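(* Let $M$ be a compact metric space, $\sigma:M\to M$ a continuous map, and let $H(\lambda,x,y)=(\sigma(\lambda),H_\lambda(x,y))$ be a fibered family of Hénon maps of degree $d$ over $(M,\sigma)$ (as defined in the context). Then the sequences $G_{n,\lambda}^{\pm}$ converge, as $n\to\infty$, uniformly on compact subsets of $M\times\mathbb{C}^2$ to continuous functions $G_\lambda^{\pm}$ that satisfy, for every $\lambda\in M$, $$ d\, G_\lambda^{\pm} = G_{\sigma(\lambda)}^{\pm}\circ H_\lambda^{\pm 1}\quad\text{on }\mathbb{C}^2 .$$ For each $\lambda\in M$ the functions $G_\lambda^{\pm}$ are positive pluriharmonic on $\mathbb{C}^2\setminus K_\lambda^{\pm}$, plurisubharmonic on $\mathbb{C}^2$, and vanish precisely on $K_\lambda^{\pm}$. The correspondence $\lambda\mapsto G_\lambda^{\pm}$ is continuous (with respect to uniform convergence on compact subsets of $\mathbb{C}^2$). If moreover $\sigma$ is surjective, then $G_\lambda^+$ is locally uniformly Hölder continuous, i.e., for each compact $S\subset\mathbb{C}^2$ there exist constants $\tau,C>0$, depending only on $S$ and the map $H$ (in particular not on $\lambda$), such that $$ |G_\lambda^+(x,y)-G_\lambda^+(x',y')|\le C\,\|(x,y)-(x',y')\|^{\tau}$$ for all $(x,y),(x',y')\in S$ and all $\lambda\in M$.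
   Context: Fibered family of Hénon maps over $(M,\sigma)$: fix $m\ge1$ and integers $d_1,\dots,d_m\ge2$ and put $d=d_1d_2\cdots d_m$. For each $\lambda\in M$, $H_\lambda=H_\lambda^{(m)}\circ H_\lambda^{(m-1)}\circ\cdots\circ H_\lambda^{(1)}:\mathbb{C}^2\to\mathbb{C}^2$, where for $1\le j\le m$, $H_\lambda^{(j)}(x,y)=(y,\;p_{j,\lambda}(y)-a_j(\lambda)x)$, with $p_{j,\lambda}$ a monic polynomial of degree $d_j$ whose coefficients are continuous functions of $\lambda\in M$, and $a_j:M\to\mathbb{C}$ a continuous non-vanishing function. Define $H:M\times\mathbb{C}^2\to M\times\mathbb{C}^2$ by $H(\lambda,x,y)=(\sigma(\lambda),H_\lambda(x,y))$. For $n\ge0$ put $H_\lambda^{\pm n}=H_{\sigma^{n-1}(\lambda)}^{\pm1}\circ\cdots\circ H_{\sigma(\lambda)}^{\pm1}\circ H_\lambda^{\pm1}$ (identity for $n=0$); thus $H_\lambda^{-n}$ is in general not the inverse of $H_\lambda^{+n}$. $K_\lambda^{\pm}=\{z\in\mathbb{C}^2:\ \text{the sequence }\{H_\lambda^{\pm n}(z)\}_n\text{ is bounded}\}$. For $n\ge1$, $G_{n,\lambda}^{\pm}(x,y)=\frac1{d^n}\log^+\|H_\lambda^{\pm n}(x,y)\|$, where $\log^+t=\max\{\log t,0\}$. Statements with $\pm$ are understood as two statements, one for all upper signs and one for all lower signs. *)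

(* Defs.v *)
From HB Require Import structures.
From mathcomp Require Import all_boot all_order all_algebra.
From mathcomp Require Import all_classical all_reals all_analysis.
From mathcomp Require Import complex.
Set Implicit Arguments.
Unset Strict Implicit.
Unset Printing Implicit Defensive.
Import Order.TTheory GRing.Theory Num.Theory.
Import numFieldNormedType.Exports.
Local Open Scope classical_set_scope.
Local Open Scope ring_scope.
Local Open Scope complex_scope.

(* R[i] typed as a numClosedFieldType: this is what triggers the topology and
   the normed-module structure that numFieldNormedType.Exports puts on number
   fields (they are not inferred on the bare R[i]). *)
Definition Cplx (R : realType) : numClosedFieldType := R[i].
Definition C2 (R : realType) : normedModType (Cplx R) :=
  (Cplx R * Cplx R)%type.

(* The Hermitian norm; the norm provided by the library on a product is the
   sup norm and takes its values in R[i]. *)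
Definition norm2 (R : realType) (z : C2 R) : R :=
  Num.sqrt (Normc.normc z.1 ^+ 2 + Normc.normc z.2 ^+ 2).

Definition log_plus (R : realType) (t : R) : R := Num.max (ln t) 0.

Section potential_theory.
Context {R : realType}.

Section smoothness.
Context {V : normedModType (Cplx R)}.
Implicit Types (u : V -> R) (v z : V) (Omega : set V).

Definition line u v z (t : R) : R := u (z + (t%:C : Cplx R) *: v).

Definition rderivable u v z : Prop := derivable (line u v z) 0 1.
Definition rderive v u z : R := derive1 (line u v z) 0.

(* C^2 as a function on the underlying real vector space.  Quantifying over all
   real directions rather than over a real basis makes no difference here:
   V will be C or C^2. *)
Definition C2_on Omega u : Prop :=
  [/\ forall z, Omega z -> {for z, continuous u},
      forall v z, Omega z ->
        rderivable u v z /\ {for z, continuous (rderive v u)} &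
      forall v w z, Omega z ->
        rderivable (rderive v u) w z /\
        {for z, continuous (rderive w (rderive v u))}].
End smoothness.

Definition laplacian (v : Cplx R -> R) (zeta : Cplx R) : R :=
  let dx := rderive (1 : Cplx R) in
  let dy := rderive ('i%C : Cplx R) in
  dx (dx v) zeta + dy (dy v) zeta.

Definition harmonic_on (U : set (Cplx R)) (v : Cplx R -> R) : Prop :=
  [/\ open U, C2_on U v & forall zeta, U zeta -> laplacian v zeta = 0].

Definition pluriharmonic_on (Omega : set (C2 R)) (u : C2 R -> R) : Prop :=
  [/\ open Omega, C2_on Omega u &
      forall a b : C2 R,
        harmonic_on [set zeta | Omega (a + zeta *: b)]
                    (fun zeta => u (a + zeta *: b))].

Definition upper_semicontinuous (T : topologicalType) (u : T -> \bar R) :=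
  lower_semicontinuous (fun x => - u x)%E.

Definition cis (theta : R) : Cplx R := cos theta +i* sin theta.

(* Upper semicontinuity and u < +oo bound u from above on circles, so the
   integral is well defined in [-oo, +oo[.  The function -oo is allowed. *)
Definition subharmonic (v : Cplx R -> \bar R) : Prop :=
  [/\ forall zeta, (v zeta < +oo)%E,
      upper_semicontinuous v &
      forall (a : Cplx R) (r : R), 0 < r ->
        (v a <= ((2 * pi)^-1)%:E *
           \int[lebesgue_measure]_(theta in `[0%R, (2 * pi)%R])
              v (a + (r%:C : Cplx R) * cis theta)%R)%E].

Definition plurisubharmonic (u : C2 R -> \bar R) : Prop :=
  [/\ forall z, (u z < +oo)%E,
      upper_semicontinuous u &
      forall a b : C2 R, subharmonic (fun zeta => u (a + zeta *: b))].

End potential_theory.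

Record henonFamily (R : realType) (M : topologicalType) := HenonFamily {
  hlen : nat ;
  hlen_gt0 : (0 < hlen)%N ;
  hdeg : 'I_hlen -> nat ;
  hdeg_ge2 : forall j, (2 <= hdeg j)%N ;
  hpoly : 'I_hlen -> M -> {poly Cplx R} ;
  hpoly_monic : forall j lam, hpoly j lam \is monic ;
  hpoly_size : forall j lam, size (hpoly j lam) = (hdeg j).+1 ;
  hpoly_cont : forall j (k : nat), continuous (fun lam => (hpoly j lam)`_k) ;
  hcoef : 'I_hlen -> M -> Cplx R ;
  hcoef_neq0 : forall j lam, hcoef j lam != 0 ;
  hcoef_cont : forall j, continuous (hcoef j) }.

Variant sign := Plus | Minus.

Section henon.
Context {R : realType} {M : topologicalType} (F : henonFamily R M).
Implicit Types (lam : M) (z : C2 R) (s : sign).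

Definition degree : nat := \prod_(j < hlen F) hdeg j.

Definition factor lam (j : 'I_(hlen F)) z : C2 R :=
  (z.2, (hpoly j lam).[z.2] - hcoef j lam * z.1).

Definition factor_inv lam (j : 'I_(hlen F)) z : C2 R :=
  (((hpoly j lam).[z.1] - z.2) / hcoef j lam, z.1).

(* The factor of index 0 acts first. *)
Definition henon lam z : C2 R :=
  foldl (fun w j => factor lam j w) z (enum 'I_(hlen F)).

Definition henon_inv lam z : C2 R :=
  foldr (fun j w => factor_inv lam j w) z (enum 'I_(hlen F)).

Lemma factorK lam j : cancel (factor lam j) (factor_inv lam j).
Proof.
move=> [x y]; rewrite /factor /factor_inv /=; congr pair.
by rewrite opprB addrCA subrr addr0 mulrC mulKf // hcoef_neq0.
Qed.

Lemma factor_invK lam j : cancel (factor_inv lam j) (factor lam j).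
Proof.
move=> [x y]; rewrite /factor /factor_inv /=; congr pair.
by rewrite mulrC divfK ?hcoef_neq0 // opprB addrCA subrr addr0.
Qed.

Lemma henonK lam : cancel (henon lam) (henon_inv lam).
Proof.
rewrite /henon /henon_inv => z; elim: (enum _) z => //= j r IHr z.
by rewrite IHr factorK.
Qed.

Lemma henon_invK lam : cancel (henon_inv lam) (henon lam).
Proof.
rewrite /henon /henon_inv => z; elim: (enum _) z => //= j r IHr z.
by rewrite factor_invK IHr.
Qed.

Definition henon_pm s : M -> C2 R -> C2 R :=
  if s is Plus then henon else henon_inv.

Variable sigma : M -> M.

(* For s = Minus this composes the inverses along the forward orbit of sigma;
   it is not the inverse of the n-th iterate for s = Plus. *)
Fixpoint henon_iter s (n : nat) lam z : C2 R :=
  if n is n'.+1 then henon_pm s (iter n' sigma lam) (henon_iter s n' lam z)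
  else z.

Definition filledK s lam : set (C2 R) :=
  [set z | exists B : R, forall n, norm2 (henon_iter s n lam z) <= B].

Definition Gn s (n : nat) lam z : R :=
  (degree%:R ^+ n)^-1 * log_plus (norm2 (henon_iter s n lam z)).

End henon.

(* Main.v *)
Require Import Defs.
From HB Require Import structures.
From mathcomp Require Import all_boot all_order all_algebra.
From mathcomp Require Import all_classical all_reals all_analysis.
From mathcomp Require Import complex ring lra.
Import Order.TTheory GRing.Theory Num.Theory.
Import numFieldNormedType.Exports.
Set Implicit Arguments.
Unset Strict Implicit.
Unset Printing Implicit Defensive.
Local Open Scope classical_set_scope.
Local Open Scope ring_scope.

(** Each fiber map is a composition of elementary maps (x, y) |-> (y, q(y) - b x)
with q a polynomial of degree at least 2. Once the two coordinates are exchanged,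
the inverse of a factor (x, y) |-> (y, p(y) - a x) is of the same form, with
q = p / a and b = 1 / a. Both signs are thus instances of one situation: a
sequence of elementary maps (q_k, b_k) of degrees d_k, whose coefficients are
bounded uniformly because the base is compact [tame]. The theorem is proved for
such sequences, with constants that depend on the bounds only, and then read
along the orbit of a point of the base [orb_henon_iter].

Let N_k be the height max(1, |x_k|, |y_k|) of the k-th point of an orbit and D_k
the product of the first k degrees. An orbit that starts in a large ball either
stays in it or leaves it through the cone |x| <= |y|, which is invariant and in
which |y| grows like a power [escape_alternative, step_lower]. In both cases
N_(k+1) is comparable to N_k ^ d_k, up to a factor that depends only on the ball
[height_upper, height_lower]. Hence the potentials log N_k / D_k converge
geometrically to a limit, the function [green], uniformly on the ball and over
the base [potential_green]. This gives the uniform convergence on compact sets,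
the joint continuity and the functional equation. The limit vanishes on bounded
orbits, and it is positive on escaping ones, because the errors still to come
cannot exhaust log |y| beyond the escape radius [green_gt0].

Hoelder continuity. The comparison of heights also shows that the distance of two
orbits, relative to the height, grows at most exponentially as long as it is
below 1 [orb_lip]. The potential of order k is therefore Lipschitz with an
exponential constant, and it is within O(2^-k) of the limit; choosing k according
to the distance of the two points gives a power of this distance [green_holder].

Plurisubharmonicity. On a complex line the orbit is a pair of polynomials in the
parameter. For a polynomial P with roots a the product of |P| over N equidistant
points of a circle of radius r is computed from the numbers r^N - a^N; this yields
a discrete Jensen inequality [jensen], hence the sub-mean value inequality for
averages over N points [green_mean]. Letting N tend to infinity, Riemann sums
turn the averages into integrals [le_mean_riemann].

Pluriharmonicity. On the escaping set the limit is that of log |y_k| / D_k. With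
X, Y, Z the derivatives of y_k in directions v, w and in both, the first and
second derivatives of log |y_k| are the real parts of l = X / y and
t = Z / y - X Y / y^2, and one step replaces them by d l + O(1 / |y|) and
d t + O(1 / |y|), up to exponential factors. Far out, |y| grows by a factor as
large as desired, so that l / D_k and t / D_k converge locally uniformly
[log_jet1_step, log_jet2_step], and termwise differentiation [is_derive_limit]
shows that the limit is C^2. Its second derivative is the real part of a form that
is complex bilinear in v and w, so the derivatives along (v, v) and (i v, i v)
cancel [d2green_i]: every slice is harmonic. *)

(** * The modulus of complex numbers *)

Section modulus.
Context {R : realType}.
Implicit Types (z w : Cplx R).

(** The modulus as an element of R; the norm of [Cplx R] is valued in [Cplx R]. *)
Definition cmod z : R := Normc.normc z.

Lemma normE z : `|z| = (cmod z)%:C%C.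
Proof. by []. Qed.

Lemma cmod_ge0 z : 0 <= cmod z.
Proof. by case: z => a b; exact: sqrtr_ge0. Qed.

Lemma cmodM z w : cmod (z * w) = cmod z * cmod w.
Proof. exact: Normc.normcM. Qed.

Lemma cmod0 : cmod 0 = 0.
Proof. exact: Normc.normc0. Qed.

Lemma cmod1 : cmod 1 = 1.
Proof. exact: Normc.normc1. Qed.

Lemma cmodX z n : cmod (z ^+ n) = cmod z ^+ n.
Proof. by elim: n => [|n IH]; rewrite ?expr0 ?cmod1 // !exprS cmodM IH. Qed.

Lemma cmodN z : cmod (- z) = cmod z.
Proof. exact: normcN. Qed.

Lemma cmodV z : cmod z^-1 = (cmod z)^-1.
Proof. exact: Normc.normcV. Qed.

Lemma cmodD z w : cmod (z + w) <= cmod z + cmod w.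
Proof. exact: le_normcD. Qed.

Lemma cmodB z w : cmod (z - w) <= cmod z + cmod w.
Proof. by rewrite -(cmodN w); exact: cmodD. Qed.

Lemma cmodC z w : cmod (z - w) = cmod (w - z).
Proof. by rewrite -cmodN opprB. Qed.

Lemma cmod_dist z w : `|cmod z - cmod w| <= cmod (z - w).
Proof.
have := cmodD (z - w) w; have := cmodD (w - z) z.
by rewrite !subrK (cmodC w) ler_norml; move=> *; apply/andP; split; lra.
Qed.

Lemma cmod_eq0 z : (cmod z == 0) = (z == 0).
Proof.
apply/eqP/eqP => [/Normc.eq0_normc //|->]; exact: cmod0.
Qed.

Lemma cmod_gt0 z : (0 < cmod z) = (z != 0).
Proof. by rewrite lt_neqAle eq_sym cmod_eq0 cmod_ge0 andbT. Qed.

Lemma cmod_sum (I : Type) (r : seq I) (P : pred I) (f : I -> Cplx R) :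
  cmod (\sum_(i <- r | P i) f i) <= \sum_(i <- r | P i) cmod (f i).
Proof.
elim/big_rec2 : _ => [|i x y _ h]; first by rewrite cmod0.
by rewrite (le_trans (cmodD _ _)) // lerD2l.
Qed.

Lemma cmod_real (x : R) : cmod (x%:C)%C = `|x|.
Proof. by rewrite /cmod /= expr0n addr0 sqrtr_sqr. Qed.

Lemma cmod_nat n : cmod n%:R = n%:R.
Proof. by rewrite -(rmorph_nat (real_complex R)) cmod_real normr_nat. Qed.

Lemma Re_cmod z : `|complex.Re z| <= cmod z.
Proof.
case: z => a b; rewrite /cmod /= -(sqrtr_sqr a) ler_sqrt ?lerDl ?sqr_ge0 //.
by rewrite addr_ge0 ?sqr_ge0.
Qed.

(** Replaces the complex radii of the topology of [Cplx R] by real ones. *)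
Lemma nbhs_cmodP z (P : set (Cplx R)) :
  nbhs z P <-> exists2 e : R, 0 < e & forall w, cmod (z - w) < e -> P w.
Proof.
split=> [/nbhs_ballP[e /= e0 he]|[e e0 he]].
  have [er ee] : 0 < complex.Re e /\ e = (complex.Re e)%:C%C.
    by move: e0; case: e {he} => a b /=; rewrite ltcE /= => /andP[/eqP -> ->].
  exists (complex.Re e) => // w h; apply: he.
  by rewrite -ball_normE /ball_ /= ee normE ltcR.
apply/nbhs_ballP; exists (e%:C)%C => /=; first by rewrite ltcR.
by move=> w; rewrite -ball_normE /ball_ /= normE ltcR => /he.
Qed.

Lemma cvg_cmodP (T : Type) (F : set_system T) (FF : Filter F)
    (f : T -> Cplx R) z :
  f @ F --> z <-> forall e : R, 0 < e -> \forall t \near F, cmod (z - f t) < e.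
Proof.
split=> [h e e0|h P /nbhs_cmodP[e e0 he]].
  by apply: (h [set w | cmod (z - w) < e]); apply/nbhs_cmodP; exists e.
by apply: filterS (h e e0) => t ht; exact: he.
Qed.

Lemma cmod_continuous : continuous (cmod : Cplx R -> R).
Proof.
move=> z; apply/(@cvgrPdist_lt _ _ _ _ (nbhs_filter z)) => e e0.
apply/nbhs_cmodP; exists e => // w h.
exact: le_lt_trans (cmod_dist _ _) h.
Qed.

Lemma Re_continuous : continuous (@complex.Re R : Cplx R -> R).
Proof.
move=> z; apply/(@cvgrPdist_lt _ _ _ _ (nbhs_filter z)) => e e0.
apply/nbhs_cmodP; exists e => // w h.
apply: le_lt_trans h; rewrite -(raddfB (@complex.Re R)).
exact: Re_cmod.
Qed.

Section cvg_cplx.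
Context {X : Type} {F : set_system X} {FF : Filter F}.
Implicit Types (f g : X -> Cplx R) (l m : Cplx R).

Lemma cvg_cplxD f g l m : f x @[x --> F] --> l -> g x @[x --> F] --> m ->
  f x + g x @[x --> F] --> l + m.
Proof. exact: (@cvgD (Cplx R) (Cplx R)). Qed.

Lemma cvg_cplxB f g l m : f x @[x --> F] --> l -> g x @[x --> F] --> m ->
  f x - g x @[x --> F] --> l - m.
Proof. exact: (@cvgB (Cplx R) (Cplx R)). Qed.

Lemma cvg_cplxM f g l m : f x @[x --> F] --> l -> g x @[x --> F] --> m ->
  f x * g x @[x --> F] --> l * m.
Proof. exact: (@cvgM (Cplx R)). Qed.

Lemma cvg_cplxV f l : l != 0 -> f x @[x --> F] --> l ->
  (f x)^-1 @[x --> F] --> l^-1.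
Proof. exact: (@cvgV (Cplx R)). Qed.

Lemma cvg_horner (p : {poly Cplx R}) f l :
  f x @[x --> F] --> l -> p.[f x] @[x --> F] --> p.[l].
Proof.
move=> fl; elim/poly_ind: p => [|p c IH].
  by rewrite horner0; under eq_fun do rewrite horner0; exact: cvg_cst.
rewrite hornerMXaddC; under eq_fun do rewrite hornerMXaddC.
by apply: cvg_cplxD; [exact: cvg_cplxM|exact: cvg_cst].
Qed.

End cvg_cplx.

End modulus.

Lemma cvg_sum {K : numFieldType} {V : normedModType K} {T : Type}
    (F : set_system T) {FF : Filter F} (I : Type) (r : seq I)
    (f : I -> T -> V) (l : I -> V) :
  (forall i, f i x @[x --> F] --> l i) ->
  \sum_(i <- r) f i x @[x --> F] --> \sum_(i <- r) l i.
Proof.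
move=> fl; apply: (cvg_big (op := +%R)) => //; exact: add_continuous.
Qed.

(** * Escape of orbits and the Green function *)

Section geometric_sequence.
Context {R : realType}.
Implicit Types (u : nat -> R) (c : R).

Lemma half_pow_cvg0 c : c / 2 ^+ n @[n --> \oo] --> (0 : R).
Proof.
have := @cvg_geometric R c 2^-1.
rewrite ger0_norm ?invr_ge0 // invf_lt1 ?ltr1n // => /(_ isT).
by apply: cvg_trans; apply: near_eq_cvg; near=> n; rewrite /= exprVn.
Unshelve. all: by end_near. Qed.

(** The sequences u + c / 2^n and u - c / 2^n are monotone, in opposite
directions, and the limit lies between them. *)
Lemma geometric_cvg u c : (forall n, `|u n.+1 - u n| <= c / 2 ^+ n.+1) ->
  cvgn u /\ forall n, `|u n - limn u| <= c / 2 ^+ n.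
Proof.
move=> h; have c2 n : c / 2 ^+ n = c / 2 ^+ n.+1 + c / 2 ^+ n.+1.
  by rewrite exprS; field; rewrite expf_neq0.
have c0 n : 0 <= c / 2 ^+ n.
  by rewrite c2 addr_ge0 // (le_trans (normr_ge0 _) (h n)).
pose a n := u n + c / 2 ^+ n; pose b n := u n - c / 2 ^+ n.
have amon : {homo a : n m / (n <= m)%N >-> m <= n}.
  apply/nonincreasing_seqP => n; rewrite /a (c2 n).
  by have := h n; rewrite ler_norml => /andP[_]; lra.
have bmon : {homo b : n m / (n <= m)%N >-> n <= m}.
  apply/nondecreasing_seqP => n; rewrite /b (c2 n).
  by have := h n; rewrite ler_norml => /andP[]; lra.
have acvg : cvgn a.
  apply: nonincreasing_is_cvgn => //; exists (b 0%N) => _ [n _ <-].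
  apply: (le_trans (bmon 0%N n (leq0n n))).
  by rewrite /a /b; have := c0 n; lra.
have ua : u n @[n --> \oo] --> limn a.
  have -> : u = (fun n => a n - c / 2 ^+ n).
    by apply/funext => n; rewrite /a addrK.
  by rewrite -[limn a]subr0; apply: cvgB => //; exact: half_pow_cvg0.
have ul : limn u = limn a by exact/cvg_lim.
split=> [|n]; first by apply/cvg_ex; exists (limn a).
have bl : b @ \oo --> limn a.
  by rewrite -[limn a]subr0; apply: cvgB => //; exact: half_pow_cvg0.
have h1 := nonincreasing_cvgn_ge amon acvg n.
have bcvg : cvgn b by apply/cvg_ex; exists (limn a).
have h2 := nondecreasing_cvgn_le bmon bcvg n.
have bla : limn b = limn a by exact/cvg_lim.
rewrite ul; rewrite bla in h2; move: h1 h2; rewrite /a /b => h1 h2.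
by rewrite ler_norml; apply/andP; split; lra.
Qed.

End geometric_sequence.

Section logarithm.
Context {R : realType}.
Implicit Types (x y c : R).

Lemma ln_leM x y c n : 0 < x -> 0 < y -> 0 < c ->
  x ^+ n <= c * y -> ln x *+ n <= ln c + ln y.
Proof.
move=> x0 y0 c0 h; rewrite -lnXn // -lnM ?posrE //.
by rewrite ler_ln ?posrE ?mulr_gt0 ?exprn_gt0.
Qed.

Lemma ln_geM x y c n : 0 < x -> 0 < y -> 0 < c ->
  y <= c * x ^+ n -> ln y <= ln c + ln x *+ n.
Proof.
move=> x0 y0 c0 h; rewrite -lnXn // -lnM ?posrE ?exprn_gt0 //.
by rewrite ler_ln ?posrE ?mulr_gt0 ?exprn_gt0.
Qed.

End logarithm.

Section system.
Context {R : realType}.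
Local Notation C := (Cplx R).

(** An elementary Henon map. *)
Definition step (p : {poly C}) (c : C) (z : C2 R) : C2 R :=
  (z.2, p.[z.2] - c * z.1).

(** Uniform control of a sequence of elementary maps by one constant. The degree of
q_k is written [(e k).+2], which makes it at least 2. The fields [tame_euler] and
[tame_euler2] express that y q' - d q and y^2 q'' - d (d - 1) q have degree less
than d = deg q, the leading terms being cancelled. *)
Record tame (A : R) (q : nat -> {poly C}) (b : nat -> C) (e : nat -> nat) :
    Prop := Tame {
  tame_ge1 : 1 <= A ;
  tame_deg : forall k, ((e k).+2)%:R <= A ;
  tame_coef : forall k, cmod (b k) <= A ;
  tame_upper : forall k N y, 1 <= N -> cmod y <= N ->
    cmod (q k).[y] <= A * N ^+ (e k).+2 ;
  tame_lower : forall k y, 1 <= cmod y ->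
    cmod y ^+ (e k).+2 <= A * (cmod (q k).[y] + cmod y ^+ (e k).+1) ;
  tame_lip : forall k N y y', 1 <= N -> cmod y <= N -> cmod y' <= N ->
    cmod ((q k).[y] - (q k).[y']) <= A * N ^+ (e k).+1 * cmod (y - y') ;
  tame_euler : forall k N y, 1 <= N -> cmod y <= N ->
    cmod (y * (q k)^`().[y] - (e k).+2%:R * (q k).[y]) <= A * N ^+ (e k).+1 ;
  tame_euler2 : forall k N y, 1 <= N -> cmod y <= N ->
    cmod (y ^+ 2 * (q k)^`()^`().[y]
          - ((e k).+2 * (e k).+1)%:R * (q k).[y]) <= A * N ^+ (e k).+1 }.

(** Its logarithm is the maximum of log^+ |x| and log^+ |y|. *)
Definition height (z : C2 R) : R := Num.max 1 (Num.max (cmod z.1) (cmod z.2)).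

Lemma height_ge1 z : 1 <= height z.
Proof. by rewrite /height le_max lexx. Qed.

Lemma height_gt0 z : 0 < height z.
Proof. exact: lt_le_trans ltr01 (height_ge1 z). Qed.

Lemma height_ge_fst z : cmod z.1 <= height z.
Proof. by rewrite /height !le_max lexx !orbT. Qed.

Lemma height_ge_snd z : cmod z.2 <= height z.
Proof. by rewrite /height !le_max lexx !orbT. Qed.

Lemma height_le z (B : R) :
  1 <= B -> cmod z.1 <= B -> cmod z.2 <= B -> height z <= B.
Proof. by move=> *; rewrite /height !ge_max; apply/and3P; split. Qed.

Lemma height_dist z w :
  `|height z - height w| <= Num.max (cmod (z.1 - w.1)) (cmod (z.2 - w.2)).
Proof.
set d := Num.max _ _.
have d1 : cmod (z.1 - w.1) <= d by rewrite le_max lexx.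
have d2 : cmod (z.2 - w.2) <= d by rewrite le_max lexx orbT.
have dge0 : 0 <= d by exact: le_trans (cmod_ge0 _) d1.
have h1 := cmod_dist z.1 w.1; have h2 := cmod_dist z.2 w.2.
move: h1 h2; rewrite !ler_norml => /andP[h1 h1'] /andP[h2 h2'].
have zz1 := height_ge_fst z; have zz2 := height_ge_snd z.
have ww1 := height_ge_fst w; have ww2 := height_ge_snd w.
have z1 := height_ge1 z; have w1 := height_ge1 w.
have : height z <= height w + d by apply: height_le; lra.
have : height w <= height z + d by apply: height_le; lra.
by move=> *; apply/andP; split; lra.
Qed.

(** Unbounded orbits leave every large ball through this cone. *)
Definition escaped (r : R) (z : C2 R) : Prop := cmod z.1 <= cmod z.2 /\ r <= cmod z.2.

(** If |y| is at least this radius then |y| / A is at least 2 (1 + A), and half of the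
leading term of q outweighs the lower terms and b x. *)
Definition escape_radius (A : R) : R := 2 * A * (1 + A).

Variables (A : R) (q : nat -> {poly C}) (b : nat -> C) (e : nat -> nat).
Hypothesis T : tame A q b e.

Let A1 : 1 <= A := tame_ge1 T.
Let A0 : 0 < A. Proof. exact: lt_le_trans ltr01 A1. Qed.

Lemma escape_radius_ge4 : 4 <= escape_radius A.
Proof. by rewrite /escape_radius; have := A1; nra. Qed.

Lemma step_lower k z : escaped (escape_radius A) z ->
  cmod z.2 ^+ (e k).+2 <= 2 * A * cmod (step (q k) (b k) z).2.
Proof.
case: z => x y [/= xy ry]; set t := cmod y in xy ry *.
have t4 : 4 <= t by exact: le_trans escape_radius_ge4 ry.
have t1 : 1 <= t by lra.
have low := tame_lower T k t1; rewrite -/t in low.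
have bx : cmod (b k * x) <= A * t ^+ (e k).+1.
  rewrite cmodM; apply: (@le_trans _ _ (A * t)).
    by apply: ler_pM => //; rewrite ?cmod_ge0 // (tame_coef T).
  by rewrite ler_pM2l // ler_eXnr.
have tri : cmod (q k).[y] <= cmod ((q k).[y] - b k * x) + cmod (b k * x).
  by rewrite -{1}(subrK (b k * x) (q k).[y]) cmodD.
set s := cmod (_ - _) in tri *; set p := cmod (q k).[y] in low tri.
rewrite exprS in low *; set u := t ^+ _ in low bx *.
have u0 : 0 < u by rewrite exprn_gt0 //; lra.
have rr : 2 * A * (1 + A) * u <= t * u by rewrite ler_pM2r.
have h : A * p <= A * (s + A * u) by rewrite ler_pM2l //; lra.
nra.
Qed.

Lemma step_grow k K z : escaped (escape_radius A) z -> 2 * A * K <= cmod z.2 ->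
  K * cmod z.2 <= cmod (step (q k) (b k) z).2.
Proof.
move=> ez Kz; have h := step_lower k ez.
have t4 : 4 <= cmod z.2 by exact: le_trans escape_radius_ge4 ez.2.
set t := cmod z.2 in Kz h t4 *.
have [t0 t1] : 0 <= t /\ 1 <= t by split; lra.
have : t * t <= t ^+ (e k).+2.
  by rewrite !exprS mulrA ler_peMr ?mulr_ge0 ?exprn_ege1.
have tt : 2 * A * K * t <= t * t by rewrite ler_wpM2r.
move=> h2; rewrite -(ler_pM2l (_ : 0 < 2 * A)); last by have := A1; lra.
by rewrite mulrA (le_trans tt) // (le_trans h2).
Qed.

Lemma step_escaped k r z : escape_radius A <= r -> escaped r z ->
  escaped r (step (q k) (b k) z) /\ 2 * cmod z.2 <= cmod (step (q k) (b k) z).2.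
Proof.
move=> rr [xy rz]; have ez : escaped (escape_radius A) z by split=> //; exact: le_trans rz.
have z4 : 4 <= cmod z.2 by exact: le_trans escape_radius_ge4 ez.2.
have h : 2 * cmod z.2 <= cmod (step (q k) (b k) z).2.
  apply: step_grow => //; apply: le_trans ez.2.
  by rewrite /escape_radius; have := A1; nra.
by split=> //; split; rewrite /=; move: h => /=; lra.
Qed.

Lemma escaped_height r z : escape_radius A <= r -> escaped r z -> height z = cmod z.2.
Proof.
move=> rr [xy rz]; rewrite /height; have := escape_radius_ge4 => r4.
by rewrite (max_r xy) max_r //; lra.
Qed.

Fixpoint orb k z : C2 R :=
  if k is k'.+1 then step (q k') (b k') (orb k' z) else z.

Lemma escaped_orb r j k z : escape_radius A <= r -> escaped r (orb k z) ->
  (k <= j)%N -> escaped r (orb j z).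
Proof.
move=> rr ez /subnK <-; elim: (j - k)%N => // n IH.
exact: (step_escaped _ rr IH).1.
Qed.

(** A step (x, y) |-> (y, y') that leaves the ball has |y'| > B >= |y|, so it lands in
the cone, and the cone is invariant. *)
Lemma escape_alternative B z : escape_radius A <= B -> height z <= B ->
  forall k, height (orb k z) <= B \/ escaped B (orb k z).
Proof.
move=> rB zB; have B4 : 4 <= B by exact: le_trans escape_radius_ge4 rB.
elim=> [|k [IH|IH]]; first by left.
- set w := orb k z in IH *.
  have w2 : cmod w.2 <= B by exact: le_trans (height_ge_snd _) IH.
  case: (lerP (cmod (step (q k) (b k) w).2) B) => h.
    by left; apply: height_le => //=; lra.
  by right; split => /=; move: h => /=; lra.
- by right; apply: (step_escaped k rB IH).1.
Qed.

Lemma height_upper k z :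
  height (step (q k) (b k) z) <= 2 * A * height z ^+ (e k).+2.
Proof.
set N := height z.
have N1 : 1 <= N := height_ge1 z.
have y1 : cmod z.2 <= N := height_ge_snd z.
have x1 : cmod z.1 <= N := height_ge_fst z.
have NN : N <= N ^+ (e k).+2 by rewrite ler_eXnr.
have AN : N ^+ (e k).+2 <= A * N ^+ (e k).+2 by rewrite ler_peMl //; lra.
have qb := tame_upper T k N1 y1.
have bb : cmod (b k * z.1) <= A * N ^+ (e k).+2.
  rewrite cmodM; apply: ler_pM; rewrite ?cmod_ge0 // ?(tame_coef T) //.
  exact: le_trans NN.
have := cmodB (q k).[z.2] (b k * z.1).
by move=> h; apply: height_le => /=; lra.
Qed.

(** The exponent bounds all degrees of a tame sequence. *)
Definition cmp_const (B : R) : R := 2 * A * B ^+ Num.truncn A.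

Lemma cmp_const_ge B : 1 <= B -> 2 * A <= cmp_const B.
Proof. by move=> B1; rewrite /cmp_const ler_peMr ?exprn_ege1 //; have := A1; lra. Qed.

(** Inside the ball the constant alone exceeds the left-hand side; in the cone the
height is |y| and the leading term of q dominates. *)
Lemma height_lower B k z : escape_radius A <= B ->
  height z <= B \/ escaped B z ->
  height z ^+ (e k).+2 <= cmp_const B * height (step (q k) (b k) z).
Proof.
move=> rB; have B4 : 4 <= B by exact: le_trans escape_radius_ge4 rB.
have B1 : 1 <= B by lra.
have cB := cmp_const_ge B1.
case=> [zB|ez].
  apply: (@le_trans _ _ (cmp_const B * 1)); last first.
    by rewrite ler_pM2l ?height_ge1 //; have := A1; lra.
  rewrite mulr1 /cmp_const; apply: (@le_trans _ _ (B ^+ Num.truncn A)).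
    apply: (@le_trans _ _ (B ^+ (e k).+2)).
      by rewrite lerXn2r // ?nnegrE; have := height_gt0 z; lra.
    rewrite ler_weXn2l // truncn_ge_nat ?(tame_deg T) //; exact: ltW.
  by rewrite ler_peMl ?exprn_ge0 //; have := A1; lra.
rewrite (escaped_height rB ez).
have ez' : escaped (escape_radius A) z by case: ez => h1 h2; split=> //; exact: le_trans h2.
apply: (le_trans (step_lower k ez')).
apply: ler_pM; rewrite ?cmod_ge0 ?height_ge_snd //.
by have := A1; lra.
Qed.

Definition total_deg k : R := \prod_(i < k) (e i).+2%:R.

Lemma total_degS k : total_deg k.+1 = total_deg k * (e k).+2%:R.
Proof. by rewrite /total_deg big_ord_recr. Qed.

Lemma total_deg_ge k : 2 ^+ k <= total_deg k.
Proof.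
elim: k => [|k IH]; first by rewrite /total_deg big_ord0.
by rewrite total_degS exprSr; apply: ler_pM; rewrite ?exprn_ge0 ?ler_nat.
Qed.

Lemma total_deg_gt0 k : 0 < total_deg k.
Proof. by apply: lt_le_trans (total_deg_ge k); rewrite exprn_gt0. Qed.

Definition potential k z : R := ln (height (orb k z)) / total_deg k.

Lemma ln_height_ge0 z : 0 <= ln (height z).
Proof. by rewrite ln_ge0 // height_ge1. Qed.

Lemma potential_ge0 k z : 0 <= potential k z.
Proof. by rewrite divr_ge0 ?ln_height_ge0 // ltW // total_deg_gt0. Qed.

Lemma ln_cmp_ge0 B : 1 <= B -> 0 <= ln (cmp_const B).
Proof. by move=> /cmp_const_ge h; rewrite ln_ge0 //; have := A1; lra. Qed.

Lemma potential_step B z k : escape_radius A <= B -> height z <= B ->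
  `|potential k.+1 z - potential k z| <= ln (cmp_const B) / 2 ^+ k.+1.
Proof.
move=> rB zB; have B4 : 4 <= B by exact: le_trans escape_radius_ge4 rB.
have B1 : 1 <= B by lra.
have cB := cmp_const_ge B1; have cB0 := ln_cmp_ge0 B1.
have alt := escape_alternative rB zB k.
rewrite /potential /= total_degS; set w := orb k z in alt *.
have lo := height_lower k rB alt; have up := height_upper k w.
set w' := step _ _ w in lo up *.
have c0 : 0 < cmp_const B by have := A1; lra.
have hX : 0 < height w ^+ (e k).+2 by rewrite exprn_gt0 // height_gt0.
have w0 := height_gt0 w; have w'0 := height_gt0 w'.
have lo' := ln_leM w0 w'0 c0 lo.
have up' : ln (height w') <= ln (cmp_const B) + ln (height w) *+ (e k).+2.
  by apply: ln_geM => //; apply: (le_trans up); rewrite ler_pM2r.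
have D0 := total_deg_gt0 k; have D2 := total_deg_ge k.+1; rewrite total_degS in D2.
set d := (e k).+2%:R in D2 *; have d0 : 0 < d by rewrite ltr0n.
have Dd : 0 < total_deg k * d by rewrite mulr_gt0.
have -> : ln (height w') / (total_deg k * d) - ln (height w) / total_deg k =
   (ln (height w') - d * ln (height w)) / (total_deg k * d).
  by field; rewrite !gt_eqF.
rewrite normrM [`|_^-1|]gtr0_norm ?invr_gt0 //.
apply: ler_pM; rewrite ?invr_ge0 //; first exact: ltW.
  move: lo' up'; rewrite -(mulr_natl (ln (height w))) -/d => lo' up'.
  rewrite ler_norml; apply/andP; split; rewrite ?lerBlDr ?lerBrDr //.
  by rewrite addrC lerBlDr addrC.
by rewrite lef_pV2 // posrE exprn_gt0.
Qed.

Definition green z : R := limn (potential ^~ z).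

Lemma potential_green B z k : escape_radius A <= B -> height z <= B ->
  `|potential k z - green z| <= ln (cmp_const B) / 2 ^+ k.
Proof.
move=> rB zB.
exact: (geometric_cvg (fun k => potential_step k rB zB)).2.
Qed.

Lemma potential_cvg z : potential k z @[k --> \oo] --> green z.
Proof.
have rB : escape_radius A <= Num.max (escape_radius A) (height z) by rewrite le_max lexx.
have zB : height z <= Num.max (escape_radius A) (height z) by rewrite le_max lexx orbT.
exact: (geometric_cvg (fun k => potential_step k rB zB)).1.
Qed.

Lemma green_ge0 z : 0 <= green z.
Proof.
apply: limr_ge; first by apply/cvg_ex; exists (green z); exact: potential_cvg.
by near=> k; exact: potential_ge0.
Unshelve. all: by end_near. Qed.

(** From the escape on, the difference of log |y_j| / D_j and log (2 A) / D_j increases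
with j, and it starts positive since |y| exceeds 2 A. *)
Lemma green_gt0 k z : escaped (escape_radius A) (orb k z) -> 0 < green z.
Proof.
move=> ez; pose c := ln (2 * A).
have c0 : 0 <= c by rewrite ln_ge0 //; have := A1; lra.
pose h j := potential j z - c / total_deg j.
have hmon j : (k <= j)%N -> h j <= h j.+1.
  move=> kj; have ej := escaped_orb (lexx _) ez kj.
  have ej' := (step_escaped j (lexx _) ej).1.
  rewrite /h /potential /= total_degS.
  rewrite (escaped_height (lexx _) ej) (escaped_height (lexx _) ej').
  have lo := step_lower j ej; set w := orb j z in lo ej ej' *.
  have w0 : 0 < cmod w.2 by have := escape_radius_ge4; have := ej.2; lra.
  have w'0 : 0 < cmod (step (q j) (b j) w).2 by have := escape_radius_ge4; have := ej'.2; lra.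
  have A2 : 0 < 2 * A by have := A1; lra.
  have lo' : ln (cmod w.2) *+ (e j).+2 <= c + ln (cmod (step (q j) (b j) w).2).
    exact: ln_leM.
  have D0 := total_deg_gt0 j; set l := ln (cmod w.2) in lo' *; set l' := ln _ in lo' *.
  rewrite -mulrBl -mulrBl.
  have d2 : 2 <= (e j).+2%:R :> R by rewrite ler_nat.
  move: lo'; rewrite -(mulr_natr l); set d := (e j).+2%:R in d2 * => lo'.
  have d0 : 0 < d by lra.
  rewrite ler_pdivlMr ?mulr_gt0 //.
  have -> : (l - c) / total_deg j * (total_deg j * d) = (l - c) * d by field; rewrite gt_eqF.
  nra.
have hk0 : 0 < h k.
  rewrite /h /potential (escaped_height (lexx _) ez) -mulrBl divr_gt0 ?total_deg_gt0 //.
  rewrite subr_gt0 /c ltr_ln ?posrE; have := A1; have := ez.2; rewrite /escape_radius; nra.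
have hge n : (k <= n)%N -> h k <= h n.
  move=> /subnK <-; elim: (n - k)%N => // i IH.
  by rewrite addSn (le_trans IH) // hmon // leq_addl.
apply: (lt_le_trans hk0); apply: limr_ge.
  by apply/cvg_ex; exists (green z); exact: potential_cvg.
near=> n; apply: (@le_trans _ _ (h n)); first by apply: hge; near: n; exact: nbhs_infty_ge.
by rewrite /h lerBlDr lerDl divr_ge0 // ltW // total_deg_gt0.
Unshelve. all: by end_near. Qed.

End system.

(** * Hoelder continuity *)

Section holder.
Context {R : realType}.
Local Notation C := (Cplx R).

Definition dist2 (z w : C2 R) : R := Num.max (cmod (z.1 - w.1)) (cmod (z.2 - w.2)).

Lemma dist2_ge0 z w : 0 <= dist2 z w.
Proof. by rewrite /dist2 le_max cmod_ge0. Qed.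

Lemma dist2C z w : dist2 z w = dist2 w z.
Proof. by rewrite /dist2 !(cmodC z.1) (cmodC z.2). Qed.

Lemma dist2_le_norm2 (z w : C2 R) : dist2 z w <= norm2 (z - w).
Proof.
rewrite /dist2 /norm2 -!/(cmod _) /= ge_max; apply/andP; split.
  by rewrite -{1}(ger0_norm (cmod_ge0 _)) -sqrtr_sqr ler_wsqrtr // lerDl sqr_ge0.
by rewrite -{1}(ger0_norm (cmod_ge0 (_ - w.2))) -sqrtr_sqr ler_wsqrtr // lerDr sqr_ge0.
Qed.

Definition lip_const (A B : R) : R := A * 2 ^+ Num.truncn A * cmp_const A B.

Section lipschitz.
Variables (A : R) (q : nat -> {poly C}) (b : nat -> C) (e : nat -> nat).
Hypothesis T : tame A q b e.
Local Notation orb := (orb q b).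

Lemma lip_const_ge1 B : 1 <= B -> 1 <= lip_const A B.
Proof.
move=> B1; have A1 := tame_ge1 T; have h := cmp_const_ge T B1.
have p1 : 1 <= 2 ^+ Num.truncn A :> R by rewrite exprn_ege1 // ler1n.
by apply: mulr_ege1; [exact: mulr_ege1|lra].
Qed.

(** One step multiplies distances by a constant times N^(d - 1), where N is the height,
while the height itself becomes N^d up to a constant: relative to the height,
distances grow by a bounded factor. A relative distance of at most 1 keeps the
second orbit at comparable height. *)
Lemma orb_lip B z w k : escape_radius A <= B -> height z <= B ->
  lip_const A B ^+ k * dist2 z w <= 1 ->
  dist2 (orb k z) (orb k w) <= lip_const A B ^+ k * dist2 z w * height (orb k z).
Proof.
move=> rB zB; have B4 : 4 <= B by exact: le_trans (escape_radius_ge4 T) rB.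
have A1 := tame_ge1 T.
have L1 : 1 <= lip_const A B by apply: lip_const_ge1; lra.
have d0 := dist2_ge0 z w.
elim: k => [_|k IH]; first by rewrite expr0 mul1r ler_peMr ?height_ge1.
rewrite exprS -mulrA => h.
have {}/IH : lip_const A B ^+ k * dist2 z w <= 1.
  by apply: le_trans h; rewrite ler_peMl // mulr_ge0 // exprn_ge0 //; lra.
have lo := height_lower T k rB (escape_alternative T rB zB k).
have s0 : 0 <= lip_const A B ^+ k * dist2 z w by rewrite mulr_ge0 // exprn_ge0 //; lra.
have s1 : lip_const A B ^+ k * dist2 z w <= 1.
  by apply: le_trans h; rewrite ler_peMl.
move: s0 s1 {h} => /=; set s := _ * dist2 z w => s0 s1.
set u := orb k z in lo *; set v := orb k w.
have N1 := height_ge1 u; set N := height u in N1 lo * => D.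
set D' := dist2 u v in D.
have D0 : 0 <= D' := dist2_ge0 u v.
have D1 : cmod (u.1 - v.1) <= D' by rewrite /D' le_max lexx.
have D2 : cmod (u.2 - v.2) <= D' by rewrite /D' le_max lexx orbT.
have y1 : cmod u.2 <= 2 * N by have := height_ge_snd u; rewrite -/N; lra.
have sN : s * N <= N by rewrite ler_piMl //; lra.
have y2 : cmod v.2 <= 2 * N.
  have := height_ge_snd u; rewrite -/N.
  have := cmod_dist u.2 v.2; rewrite ler_norml => /andP[]; lra.
have N2 : 1 <= 2 * N by lra.
have lip := tame_lip T k N2 y1 y2.
have P1 : 1 <= (2 * N) ^+ (e k).+1 by rewrite exprn_ege1.
set P := (2 * N) ^+ (e k).+1 in lip P1.
have key : 2 * A * P * D' <= lip_const A B * s * height (orb k.+1 z).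
  apply: (@le_trans _ _ (2 * A * P * (s * N))).
    by rewrite ler_pM2l //; nra.
  have -> : 2 * A * P * (s * N) = A * 2 ^+ (e k).+2 * s * N ^+ (e k).+2.
    by rewrite /P exprMn [N ^+ _.+2]exprS [2 ^+ _.+2]exprS; ring.
  have e2 : 2 ^+ (e k).+2 <= 2 ^+ Num.truncn A :> R.
    rewrite ler_weXn2l ?ler1n // truncn_ge_nat ?(tame_deg T) //; lra.
  apply: (@le_trans _ _ (A * 2 ^+ Num.truncn A * s * N ^+ (e k).+2)).
    apply: ler_wpM2r; first by rewrite exprn_ge0 //; lra.
    apply: ler_wpM2r => //; rewrite ler_pM2l //; lra.
  have -> : lip_const A B * s * height (orb k.+1 z) =
      A * 2 ^+ Num.truncn A * s * (cmp_const A B * height (orb k.+1 z)).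
    by rewrite /lip_const; ring.
  apply: ler_wpM2l => //.
  by rewrite mulr_ge0 // mulr_ge0 ?exprn_ge0 //; lra.
rewrite -/s; apply: le_trans key; rewrite {1}/dist2 ge_max; apply/andP; split=> /=.
  apply: (le_trans D2); rewrite ler_peMl // -mulrA; nra.
have -> : (q k).[u.2] - b k * u.1 - ((q k).[v.2] - b k * v.1) =
  ((q k).[u.2] - (q k).[v.2]) - b k * (u.1 - v.1) by ring.
apply: (le_trans (cmodB _ _)); rewrite cmodM.
have h1 : cmod (b k) * cmod (u.1 - v.1) <= A * P * D'.
  apply: ler_pM; rewrite ?cmod_ge0 //.
  by apply: (le_trans (tame_coef T k)); rewrite ler_peMr //; lra.
have h2 : A * P * cmod (u.2 - v.2) <= A * P * D'.
  by apply: ler_wpM2l => //; rewrite mulr_ge0 //; lra.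
lra.
Qed.

Lemma ln_height_lip B z w k : escape_radius A <= B -> height z <= B -> height w <= B ->
  lip_const A B ^+ k * dist2 z w <= 1 ->
  `|ln (height (orb k z)) - ln (height (orb k w))| <=
    lip_const A B ^+ k * dist2 z w.
Proof.
move=> rB; wlog suff main : z w / height z <= B ->
    lip_const A B ^+ k * dist2 z w <= 1 ->
    ln (height (orb k w)) - ln (height (orb k z)) <= lip_const A B ^+ k * dist2 z w.
  move=> zB wB h; rewrite ler_norml lerNl opprB main //=.
  by rewrite dist2C main // dist2C.
move=> zB h.
have D := orb_lip rB zB h.
set u := orb k z in D *; set v := orb k w in D *.
have u0 := height_gt0 u; have v0 := height_gt0 v.
rewrite -ln_div ?posrE // -[X in ln X](subrK 1) addrC.
apply: (@le_trans _ _ (height v / height u - 1)).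
  by apply: le_ln1Dx; rewrite ltrBrDr addrC subrr divr_gt0.
have -> : height v / height u - 1 = (height v - height u) / height u.
  by field; rewrite gt_eqF.
rewrite ler_pdivrMr //; apply: le_trans D.
have := height_dist u v; rewrite ler_norml -/(dist2 u v) => /andP[]; lra.
Qed.

(** The tails after time k are geometrically small, and the potentials of order k are
Lipschitz. *)
Lemma green_lip B z w k : escape_radius A <= B -> height z <= B -> height w <= B ->
  lip_const A B ^+ k * dist2 z w <= 1 ->
  `|green q b e z - green q b e w| <=
    2 * ln (cmp_const A B) / 2 ^+ k + lip_const A B ^+ k * dist2 z w.
Proof.
move=> rB zB wB h.
have h1 := potential_green T k rB zB; have h2 := potential_green T k rB wB.
have h3 := ln_height_lip rB zB wB h.
have h4 : `|potential q b e k z - potential q b e k w| <=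
    lip_const A B ^+ k * dist2 z w.
  rewrite /potential -mulrBl normrM; apply: le_trans h3.
  have D0 : 0 < total_deg e k :> R := total_deg_gt0 _ _.
  rewrite [`|_^-1|]gtr0_norm ?invr_gt0 //.
  rewrite ler_piMr // invf_le1 //.
  by apply: le_trans (total_deg_ge e k); rewrite exprn_ege1 // ler1n.
move: h1 h2 h4; rewrite !ler_norml -(mulrA 2).
by move=> /andP[? ?] /andP[? ?] /andP[? ?]; apply/andP; split; lra.
Qed.

Lemma green_le B z : escape_radius A <= B -> height z <= B ->
  green q b e z <= ln B + ln (cmp_const A B).
Proof.
move=> rB zB; have := potential_green T 0 rB zB.
rewrite expr0 divr1 /potential /total_deg big_ord0 divr1 /=.
have : ln (height z) <= ln B.
  by rewrite ler_ln ?posrE ?height_gt0 // (lt_le_trans (height_gt0 z)).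
by rewrite ler_norml => ? /andP[]; lra.
Qed.

End lipschitz.

Lemma powR_le (x y t : R) : 0 <= x -> x <= y -> 0 < t -> x `^ t <= y `^ t.
Proof.
move=> x0 xy t0; apply: ge0_ler_powR; rewrite ?nnegrE //; first exact: ltW.
exact: le_trans xy.
Qed.

Lemma geometric_bracket (L d : R) : 2 <= L -> 0 < d -> d < 1 ->
  exists k, L ^+ k * d <= 1 /\ 1 < L ^+ k.+1 * d.
Proof.
move=> L2 d0 d1.
have ex : exists k, 1 < L ^+ k.+1 * d.
  exists (Num.bound d^-1); rewrite -ltr_pdivrMr // div1r.
  have dv : 0 <= d^-1 by rewrite invr_ge0 ltW.
  apply: (lt_trans (archi_boundP dv)).
  set n := Num.bound _.
  apply: (@lt_le_trans _ _ (2 ^+ n)); first by rewrite -natrX ltr_nat ltn_expl.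
  apply: (@le_trans _ _ (2 ^+ n.+1)).
    by rewrite ler_weXn2l ?ler1n.
  by rewrite lerXn2r // nnegrE; lra.
case: (ex_minnP ex) => k hk mink; exists k; split=> //.
case: k hk mink => [|k] hk mink; first by rewrite expr0 mul1r ltW.
rewrite leNgt; apply/negP => /mink; rewrite ltnn //.
Qed.

(** The exponent is chosen such that L^-1 raised to it is 1 / 2. *)
Lemma holder_of_bracket (L d : R) k : 2 <= L -> 0 < d -> 1 < L ^+ k.+1 * d ->
  (2 ^+ k.+1)^-1 <= d `^ (ln 2 / ln L).
Proof.
move=> L2 d0 h; have lL : 0 < ln L by rewrite ln_gt0 //; lra.
have L0 : 0 < L by lra.
have : 0 < ln (L ^+ k.+1 * d) by rewrite ln_gt0.
rewrite lnM ?posrE ?exprn_gt0 // lnXn // => hl.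
rewrite /powR gt_eqF // -[leLHS]lnK ?posrE ?invr_gt0 ?exprn_gt0 // ler_expR.
rewrite lnV ?posrE ?exprn_gt0 // lnXn // mulrAC ler_pdivlMr //.
have l2 : 0 < ln 2 :> R by rewrite ln_gt0 // ltr1n.
move: hl; rewrite -(mulr_natr (ln L)) -(mulr_natr (ln 2)).
by set n := _%:R; nra.
Qed.

(** For the largest k such that (2 lip_const)^k times the distance is at most 1, both
error terms of [green_lip] are O(2^-k). *)
Lemma green_holder (A B : R) : 1 <= A -> escape_radius A <= B ->
  exists tau C0 : R, [/\ 0 < tau, 0 < C0 &
    forall q b e, tame A q b e -> forall z w, height z <= B -> height w <= B ->
    `|green q b e z - green q b e w| <= C0 * norm2 (z - w) `^ tau].
Proof.
move=> A1 rB.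
pose L := 2 * lip_const A B; pose c := ln (cmp_const A B).
have B1 : 1 <= B by apply: le_trans rB; rewrite /escape_radius; nra.
have c2 : 2 <= cmp_const A B.
  rewrite /cmp_const; apply: (@le_trans _ _ (2 * A * 1)); first lra.
  by rewrite ler_pM2l ?exprn_ege1 //; lra.
have c0 : 0 <= c by rewrite ln_ge0 //; lra.
have lB : 0 <= ln B by rewrite ln_ge0.
have L1 : 1 <= lip_const A B.
  have p1 : 1 <= 2 ^+ Num.truncn A :> R by rewrite exprn_ege1 // ler1n.
  by apply: mulr_ege1; [exact: mulr_ege1|lra].
have L2 : 2 <= L by rewrite /L; lra.
have lL : 0 < ln L by rewrite ln_gt0 //; lra.
have l2 : 0 < ln 2 :> R by rewrite ln_gt0 // ltr1n.
have tau0 : 0 < ln 2 / ln L by rewrite divr_gt0.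
exists (ln 2 / ln L), (2 * (2 * c + 1) + ln B); split=> //; first lra.
move=> q b e T z w zB wB; set tau := _ / _ in tau0 *.
have d0 := dist2_ge0 z w; have dn := dist2_le_norm2 z w.
apply: (@le_trans _ _ ((2 * (2 * c + 1) + ln B) * dist2 z w `^ tau)); last first.
  rewrite ler_wpM2l //; first lra.
  exact: powR_le.
set d := dist2 z w in d0 *; have p0 := powR_ge0 d tau.
case: (ltrP d 1) => d1; last first.
  have p1 : 1 <= d `^ tau.
    by have := powR_le ler01 d1 tau0; rewrite powR1.
  have g1 := green_le T rB zB; have g2 := green_le T rB wB.
  have g3 := green_ge0 T z; have g4 := green_ge0 T w.
  rewrite -/c in g1 g2; apply: (@le_trans _ _ (ln B + c)).
    by rewrite ler_norml; apply/andP; split; lra.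
  nra.
move: d0; rewrite le_eqVlt => /orP[/eqP d0|d0].
  have zw : z = w.
    have [h1 h2] : cmod (z.1 - w.1) <= 0 /\ cmod (z.2 - w.2) <= 0.
      by split; rewrite d0 /d le_max lexx ?orbT.
    case: z w h1 h2 {zB wB dn d d0 p0 d1} => [a1 a2] [a3 a4] /=.
    rewrite !le_eqVlt !ltNge !cmod_ge0 !orbF !cmod_eq0 !subr_eq0.
    by move=> /eqP -> /eqP ->.
  by rewrite zw subrr normr0 mulr_ge0 //; lra.
have [k [k1 k2]] := geometric_bracket L2 d0 d1.
have hk := holder_of_bracket L2 d0 k2; rewrite -/tau in hk.
have t0 : 0 < 2 ^+ k :> R by rewrite exprn_gt0.
have k3 : lip_const A B ^+ k * d <= (2 ^+ k)^-1.
  rewrite -[leRHS]div1r ler_pdivlMr //; apply: le_trans k1.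
  by rewrite -/d /L [(2 * _) ^+ k]exprMn [leLHS]mulrC mulrA.
have k4 : lip_const A B ^+ k * d <= 1.
  by apply: (le_trans k3); rewrite invf_le1 // exprn_ege1 // ler1n.
apply: (le_trans (green_lip T rB zB wB k4)).
rewrite -/c; move: hk; rewrite exprS invfM => hk.
set s := (2 ^+ k)^-1 in k3 hk *; have s0 : 0 <= s by rewrite invr_ge0 ltW.
set p := d `^ tau in p0 hk *.
have : (2 * c + 1) * s <= (2 * c + 1) * (2 * p) by rewrite ler_wpM2l //; lra.
have : 0 <= ln B * p by rewrite mulr_ge0.
rewrite -/d; nra.
Qed.

End holder.

(** * Riemann sums *)

Section riemann_sum.
Context {R : realType}.

Lemma uniform_modulus (h : R -> R) (a b eps : R) : continuous h -> 0 < eps ->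
  exists2 d : R, 0 < d & forall x y, a <= x <= b -> `|x - y| < d -> `|h x - h y| < eps.
Proof.
move=> hc e0.
have := (@compact_near_coveringP _ `[a, b]%classic).1 (@segment_compact _ a b).
move=> /(_ R (0^'+) (fun d x => forall y, `|x - y| < d -> `|h x - h y| < eps) _).
case=> [x _|d /= d0 H].
  have e2 : 0 < eps / 2 by lra.
  have /cvgrPdist_lt /(_ _ e2) := hc x.
  move=> /nbhs_ballP[eta /= eta0 heta].
  have eta2 : 0 < eta / 2 by lra.
  exists (ball x (eta / 2), [set d | d < eta / 2]) => /=.
    split; first exact: nbhsx_ballx.
    exact: nbhs_right_lt.
  move=> [x' d] /= [xx' dd] y x'y.
  move: xx'; rewrite /ball /= => xx'.
  have h1 : `|h x - h x'| < eps / 2 by apply: heta; rewrite /ball /=; lra.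
  have h2 : `|h x - h y| < eps / 2.
    apply: heta; rewrite /ball /=.
    have -> : x - y = (x - x') + (x' - y) by ring.
    by apply: le_lt_trans (ler_normD _ _) _; lra.
  have -> : h x' - h y = (h x - h y) - (h x - h x') by ring.
  by apply: le_lt_trans (ler_normB _ _) _; lra.
exists (d / 2); first by lra.
move=> x y xab xy; apply: (H (d / 2)) => //=; last by lra.
by rewrite sub0r normrN gtr0_norm; lra.
Qed.

Lemma antiderivative (h : R -> R) (a b : R) : a < b -> continuous h ->
  exists2 F : R -> R, (forall x, a <= x <= b -> is_derive x (1 : R) F (h x)) &
    (\int[lebesgue_measure]_(x in `[a, b]) (h x)%:E = (F b - F a)%:E)%E.
Proof.
move=> ab hc.
pose F x := (\int[@lebesgue_measure R]_(t in `[a - 1, x]) h t)%R.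
have hi : (@lebesgue_measure R).-integrable `[a - 1, b + 1] (EFin \o h).
  apply: continuous_compact_integrable; first exact: segment_compact.
  exact: continuous_subspaceT.
have dF x : a <= x <= b -> is_derive x (1 : R) F (h x).
  move=> /andP[ax xb].
  have xu : x < b + 1 by lra.
  have a1x : a - 1 < x by lra.
  have [d1 d2] := continuous_FTC1_closed xu hi a1x (hc x).
  by apply: DeriveDef; [exact: d1|rewrite -derive1E; exact: d2].
exists F => //; rewrite EFinB; apply: continuous_FTC2 => //.
- exact: continuous_subspaceT.
- split.
  + move=> x; rewrite in_itv /= => /andP[h1 h2].
    by apply: (@ex_derive _ _ _ _ _ _ _ (dF x _)); rewrite !ltW.
  + apply: cvg_at_right_filter; apply: differentiable_continuous; apply/derivable1_diffP.
    by apply: (@ex_derive _ _ _ _ _ _ _ (dF a _)); rewrite lexx ltW.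
  + apply: cvg_at_left_filter; apply: differentiable_continuous; apply/derivable1_diffP.
    by apply: (@ex_derive _ _ _ _ _ _ _ (dF b _)); rewrite lexx ltW.
- move=> x; rewrite in_itv /= => /andP[h1 h2]; rewrite derive1E.
  by apply: (@derive_val _ _ _ _ _ _ _ (dF x _)); rewrite !ltW.
Qed.

(** By the mean value theorem, the increment of a primitive of h over a subinterval is
its length times a value of h there, which is close to the value at the left end. *)
Lemma le_mean_riemann (h : R -> R) (c : R) : continuous h ->
  (forall eps, 0 < eps -> \forall N \near \oo,
     c <= N%:R^-1 * \sum_(i < N) h (2 * pi * i%:R / N%:R) + eps) ->
  (c%:E <= ((2 * pi)^-1)%:E *
     \int[lebesgue_measure]_(theta in `[0%R, (2 * pi)%R]) (h theta)%:E)%E.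
Proof.
move=> hc H; have p0 : 0 < 2 * pi :> R by rewrite mulr_gt0 // pi_gt0.
have [F dF ->] := antiderivative p0 hc.
rewrite -EFinM lee_fin; apply/ler_addgt0Pr => eps e0.
have e2 : 0 < eps / 2 by lra.
have [d d0 hd] := uniform_modulus 0 (2 * pi) hc e2.
have [N [N0 Nd HN]] : exists N : nat, [/\ (0 < N)%N, 2 * pi / d < N%:R &
    c <= N%:R^-1 * \sum_(i < N) h (2 * pi * i%:R / N%:R) + eps / 2].
  near \oo => N; exists N; split; near: N.
  - exact: nbhs_infty_gt.
  - near=> N; apply: (lt_le_trans (archi_boundP _)).
      by rewrite divr_ge0 // ltW.
    by rewrite ler_nat; near: N; exact: nbhs_infty_ge.
  - exact: H.
apply: (le_trans HN).
have Nr : 0 < N%:R :> R by rewrite ltr0n.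
pose x (i : nat) : R := 2 * pi * i%:R / N%:R.
have xS i : x i.+1 = x i + 2 * pi / N%:R.
  by rewrite /x -natr1; field; rewrite gt_eqF.
have step0 : 0 < 2 * pi / N%:R :> R by rewrite divr_gt0.
have stepd : 2 * pi / N%:R < d.
  by move: Nd; rewrite !ltr_pdivrMr // (mulrC d).
have xb i : (i <= N)%N -> 0 <= x i <= 2 * pi.
  move=> iN; rewrite /x; apply/andP; split.
    by rewrite divr_ge0 ?ler0n // mulr_ge0 ?ler0n // ltW.
  by rewrite ler_pdivrMr // ler_pM2l // ler_nat.
have loc (i : 'I_N) : h (x i) <= (F (x i.+1) - F (x i)) / (2 * pi / N%:R) + eps / 2.
  have [i1 i2] := andP (xb i (ltnW (ltn_ord i))).
  have [i3 i4] := andP (xb i.+1 (ltn_ord i)).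
  have xlt : x i < x i.+1 by rewrite xS ltrDl.
  have der y : x i <= y <= x i.+1 -> is_derive y (1 : R) F (h y).
    move=> /andP[y1 y2]; apply: dF; apply/andP; split; lra.
  have [||xi] := @MVT _ F h _ _ xlt.
  - by move=> y; rewrite in_itv /= => /andP[y1 y2]; apply: der; rewrite !ltW.
  - apply: derivable_within_continuous => y; rewrite in_itv /= => yy.
    exact: (@ex_derive _ _ _ _ _ _ _ (der y yy)).
  rewrite in_itv /= => /andP[xi1 xi2] ->; rewrite xS addrAC subrr add0r.
  rewrite mulfK ?gt_eqF //.
  have : `|h (x i) - h xi| < eps / 2.
    apply: hd; first by rewrite i1 i2.
    by rewrite distrC gtr0_norm ?subr_gt0 //; move: xi2; rewrite xS; lra.
  by rewrite ltr_norml => /andP[]; lra.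
have sumF : \sum_(i < N) (F (x i.+1) - F (x i)) = F (2 * pi) - F 0.
  rewrite -(big_mkord xpredT (fun i => F (x i.+1) - F (x i))) telescope_sumr //.
  by rewrite /x mulfK ?gt_eqF // mulr0 mul0r.
have le1 : \sum_(i < N) h (x i) <=
    (F (2 * pi) - F 0) / (2 * pi / N%:R) + N%:R * (eps / 2).
  apply: (le_trans (ler_sum _ (fun i _ => loc i))).
  by rewrite big_split /= -mulr_suml sumF sumr_const card_ord (mulr_natl _ N).
have le2 : N%:R^-1 * \sum_(i < N) h (x i) <=
    (2 * pi)^-1 * (F (2 * pi) - F 0) + eps / 2.
  rewrite mulrC ler_pdivrMr //; apply: (le_trans le1).
  rewrite le_eqVlt; apply/orP; left; apply/eqP.
  move: (F (2 * pi) - F 0) => I; have := gt_eqF p0; move: (2 * pi) => p pn.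
  by field; rewrite (gt_eqF Nr) pn.
by move: le2; rewrite /x; lra.
Unshelve. all: by end_near. Qed.

End riemann_sum.

(** * A discrete Jensen inequality *)

Section jensen.
Context {R : realType}.
Local Notation C := (Cplx R).

Lemma cmod_prod (I : Type) (s : seq I) (f : I -> C) :
  cmod (\prod_(i <- s) f i) = \prod_(i <- s) cmod (f i).
Proof. by apply: (big_morph cmod); [exact: cmodM|exact: cmod1]. Qed.

Lemma cisD (s t : R) : cis (s + t) = cis s * cis t.
Proof.
by rewrite /cis; apply/eqP; rewrite eq_complex /= cosD sinD eqxx addrC /=.
Qed.

Lemma cis0 : cis (0 : R) = 1.
Proof. by rewrite /cis cos0 sin0. Qed.

Lemma cisX (t : R) n : cis t ^+ n = cis (t * n%:R).
Proof.
elim: n => [|n IH]; first by rewrite mulr0 cis0.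
by rewrite exprS IH -cisD -natr1 mulrDr mulr1 addrC.
Qed.

Lemma cmod_cis (t : R) : cmod (cis t) = 1.
Proof. by rewrite /cmod /cis /= cos2Dsin2 sqrtr1. Qed.

Lemma cis_prim_root N : (0 < N)%N -> N.-primitive_root (cis (2 * pi / N%:R : R)).
Proof.
move=> N0; have Nr : 0 < N%:R :> R by rewrite ltr0n.
apply/andP; split=> //; apply/forallP => i; rewrite unity_rootE cisX.
apply/eqP; case: (eqVneq i.+1 N) => [iN|iN].
  rewrite iN divfK ?(gt_eqF Nr) //.
  rewrite (mulr_natl pi 2) /cis cos2pi sin2pi.
  exact: eqxx.
have {}iN : (i.+1 < N)%N by rewrite ltn_neqAle iN ltn_ord.
apply/negbTE; rewrite eq_complex /= negb_and; apply/orP; left.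
set t := (2 * pi / _ * _).
pose s : R := pi * (i.+1%:R / N%:R).
have -> : t = s *+ 2 by rewrite /t /s -mulr_natl; field; rewrite gt_eqF.
have s0 : 0 < sin s.
  apply: sin_gt0_pi; rewrite /s mulr_gt0 ?pi_gt0 ?divr_gt0 ?ltr0n //=.
  by rewrite gtr_pMr ?pi_gt0 // ltr_pdivrMr // mul1r ltr_nat.
rewrite cos_mulr2n cos2sin2 lt_eqF //.
have : 0 < sin s ^+ 2 by rewrite exprn_gt0.
by rewrite -mulr_natl; lra.
Qed.

Definition circle_point (r : R) N (i : nat) : C := r%:C%C * cis (2 * pi * i%:R / N%:R).

Lemma circle_pointE r N i :
  circle_point r N i = r%:C%C * cis (2 * pi / N%:R) ^+ i.
Proof. by rewrite /circle_point cisX mulrAC. Qed.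

Lemma prod_sub_unity_roots N (w x : C) : N.-primitive_root w ->
  \prod_(i < N) (x - w ^+ i) = x ^+ N - 1.
Proof.
move=> wN; have -> : x ^+ N - 1 = ('X^N - 1).[x] by rewrite hornerD hornerN hornerXn hornerC.
rewrite -(factor_Xn_sub_1 wN) big_mkord horner_prod.
by apply: eq_bigr => i _; rewrite hornerXsubC.
Qed.

(** The sampled points are the roots of X^N - r^N. *)
Lemma prod_circle (r : R) N (a : C) : (0 < N)%N -> 0 < r ->
  \prod_(i < N) cmod (circle_point r N i - a) = cmod (r%:C%C ^+ N - a ^+ N).
Proof.
move=> N0 r0.
have rC : (r%:C%C : C) != 0 by rewrite -cmod_eq0 cmod_real gt_eqF // normr_gt0 gt_eqF.
have -> : \prod_(i < N) cmod (circle_point r N i - a) =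
    r ^+ N * cmod (\prod_(i < N) (a / r%:C%C - cis (2 * pi / N%:R) ^+ i : C)).
  rewrite cmod_prod -[in r ^+ N](card_ord N) -prodr_const -big_split /=.
  apply: eq_bigr => i _; rewrite circle_pointE.
  rewrite -[X in _ = X * _](gtr0_norm r0) -[X in _ = X * _]cmod_real -cmodM.
  by rewrite mulrBr [_ * (a / _)]mulrCA divff // mulr1 cmodC.
rewrite (prod_sub_unity_roots _ (cis_prim_root N0)).
rewrite -[r ^+ N](ger0_norm (exprn_ge0 N (ltW r0))).
rewrite -[X in X * _ = _]cmod_real -cmodM rmorphXn /=.
rewrite (_ : _ * _ = a ^+ N - r%:C%C ^+ N); first exact: cmodC.
by rewrite expr_div_n mulrBr mulr1 [X in X - _]mulrC divfK // expf_neq0.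
Qed.

Lemma near_pow_gap (x y : R) : 0 < x -> x < y ->
  \forall N \near \oo, 2 * x ^+ N <= y ^+ N.
Proof.
move=> x0 xy; have y0 : 0 < y by lra.
have q1 : `|x / y| < 1 by rewrite gtr0_norm ?divr_gt0 // ltr_pdivrMr // mul1r.
have half0 : 0 < 2^-1 :> R by lra.
have /cvgr0Pnorm_lt /(_ _ half0) := cvg_geometric 1 q1.
apply: filterS => N; rewrite /geometric /= mul1r expr_div_n gtr0_norm; last first.
  by rewrite divr_gt0 ?exprn_gt0.
by rewrite ltr_pdivrMr ?exprn_gt0 //; lra.
Qed.

(** |r^N - z^N| is of the order of max(r, |z|)^N unless |z| = r. *)
Lemma near_prod_roots (r : R) (s : seq C) : 0 < r ->
  all (fun z => (z != 0) && (cmod z != r)) s ->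
  \forall N \near \oo, \prod_(z <- s) cmod z ^+ N <=
    2 ^+ size s * \prod_(z <- s) cmod (r%:C%C ^+ N - z ^+ N).
Proof.
move=> r0; elim: s => [_|z s IH /= /andP[/andP[z0 zr] /IH {}IH]].
  by apply: nearW => N; rewrite !big_nil mul1r.
have m0 : 0 < cmod z by rewrite cmod_gt0.
have hz : \forall N \near \oo, cmod z ^+ N <= 2 * cmod (r%:C%C ^+ N - z ^+ N).
  have rN N : cmod (r%:C%C ^+ N) = r ^+ N by rewrite cmodX cmod_real gtr0_norm.
  have dist N := cmod_dist (r%:C%C ^+ N) (z ^+ N).
  case: (ltrP r (cmod z)) => [rz|].
    apply: filterS (near_pow_gap r0 rz) => N hN.
    by have := dist N; rewrite rN cmodX ler_norml => /andP[]; lra.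
  rewrite le_eqVlt (negbTE zr) /= => zr'.
  apply: filterS (near_pow_gap m0 zr') => N hN.
  have : 0 <= cmod z ^+ N by rewrite exprn_ge0 // ltW.
  by have := dist N; rewrite rN cmodX ler_norml => /andP[]; lra.
apply: filterS2 hz IH => N h1 h2; rewrite !big_cons exprS.
have -> : 2 * 2 ^+ size s * (cmod (r%:C%C ^+ N - z ^+ N) *
    \prod_(z0 <- s) cmod (r%:C%C ^+ N - z0 ^+ N)) =
  (2 * cmod (r%:C%C ^+ N - z ^+ N)) *
    (2 ^+ size s * \prod_(z0 <- s) cmod (r%:C%C ^+ N - z0 ^+ N)) by ring.
apply: ler_pM => //; first by rewrite exprn_ge0 ?cmod_ge0.
by apply: prodr_ge0 => w _; rewrite exprn_ge0 ?cmod_ge0.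
Qed.

(** The function log^+. *)
Definition log_max1 (t : R) : R := ln (Num.max 1 t).

Lemma log_max1_ge0 t : 0 <= log_max1 t.
Proof. by rewrite /log_max1 ln_ge0 // le_max lexx. Qed.

Lemma log_max1_ge t : 0 < t -> ln t <= log_max1 t.
Proof. by move=> t0; rewrite ler_ln ?posrE ?lt_max ?t0 ?ltr01 // le_max lexx orbT. Qed.

Lemma log_max1_le s t : s <= t -> log_max1 s <= log_max1 t.
Proof.
move=> st; rewrite ler_ln ?posrE ?lt_max ?ltr01 //.
by rewrite ge_max !le_max lexx st orbT.
Qed.

Lemma log_max1_lip s t d : 0 <= d -> s <= t + d -> log_max1 s <= log_max1 t + d.
Proof.
move=> d0 std; apply: (le_trans (log_max1_le std)).
rewrite /log_max1; set m := Num.max 1 t; have m1 : 1 <= m by rewrite le_max lexx.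
have tm : t <= m by rewrite le_max lexx orbT.
have h : Num.max 1 (t + d) <= m * (1 + d).
  by rewrite ge_max; apply/andP; split; nra.
apply: (@le_trans _ _ (ln (m * (1 + d)))).
  by rewrite ler_ln ?posrE ?lt_max ?ltr01 // mulr_gt0 //; lra.
rewrite lnM ?posrE; [|lra|lra].
by rewrite lerD2l; apply: le_ln1Dx; lra.
Qed.

(** Factoring P, the product of |P| over the sampled points is computed root by root by
[prod_circle]; it is at least |P(0)|^N up to a factor that does not depend on N. *)
Lemma jensen_off_roots (r : R) (P : {poly C}) (eps : R) :
  0 < r -> P.[0] != 0 -> 0 < eps ->
  (forall z, root P z -> cmod z != r) ->
  \forall N \near \oo, ln (cmod P.[0]) <=
    N%:R^-1 * \sum_(i < N) log_max1 (cmod P.[circle_point r N i]) + eps.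
Proof.
move=> r0 P0 e0 nor.
have [rs EP] := closed_field_poly_normal P.
set c := lead_coef P in EP.
have Pn0 : P != 0 by apply: contraNneq P0 => ->; rewrite horner0.
have c0 : c != 0 by rewrite lead_coef_eq0.
have rs_ok : all (fun z => (z != 0) && (cmod z != r)) rs.
  apply/allP => z zrs; have rz : root P z.
    by rewrite EP rootZ // root_prod_XsubC.
  by rewrite nor // andbT; apply: contraNneq P0 => zz; move: rz; rewrite zz /root.
have hornP w : cmod P.[w] = cmod c * \prod_(z <- rs) cmod (w - z).
  rewrite EP hornerZ cmodM horner_prod cmod_prod.
  by congr (_ * _); apply: eq_bigr => z _; rewrite !hornerE.
have m0 : 0 < cmod c by rewrite cmod_gt0.
have P0m : 0 < cmod P.[0] by rewrite cmod_gt0.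
near=> N.
have N0 : (0 < N)%N by near: N; exact: nbhs_infty_gt.
have Nr : 0 < N%:R :> R by rewrite ltr0n.
have hN : \prod_(z <- rs) cmod z ^+ N <=
    2 ^+ size rs * \prod_(z <- rs) cmod (r%:C%C ^+ N - z ^+ N).
  by near: N; exact: near_prod_roots.
have prodE : \prod_(i < N) cmod P.[circle_point r N i] =
    cmod c ^+ N * \prod_(z <- rs) cmod (r%:C%C ^+ N - z ^+ N).
  rewrite (eq_bigr _ (fun i _ => hornP _)).
  rewrite big_split /= prodr_const card_ord exchange_big /=; congr (_ * _).
  by apply: eq_bigr => z _; exact: prod_circle.
have P0E : cmod P.[0] ^+ N = cmod c ^+ N * \prod_(z <- rs) cmod z ^+ N.
  rewrite hornP exprMn -prodrXl; congr (_ * _).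
  by apply: eq_bigr => z _; rewrite sub0r cmodN.
have key : cmod P.[0] ^+ N <= 2 ^+ size rs * \prod_(i < N) cmod P.[circle_point r N i].
  by rewrite P0E prodE mulrCA ler_wpM2l // exprn_ge0 // ltW.
have t0 : 0 < 2 ^+ size rs :> R by rewrite exprn_gt0.
have prod0 : 0 < \prod_(i < N) cmod P.[circle_point r N i].
  by rewrite -(pmulr_rgt0 _ t0); apply: lt_le_trans key; rewrite exprn_gt0.
have pos i : 0 < cmod P.[circle_point r N (nat_of_ord (i : 'I_N))].
  rewrite lt_neqAle cmod_ge0 andbT eq_sym; apply: contraTneq prod0 => zi.
  by rewrite (bigD1 i) //= zi mul0r ltxx.
have key2 := ln_leM P0m prod0 t0 key.
have lnp : ln (\prod_(i < N) cmod P.[circle_point r N i]) <=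
    \sum_(i < N) log_max1 (cmod P.[circle_point r N i]).
  have -> : ln (\prod_(i < N) cmod P.[circle_point r N i]) =
      \sum_(i < N) ln (cmod P.[circle_point r N i]).
    have H (s : seq 'I_N) : 0 < \prod_(i <- s) cmod P.[circle_point r N i] /\
      ln (\prod_(i <- s) cmod P.[circle_point r N i]) =
      \sum_(i <- s) ln (cmod P.[circle_point r N i]).
      elim: s => [|i s [s0 sE]]; first by rewrite !big_nil ln1.
      by rewrite !big_cons mulr_gt0 // lnM ?posrE // sE.
    exact: (H _).2.
  by apply: ler_sum => i _; exact: log_max1_ge.
have Ne : ln (2 ^+ size rs) <= N%:R * eps.
  rewrite -ler_pdivrMr //; near: N; near=> N.
  apply: (@le_trans _ _ (Num.bound (ln (2 ^+ size rs) / eps))%:R).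
    apply/ltW/archi_boundP/divr_ge0; last exact: ltW.
    by rewrite ln_ge0 // exprn_ege1 // ler1n.
  by rewrite ler_nat; near: N; exact: nbhs_infty_ge.
rewrite -(ler_pM2l Nr) mulrDr mulrA divff ?gt_eqF // mul1r.
by move: key2; rewrite -(mulr_natl _ N); lra.
Unshelve. all: by end_near. Qed.

Lemma near_radius_off_roots (r : R) (P : {poly C}) : P != 0 ->
  \forall t \near r^'+, forall z, root P z -> cmod z != t.
Proof.
move=> Pn0; have [rs EP] := closed_field_poly_normal P.
have H : \forall t \near r^'+, all (fun z => cmod z != t) rs.
  elim: rs {EP} => [|z s IH] /=; first exact: nearW.
  have hz : \forall t \near r^'+, cmod z != t.
    case: (ltrP r (cmod z)) => rz; near=> t.
      by rewrite gt_eqF //; near: t; exact: nbhs_right_lt.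
    by rewrite lt_eqF // (le_lt_trans rz) //; near: t; exact: nbhs_right_gt.
  by apply: filterS2 hz IH => t -> ->.
apply: filterS H => t /allP H z rz; apply: H.
by move: rz; rewrite EP rootZ ?lead_coef_eq0 // root_prod_XsubC.
Unshelve. all: by end_near. Qed.

Lemma horner_radius_dist (P : {poly C}) (r t : R) (u : C) : 0 <= r -> r <= t -> cmod u = 1 ->
  cmod (P.[t%:C%C * u] - P.[r%:C%C * u]) <=
    \sum_(i < size P) cmod P`_i * (t ^+ i - r ^+ i).
Proof.
move=> r0 rt u1; rewrite !horner_coef -sumrB.
apply: (le_trans (cmod_sum _ _ _)); apply: ler_sum => i _.
rewrite -mulrBr cmodM ler_wpM2l ?cmod_ge0 // !exprMn -mulrBl cmodM cmodX u1 expr1n mulr1.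
have -> : (t%:C ^+ i - r%:C ^+ i)%C = (t ^+ i - r ^+ i)%:C%C :> C.
  by rewrite rmorphB !rmorphXn.
rewrite cmod_real ger0_norm // subr_ge0.
by rewrite lerXn2r // nnegrE // (le_trans r0).
Qed.

(** Roots on the circle are avoided by passing to a slightly larger circle: log^+ is
1-Lipschitz, so the averages change little. *)
Lemma jensen (r : R) (P : {poly C}) (eps : R) : 0 < r -> 0 < eps ->
  \forall N \near \oo, log_max1 (cmod P.[0]) <=
    N%:R^-1 * \sum_(i < N) log_max1 (cmod P.[circle_point r N i]) + eps.
Proof.
move=> r0 e0.
have sum0 N : 0 <= N%:R^-1 * \sum_(i < N) log_max1 (cmod P.[circle_point r N i]).
  by rewrite mulr_ge0 ?invr_ge0 // sumr_ge0 // => i _; exact: log_max1_ge0.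
case: (lerP (cmod P.[0]) 1) => P1.
  apply: nearW => N; rewrite {1}/log_max1 max_l // ln1.
  by have := sum0 N; lra.
have P0 : P.[0] != 0 by rewrite -cmod_gt0; lra.
have Pn0 : P != 0 by apply: contraNneq P0 => ->; rewrite horner0.
have e2 : 0 < eps / 2 by lra.
have Qsmall : \forall t \near r^'+,
    \sum_(i < size P) cmod P`_i * (t ^+ i - r ^+ i) < eps / 2.
  pose Q t := \sum_(i < size P) cmod P`_i * (t ^+ i - r ^+ i).
  have cQ : Q x @[x --> r] --> Q r.
    apply: cvg_sum => i; apply: cvgM; first exact: cvg_cst.
    by apply: cvgB; [exact: exprn_continuous|exact: cvg_cst].
  have Q0 : Q r = 0 by rewrite /Q big1 // => i _; rewrite subrr mulr0.
  rewrite Q0 in cQ; have /cvgr0Pnorm_lt /(_ _ e2) := cvg_at_right_filter cQ.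
  by apply: filterS => x; apply: le_lt_trans; exact: ler_norm.
have [t [rt tnor tdist]] : exists t, [/\ r < t, forall z, root P z -> cmod z != t &
    \sum_(i < size P) cmod P`_i * (t ^+ i - r ^+ i) < eps / 2].
  near r^'+ => t; exists t; split; near: t; last exact: Qsmall.
  - exact: nbhs_right_gt.
  - exact: near_radius_off_roots.
have t0 : 0 < t by lra.
apply: filterS (jensen_off_roots t0 P0 e2 tnor) => N.
have -> : log_max1 (cmod P.[0]) = ln (cmod P.[0]).
  by rewrite /log_max1 max_r // ltW.
move=> /le_trans; apply.
have [->|N0] := posnP N; first by rewrite invr0 !mul0r; lra.
have Nr : 0 < N%:R :> R by rewrite ltr0n.
have h : \sum_(i < N) log_max1 (cmod P.[circle_point t N i]) <=
    \sum_(i < N) (log_max1 (cmod P.[circle_point r N i]) + eps / 2).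
  apply: ler_sum => i _; apply: log_max1_lip; first exact: ltW.
  have := horner_radius_dist P (ltW r0) (ltW rt) (cmod_cis (2 * pi * i%:R / N%:R)).
  have := cmod_dist P.[circle_point t N i] P.[circle_point r N i].
  rewrite /circle_point ler_norml => /andP[_]; lra.
rewrite big_split /= sumr_const card_ord -(mulr_natl _ N) in h.
rewrite -(ler_pM2l Nr) !mulrDr !mulrA divff ?gt_eqF // !mul1r.
lra.
Unshelve. all: by end_near. Qed.

Lemma ln_heightE (x y : C) : ln (height (x, y)) = log_max1 (Num.max (cmod x) (cmod y)).
Proof. by []. Qed.

(** The logarithm of the height is the maximum of two functions covered by [jensen]. *)
Lemma jensen_height (r : R) (P Q : {poly C}) (eps : R) : 0 < r -> 0 < eps ->
  \forall N \near \oo, ln (height (P.[0], Q.[0])) <=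
    N%:R^-1 * \sum_(i < N)
      ln (height (P.[circle_point r N i], Q.[circle_point r N i])) + eps.
Proof.
move=> r0 e0.
apply: filterS2 (jensen P r0 e0) (jensen Q r0 e0) => N hP hQ.
have mono (p : C -> C) : (forall z, cmod (p z) <= Num.max (cmod P.[z]) (cmod Q.[z])) ->
    N%:R^-1 * \sum_(i < N) log_max1 (cmod (p (circle_point r N i))) <=
    N%:R^-1 * \sum_(i < N) ln (height (P.[circle_point r N i], Q.[circle_point r N i])).
  move=> hp; rewrite ler_wpM2l ?invr_ge0 //; apply: ler_sum => i _.
  exact: log_max1_le.
rewrite ln_heightE; case: (lerP (cmod P.[0]) (cmod Q.[0])) => _.
  apply: (le_trans hQ); rewrite lerD2r; apply: (mono (fun z => Q.[z])) => z.
  by rewrite le_max lexx orbT.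
apply: (le_trans hP); rewrite lerD2r; apply: (mono (fun z => P.[z])) => z.
by rewrite le_max lexx.
Qed.

End jensen.

(** * Plurisubharmonicity *)

Section plurisubharmonicity.
Context {R : realType}.
Local Notation C := (Cplx R).
Variables (A : R) (q : nat -> {poly C}) (b : nat -> C) (e : nat -> nat).
Hypothesis T : tame A q b e.
Local Notation orb := (orb q b).
Local Notation green := (green q b e).
Local Notation potential := (potential q b e).

(** The orbit of a point of the line u + zeta v, as polynomials in zeta. *)
Fixpoint orb_poly (u v : C2 R) k : {poly C} * {poly C} :=
  if k is k'.+1 then
    let: (P, Q) := orb_poly u v k' in (Q, q k' \Po Q - b k' *: P)
  else (u.1%:P + v.1 *: 'X, u.2%:P + v.2 *: 'X).

Lemma orb_polyE u v k (zeta : C) :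
  orb k (u + zeta *: v) =
  ((orb_poly u v k).1.[zeta], (orb_poly u v k).2.[zeta]).
Proof.
elim: k => [|k IH] /=.
  by rewrite !hornerE !(mulrC _ zeta).
rewrite IH /step; case: (orb_poly u v k) => P Q /=.
by rewrite hornerD hornerN hornerZ horner_comp.
Qed.

Lemma height_line (u v : C2 R) (zeta : C) (r : R) : cmod zeta <= r ->
  height (u + zeta *: v) <=
    1 + cmod u.1 + cmod u.2 + r * (cmod v.1 + cmod v.2).
Proof.
move=> zr.
have [u1 u2 v1 v2] := And4 (cmod_ge0 u.1) (cmod_ge0 u.2) (cmod_ge0 v.1) (cmod_ge0 v.2).
have r0 : 0 <= r by exact: le_trans (cmod_ge0 _) zr.
have s1 : cmod (zeta * v.1) <= r * cmod v.1 by rewrite cmodM ler_wpM2r.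
have s2 : cmod (zeta * v.2) <= r * cmod v.2 by rewrite cmodM ler_wpM2r.
have p1 : 0 <= r * cmod v.1 by rewrite mulr_ge0.
have p2 : 0 <= r * cmod v.2 by rewrite mulr_ge0.
rewrite mulrDr; apply: height_le.
- lra.
- by apply: (le_trans (cmodD _ _)); lra.
- by apply: (le_trans (cmodD _ _)); lra.
Qed.

(** The inequality holds for a potential of high order, which is uniformly close to its
limit on the ball that contains the circle. *)
Lemma green_mean (u v : C2 R) (r eps : R) : 0 < r -> 0 < eps ->
  \forall N \near \oo, green u <=
    N%:R^-1 * \sum_(i < N) green (u + circle_point r N i *: v) + eps.
Proof.
move=> r0 e0; have A1 := tame_ge1 T.
pose B := escape_radius A + (1 + cmod u.1 + cmod u.2 + r * (cmod v.1 + cmod v.2)).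
have rA := escape_radius_ge4 T.
have h0 := @height_line u v 0 r; rewrite cmod0 scale0r addr0 in h0.
have rB : escape_radius A <= B.
  by have := le_trans (height_ge1 u) (h0 (ltW r0)); rewrite /B; lra.
have uB : height u <= B by have := h0 (ltW r0); rewrite /B; lra.
have vB N i : height (u + circle_point r N i *: v) <= B.
  have := @height_line u v (circle_point r N i) r.
  rewrite /circle_point cmodM cmod_cis cmod_real gtr0_norm // mulr1 lexx => /(_ isT).
  by rewrite /B; lra.
have e4 : 0 < eps / 4 by lra.
have /cvgr0Pnorm_lt /(_ _ e4) [k _ /(_ k (leqnn k))] := half_pow_cvg0 (ln (cmp_const A B)).
rewrite /= => hk; have {}hk := le_lt_trans (ler_norm _) hk.
have dk w : height w <= B -> `|potential k w - green w| <= eps / 4.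
  by move=> wB; apply: (le_trans (potential_green T k rB wB)); exact: ltW.
have D0 : 0 < total_deg e k :> R := total_deg_gt0 _ _.
have e4D : 0 < eps / 4 * total_deg e k by rewrite mulr_gt0.
apply: filterS2 (nbhs_infty_gt 0) (jensen_height (orb_poly u v k).1 (orb_poly u v k).2 r0 e4D).
move=> N N0 hN.
have Nr : 0 < N%:R :> R by rewrite ltr0n.
have hP : potential k u <=
    N%:R^-1 * \sum_(i < N) potential k (u + circle_point r N i *: v) + eps / 4.
  rewrite /potential -(ler_pM2r D0) divfK ?gt_eqF // mulrDl.
  rewrite -mulrA mulr_suml.
  rewrite -{1}[u]addr0 -(scale0r v) orb_polyE.
  apply: (le_trans hN); rewrite lerD2r ler_wpM2l ?invr_ge0 //.
  by apply: ler_sum => i _; rewrite divfK ?gt_eqF // orb_polyE.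
have hs : \sum_(i < N) potential k (u + circle_point r N i *: v) <=
    \sum_(i < N) (green (u + circle_point r N i *: v) + eps / 4).
  apply: ler_sum => i _; have := dk _ (vB N i).
  by rewrite ler_norml => /andP[_]; lra.
rewrite big_split /= sumr_const card_ord -(mulr_natl _ N) in hs.
have hs' : N%:R^-1 * \sum_(i < N) potential k (u + circle_point r N i *: v) <=
    N%:R^-1 * \sum_(i < N) green (u + circle_point r N i *: v) + eps / 4.
  rewrite -(ler_pM2l Nr) mulrDr !mulrA divff ?gt_eqF // !mul1r; lra.
have := dk _ uB; rewrite ler_norml => /andP[]; lra.
Qed.

Lemma continuous_usc (X : topologicalType) (f : X -> R) :
  continuous f -> upper_semicontinuous (EFin \o f).
Proof.
move=> fc x a /=; rewrite lte_fin ltrNr => ax.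
exists [set y | f y < - a]; first exact: (cvgr_lt _ (fc x)).
by move=> y /=; rewrite lte_fin ltrNr.
Qed.

Lemma cmod_le_Re_Im (x y : R) : cmod (x +i* y)%C <= `|x| + `|y|.
Proof.
rewrite -(ler_pXn2r (n := 2)) ?nnegrE ?cmod_ge0 ?addr_ge0 //.
rewrite /cmod /= sqr_sqrtr ?addr_ge0 ?sqr_ge0 // sqrrD !real_normK ?num_real //.
by rewrite lerD2r lerDl mulrn_wge0 // mulr_ge0.
Qed.

Lemma cis_continuous : continuous (cis : R -> C).
Proof.
move=> t; apply/cvg_cmodP => eps e0.
have e2 : 0 < eps / 2 by lra.
have /cvgrPdist_lt /(_ _ e2) hc := @continuous_cos R t.
have /cvgrPdist_lt /(_ _ e2) hs := @continuous_sin R t.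
apply: filterS2 hc hs => s hc hs.
by apply: (le_lt_trans (cmod_le_Re_Im _ _)); lra.
Qed.

Lemma line_continuous (u v : C2 R) : continuous (fun zeta : C => u + zeta *: v).
Proof.
move=> z; apply: (@cvgD _ (C2 R) _ (nbhs z) _ (fun=> u) (fun zeta => zeta *: v)).
  exact: cvg_cst.
by apply: (@cvgZ _ _ _ (nbhs z) _ id (fun=> v)); [exact: cvg_id|exact: cvg_cst].
Qed.

Lemma green_plurisubharmonic : continuous (green : C2 R -> R) ->
  plurisubharmonic (EFin \o green).
Proof.
move=> gc; split=> [z||u v]; first exact: ltry.
  exact: continuous_usc.
have sc : continuous (fun zeta : C => green (u + zeta *: v)).
  by move=> z; apply: continuous_comp; [exact: line_continuous|exact: gc].
split=> [z||a r r0]; [exact: ltry|exact: (continuous_usc sc)|].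
pose h theta := green (u + (a + (r%:C%C : C) * cis theta) *: v).
have hc : continuous h.
  move=> t; apply: (@continuous_comp _ _ _ (fun t => a + (r%:C%C : C) * cis t)
    (fun zeta => green (u + zeta *: v))); last exact: sc.
  apply: cvgD; first exact: cvg_cst.
  by apply: cvgM; [exact: cvg_cst|exact: cis_continuous].
apply: (le_mean_riemann hc) => eps e0.
apply: filterS (green_mean (u + a *: v) v r0 e0) => N /le_trans; apply.
rewrite lerD2r ler_wpM2l ?invr_ge0 // ler_sum // => i _.
by rewrite /h /circle_point scalerDl addrA.
Qed.

End plurisubharmonicity.

(** * Directional derivatives and termwise differentiation *)

Section directional.
Context {R : realType}.
Local Notation C := (Cplx R).
Context {V : normedModType (Cplx R)}.
Implicit Types (f : V -> C) (u : V -> R) (z v : V).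

Lemma real_continuous : continuous (fun t : R => t%:C%C : C).
Proof.
move=> t; apply/cvg_cmodP => eps e0.
apply/nbhs_ballP; exists eps => // s h; have {}h : `|t - s| < eps := h.
change (cmod (t%:C%C - s%:C%C : C) < eps).
have E : (t - s)%:C%C = t%:C%C - s%:C%C :> C by rewrite rmorphB.
by rewrite -E cmod_real.
Qed.

Lemma real_direction_continuous z v (t : R) :
  (z + (s%:C%C : C) *: v) @[s --> t] --> z + (t%:C%C : C) *: v.
Proof.
apply: (@cvgD _ V _ (nbhs t) _ (fun=> z) (fun s => (s%:C%C : C) *: v)).
  exact: cvg_cst.
apply: (@cvgZ _ _ _ (nbhs t) _ (fun s => s%:C%C : C) (fun=> v)).
  exact: real_continuous.
exact: cvg_cst.
Qed.

Lemma near_line (P : set V) z v : (\forall w \near z, P w) ->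
  exists2 d : R, 0 < d & forall t : R, `|t| < d -> P (z + (t%:C%C : C) *: v).
Proof.
move=> Pz; have := @real_direction_continuous z v 0.
rewrite /= scale0r addr0 => /(_ _ Pz) /nbhs_ballP[d /= d0 H].
by exists d => // t td; apply: H; rewrite /ball /= sub0r normrN.
Qed.

Lemma line_shift u v z (t s : R) :
  line u v z (t + s) = line u v (z + (t%:C%C : C) *: v) s.
Proof.
by rewrite /line rmorphD /= scalerDl addrA.
Qed.

Lemma is_derive_line_shift u v z (t d : R) :
  is_derive (0 : R) (1 : R) (line u v (z + (t%:C%C : C) *: v)) d ->
  is_derive t (1 : R) (line u v z) d.
Proof.
move=> H.
have E : (fun h : R => h^-1 *: ((line u v z \o shift t) (h *: (1 : R)) - line u v z t)) =
  (fun h : R => h^-1 *: ((line u v (z + (t%:C%C : C) *: v) \o shift 0) (h *: (1 : R)) -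
     line u v (z + (t%:C%C : C) *: v) 0)).
  have L0 : line u v (z + (t%:C%C : C) *: v) 0 = line u v z t.
    by rewrite -line_shift addr0.
  by apply/funext => h /=; rewrite L0 addr0 [_ + t]addrC line_shift.
by split; [rewrite /derivable E; exact: ex_derive|rewrite /derive E; exact: derive_val].
Qed.

(** A complex derivative in the direction v contains the real one: the increments are
restricted to real numbers. *)
Lemma is_derive_Re f v z (d : C) : is_derive z v f d ->
  is_derive (0 : R) (1 : R) (line (fun w => complex.Re (f w)) v z) (complex.Re d).
Proof.
move=> [df dE].
have H : h^-1 *: ((f \o shift z) (h *: v) - f z) @[h --> (0 : C)^'] --> d.
  by rewrite -dE.
pose g (h : R) : R := h^-1 *: ((line (fun w => complex.Re (f w)) v z \o shift 0) (h *: (1 : R))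
    - line (fun w => complex.Re (f w)) v z 0).
have G : g h @[h --> (0 : R)^'] --> complex.Re d.
  have Hr : (h%:C%C : C) @[h --> (0 : R)^'] --> (0 : C)^'.
    move=> P /nbhs_cmodP[eps e0 HP].
    have Hs : \forall h \near (0 : R)^', `|h| < eps := dnbhs0_lt e0.
    apply: filterS2 (nbhs_dnbhs_neq (0 : R)) Hs => h h0 hs.
    apply: HP; last by rewrite -cmod_eq0 cmod_real normr_eq0.
    by rewrite sub0r cmodN cmod_real.
  have := cvg_comp _ _ (cvg_comp _ _ Hr H) (@Re_continuous R d).
  apply: cvg_trans; apply: near_eq_cvg.
  apply: filterS (nbhs_dnbhs_neq (0 : R)) => h h0.
  rewrite /g /line /= addr0 scale0r addr0 [_ *: v + z]addrC [h *: 1]mulr1.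
  rewrite -raddfB /=; case: (f _ - f _) => x y.
  rewrite -fmorphV /= /GRing.scale /= mul0r subr0 //.
split; first by apply/cvg_ex; exists (complex.Re d).
exact/cvg_lim.
Unshelve. all: by end_near. Qed.


Lemma is_derive_Im f v z (d : C) : is_derive z v f d ->
  is_derive (0 : R) (1 : R) (line (fun w => complex.Im (f w)) v z) (complex.Im d).
Proof.
move=> fd.
have ReN (w : C) : complex.Re (w * - 'i%C) = complex.Im w.
  by rewrite mulrN; have := ReiNIm w; case: (w * 'i%C) => a b /= ->; rewrite opprK.
have H := is_deriveM fd (is_derive_cst (- 'i%C : C) z v).
have := is_derive_Re H; rewrite scaler0 add0r.
have -> : line (fun w => complex.Re ((f * cst (- 'i%C)) w)) v z =
    line (fun w => complex.Im (f w)) v z.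
  apply/funext => t; rewrite /line /=.
  exact: ReN.
by rewrite (_ : complex.Re _ = complex.Im d) // /GRing.scale /= mulrC ReN.
Qed.

Lemma cmod_sqr (w : C) : cmod w ^+ 2 = complex.Re w ^+ 2 + complex.Im w ^+ 2.
Proof. by case: w => x y; rewrite /cmod /= sqr_sqrtr // addr_ge0 ?sqr_ge0. Qed.

Lemma is_derive_ln_cmod f v z (d : C) : f z != 0 -> is_derive z v f d ->
  is_derive (0 : R) (1 : R) (line (fun w => ln (cmod (f w))) v z)
    (complex.Re (d / f z)).
Proof.
move=> f0 fd; have a := is_derive_Re fd; have b := is_derive_Im fd.
set fa := line _ v z in a; set fb := line _ v z in b.
have fa0 : fa 0 = complex.Re (f z) by rewrite /fa /line scale0r addr0.
have fb0 : fb 0 = complex.Im (f z) by rewrite /fb /line scale0r addr0.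
have m0 : 0 < cmod (f z) by rewrite cmod_gt0.
have n0 : 0 < fa 0 ^+ 2 + fb 0 ^+ 2 by rewrite fa0 fb0 -cmod_sqr exprn_gt0.
have n := is_deriveD (is_deriveM a a) (is_deriveM b b).
have n0' : 0 < (fa * fa + fb * fb) 0 by [].
have l := @is_derive1_comp _ (@ln R) (fa * fa + fb * fb) 0 _ _ (is_derive1_ln n0') n.
have h := is_deriveM (is_derive_cst (2^-1 : R) (0 : R) (1 : R)) l.
have E : line (fun w => ln (cmod (f w))) v z =
    cst (2^-1 : R) * (@ln R \o (fa * fa + fb * fb)).
  apply/funext => t; rewrite /line /= /fa /fb /line.
  set w := f _; change (ln (cmod w) = 2^-1 *
    ln (complex.Re w * complex.Re w + complex.Im w * complex.Im w)).
  rewrite -!expr2 -cmod_sqr; have [->|w0] := eqVneq w 0.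
    by rewrite cmod0 expr0n /= ln0 ?mulr0.
  by rewrite lnXn ?cmod_gt0 // -(mulr_natl (ln _)) mulrA mulVf ?mul1r // pnatr_eq0.
rewrite E; apply: (is_derive_eq h).
have SE : (fa * fa + fb * fb) 0 = complex.Re (f z) ^+ 2 + complex.Im (f z) ^+ 2.
  by rewrite -fa0 -fb0 !expr2.
rewrite scaler0 addr0 /GRing.scale /= SE fa0 fb0.
rewrite fa0 fb0 in n0.
case: (f z) d n0 {a b n l h fd SE} => x y [p q] /= n0.
by field; rewrite gt_eqF.
Qed.

Lemma is_derive_horner (q : {poly C}) f v z (d : C) : is_derive z v f d ->
  is_derive z v (fun w => q.[f w]) (q^`().[f z] * d).
Proof.
move=> fd; elim/poly_ind: q => [|p c IH].
  have -> : (fun w => (0 : {poly C}).[f w]) = cst 0.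
    by apply/funext => w; rewrite horner0.
  apply: (is_derive_eq (is_derive_cst (0 : C) z v)).
  by rewrite deriv0 horner0 mul0r.
have -> : (fun w => (p * 'X + c%:P).[f w]) = (fun w => p.[f w]) * f + cst c.
  by apply/funext => w; rewrite !hornerE.
apply: (is_derive_eq (is_deriveD (is_deriveM IH fd) (is_derive_cst c z v))).
by rewrite derivD derivM derivX derivC !hornerE /GRing.scale /=; ring.
Qed.

Lemma is_derive_div f g v z (df dg : C) : g z != 0 ->
  is_derive z v f df -> is_derive z v g dg ->
  is_derive z v (fun w => f w / g w) (df / g z - f z * dg / g z ^+ 2).
Proof.
move=> g0 fd gd.
have gV : is_derive z v (fun w => (g w)^-1) (- (g z) ^- 2 *: dg).
  split; first by apply: derivableV => //; exact: ex_derive.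
  by rewrite deriveV ?derive_val //; exact: ex_derive.
apply: (is_derive_eq (is_deriveM fd gV)).
by rewrite /GRing.scale /=; field.
Qed.

End directional.

Section termwise_derivative.
Context {R : realType}.

Lemma increment_le (f g : R -> R) (d K t : R) : `|t| < d ->
  (forall s, `|s| < d -> is_derive s (1 : R) f (g s)) ->
  (forall s, `|s| < d -> `|g s| <= K) ->
  `|f t - f 0| <= K * `|t|.
Proof.
move=> td fd gK.
have main (a b : R) : a <= b -> (forall s, a <= s <= b -> `|s| < d) ->
    `|f b - f a| <= K * (b - a).
  move=> ab sd.
  have [||c] := @MVT_segment _ f g a b ab.
  - by move=> s; rewrite in_itv /= => /andP[s1 s2]; apply/fd/sd; rewrite !ltW.
  - apply: derivable_within_continuous => s; rewrite in_itv /= => sab.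
    by have := fd s (sd s sab) => H; exact: ex_derive.
  - rewrite in_itv /= => /sd cd ->; rewrite normrM [`|b - a|]ger0_norm ?subr_ge0 //.
    by rewrite ler_wpM2r ?subr_ge0 // gK.
case: (lerP 0 t) => t0.
  have := main 0 t t0; rewrite subr0 [`|t|]ger0_norm //; apply=> s /andP[s0 st].
  by rewrite ger0_norm // (le_lt_trans st) // (le_lt_trans (ler_norm _)).
have := main t 0 (ltW t0); rewrite sub0r distrC [`|t|]ltr0_norm //; apply=> s /andP[ts s0].
by rewrite ler0_norm //; rewrite ltr0_norm // in td; lra.
Qed.

(** The mean value inequality applied to f m - f n turns the uniform convergence of the
derivatives into that of the difference quotients at 0. *)
Lemma is_derive_limit (f g : nat -> R -> R) (f0 g0 : R -> R) (d c : R) : 0 < d ->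
  (forall n t, `|t| < d -> is_derive t (1 : R) (f n) (g n t)) ->
  (forall n t, `|t| < d -> `|g n t - g0 t| <= c / 2 ^+ n) ->
  (forall t, `|t| < d -> f n t @[n --> \oo] --> f0 t) ->
  is_derive (0 : R) (1 : R) f0 (g0 0).
Proof.
move=> d0 fd gc fc.
have d0' : `|0 : R| < d by rewrite normr0.
have key n t : `|t| < d -> `|(f0 t - f0 0) - (f n t - f n 0)| <= 2 * (c / 2 ^+ n) * `|t|.
  move=> td.
  have cv : `|(f m t - f m 0) - (f n t - f n 0)| @[m --> \oo] -->
      `|(f0 t - f0 0) - (f n t - f n 0)|.
    apply: cvg_norm; apply: cvgB; last exact: cvg_cst.
    by apply: cvgB; exact: fc.
  have -> : `|(f0 t - f0 0) - (f n t - f n 0)| =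
     limn (fun m => `|(f m t - f m 0) - (f n t - f n 0)|) by apply/esym/cvg_lim.
  apply: limr_le; first by apply/cvg_ex; eexists; exact: cv.
  near=> m.
  have -> : (f m t - f m 0) - (f n t - f n 0) = (f m - f n) t - (f m - f n) 0.
    rewrite /=.
    change (f m t - f m 0 - (f n t - f n 0) = f m t - f n t - (f m 0 - f n 0)).
    ring.
  apply: (increment_le (g := g m - g n) td) => s sd.
    by apply: is_deriveB; exact: fd.
  have h1 := gc n s sd; have h2 := gc m s sd.
  have cmn : c / 2 ^+ m <= c / 2 ^+ n.
    have c0 : 0 <= c.
      have := le_trans (normr_ge0 _) h1; rewrite pmulr_lge0 // invr_gt0 exprn_gt0 //.
    rewrite ler_wpM2l // lef_pV2 ?posrE ?exprn_gt0 // ler_weXn2l ?ler1n //.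
    by near: m; exact: nbhs_infty_ge.
  change (`|g m s - g n s| <= 2 * (c / 2 ^+ n)).
  have -> : g m s - g n s = (g m s - g0 s) - (g n s - g0 s) by ring.
  by apply: (le_trans (ler_normB _ _)); lra.
have lim : h^-1 *: ((f0 \o shift 0) (h *: (1 : R)) - f0 0) @[h --> (0 : R)^'] --> g0 0.
  apply/cvgrPdist_le => eps e0.
  have e8 : 0 < eps / 8 by lra.
  have /cvgr0Pnorm_lt /(_ _ e8) [n _ /(_ n (leqnn n))] := half_pow_cvg0 c.
  move=> /= hn; have {}hn := le_lt_trans (ler_norm _) hn.
  have [dn dnE] := fd n 0 d0'.
  have Dn : h^-1 *: ((f n \o shift 0) (h *: (1 : R)) - f n 0) @[h --> (0 : R)^'] --> g n 0.
    by rewrite -dnE.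
  have e2 : 0 < eps / 2 by lra.
  move/cvgrPdist_lt : Dn => /(_ _ e2) Dn.
  have Hs : \forall h \near (0 : R)^', `|h| < d := dnbhs0_lt d0.
  have Hd : \forall h \near (0 : R)^', `|h| < d /\ h != 0.
    by apply: filterS2 Hs (nbhs_dnbhs_neq (0 : R)) => h.
  apply: filterS2 Dn Hd => h hD [hd h0].
  move: hD; rewrite /= addr0 /GRing.scale /= mulr1 => hD.
  have k1 := key n h hd; have k2 := gc n 0 d0'.
  have k3 : `|h^-1 * (f0 h - f0 0) - h^-1 * (f n h - f n 0)| <= 2 * (c / 2 ^+ n).
    rewrite -mulrBr normrM normfV mulrC ler_pdivrMr ?normr_gt0 //.
  move: hD k2 k3; rewrite ltr_norml !ler_norml.
  move=> /andP[? ?] /andP[? ?] /andP[? ?]; apply/andP; split; lra.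
split; first by apply/cvg_ex; exists (g0 0).
exact/cvg_lim.
Unshelve. all: by end_near. Qed.

End termwise_derivative.

(** * Derivatives of orbits *)

Section jets.
Context {R : realType}.
Local Notation C := (Cplx R).
Variables (q : nat -> {poly C}) (b : nat -> C).
Local Notation orb := (orb q b).

(** The derivative of the k-th point of the orbit in the direction v, obtained by
differentiating the recursion that defines the orbit. *)
Fixpoint jet1 k (v z : C2 R) : C2 R :=
  if k is k'.+1 then
    let y := (orb k' z).2 in let X := jet1 k' v z in
    (X.2, (q k')^`().[y] * X.2 - b k' * X.1)
  else v.

(** The second derivative of the k-th point of the orbit, in the directions v and w. *)
Fixpoint jet2 k (v w z : C2 R) : C2 R :=
  if k is k'.+1 then
    let y := (orb k' z).2 in
    let X := jet1 k' v z in let Y := jet1 k' w z in let Z := jet2 k' v w z in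
    (Z.2, (q k')^`()^`().[y] * (X.2 * Y.2) + (q k')^`().[y] * Z.2 - b k' * Z.1)
  else 0.

Lemma jet1Z k c v z : jet1 k (c *: v) z = c *: jet1 k v z.
Proof.
elim: k => [|k IH] //=; rewrite IH; congr pair => /=.
by rewrite /GRing.scale /=; ring.
Qed.

Lemma jet2Z k c c' v w z : jet2 k (c *: v) (c' *: w) z = (c * c') *: jet2 k v w z.
Proof.
elim: k => [|k IH] /=; first by rewrite scaler0.
rewrite IH !jet1Z; congr pair => /=.
by rewrite /GRing.scale /=; ring.
Qed.

Lemma is_derive_affine (L : C2 R -> C) (z v : C2 R) (d : C) :
  (forall h : C, L (h *: v + z) = h * d + L z) -> is_derive z v L d.
Proof.
move=> HL.
have H : h^-1 *: ((L \o shift z) (h *: v) - L z) @[h --> (0 : C)^'] --> d.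
  apply: cvg_trans (@cvg_cst C d C (0 : C)^' _); apply: near_eq_cvg.
  apply: filterS (nbhs_dnbhs_neq (0 : C)) => h h0.
  by rewrite /= HL addrK /GRing.scale /= mulKf.
split; first by apply/cvg_ex; exists d.
exact/cvg_lim.
Qed.

Lemma orb_is_derive k z v :
  is_derive z v (fun z => (orb k z).1 : C) (jet1 k v z).1 /\
  is_derive z v (fun z => (orb k z).2 : C) (jet1 k v z).2.
Proof.
elim: k => [|k [IH1 IH2]] /=; first by split; apply: is_derive_affine.
split; first exact: IH2.
have h := is_deriveB (is_derive_horner (q k) IH2)
   (is_deriveM (is_derive_cst (b k) z v) IH1).
by apply: (is_derive_eq h); rewrite scaler0 addr0.
Qed.

Lemma jet1_is_derive k v z w :
  is_derive z w (fun z => (jet1 k v z).1 : C) (jet2 k v w z).1 /\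
  is_derive z w (fun z => (jet1 k v z).2 : C) (jet2 k v w z).2.
Proof.
elim: k => [|k [IH1 IH2]] /=.
  by split; apply: is_derive_affine => h; rewrite mulr0 add0r.
split; first exact: IH2.
have [_ y] := orb_is_derive k z w.
have h := is_deriveB (is_deriveM (is_derive_horner (q k)^`() y) IH2)
   (is_deriveM (is_derive_cst (b k) z w) IH1).
apply: (is_derive_eq h); rewrite scaler0 addr0 /GRing.scale /=; ring.
Qed.

Lemma orb_continuous k :
  continuous (fun z : C2 R => (orb k z).1 : C) /\
  continuous (fun z : C2 R => (orb k z).2 : C).
Proof.
elim: k => [|k [IH1 IH2]] /=.
  by split=> z; [exact: cvg_fst|exact: cvg_snd].
split; first exact: IH2.
move=> z; apply: cvg_cplxB; first by apply: cvg_horner; exact: IH2.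
by apply: cvg_cplxM; [exact: cvg_cst|exact: IH1].
Qed.

Lemma jet1_continuous k v :
  continuous (fun z : C2 R => (jet1 k v z).1 : C) /\
  continuous (fun z : C2 R => (jet1 k v z).2 : C).
Proof.
elim: k => [|k [IH1 IH2]] /=; first by split=> z; exact: cvg_cst.
have [_ y] := orb_continuous k.
split; first exact: IH2.
move=> z; apply: cvg_cplxB.
  by apply: cvg_cplxM; [apply: cvg_horner; exact: y|exact: IH2].
by apply: cvg_cplxM; [exact: cvg_cst|exact: IH1].
Qed.

Lemma jet2_continuous k v w :
  continuous (fun z : C2 R => (jet2 k v w z).1 : C) /\
  continuous (fun z : C2 R => (jet2 k v w z).2 : C).
Proof.
elim: k => [|k [IH1 IH2]] /=; first by split=> z; exact: cvg_cst.
have [_ y] := orb_continuous k.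
have [_ X] := jet1_continuous k v; have [_ Y] := jet1_continuous k w.
split; first exact: IH2.
move=> z; apply: cvg_cplxB; first apply: cvg_cplxD.
- apply: cvg_cplxM; first by apply: cvg_horner; exact: y.
  by apply: cvg_cplxM; [exact: X|exact: Y].
- by apply: cvg_cplxM; [apply: cvg_horner; exact: y|exact: IH2].
- by apply: cvg_cplxM; [exact: cvg_cst|exact: IH1].
Qed.

(** The derivative of a local branch of log y_k. *)
Definition log_jet1 k v z : C := (jet1 k v z).2 / (orb k z).2.

(** The second derivative of a local branch of log y_k. *)
Definition log_jet2 k v w z : C :=
  (jet2 k v w z).2 / (orb k z).2
  - (jet1 k v z).2 * (jet1 k w z).2 / (orb k z).2 ^+ 2.

Lemma log_jet1_is_derive k v z w : (orb k z).2 != 0 ->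
  is_derive z w (log_jet1 k v) (log_jet2 k v w z).
Proof.
move=> y0.
exact: (@is_derive_div _ _ (fun z => (jet1 k v z).2) (fun z => (orb k z).2)
  _ _ _ _ y0 (jet1_is_derive k v z w).2 (orb_is_derive k z w).2).
Qed.

Lemma log_jet1_continuous k v z : (orb k z).2 != 0 ->
  {for z, continuous (log_jet1 k v)}.
Proof.
move=> y0; apply: cvg_cplxM; first exact: (jet1_continuous k v).2.
by apply: cvg_cplxV => //; exact: (orb_continuous k).2.
Qed.

Lemma log_jet2_continuous k v w z : (orb k z).2 != 0 ->
  {for z, continuous (log_jet2 k v w)}.
Proof.
move=> y0; have yc := (orb_continuous k).2 z.
apply: cvg_cplxB.
  by apply: cvg_cplxM; [exact: (jet2_continuous k v w).2|exact: cvg_cplxV].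
apply: cvg_cplxM.
  by apply: cvg_cplxM; [exact: (jet1_continuous k v).2|exact: (jet1_continuous k w).2].
apply: cvg_cplxV; first by rewrite expf_neq0.
by under eq_fun do rewrite expr2; rewrite expr2; exact: cvg_cplxM.
Qed.

End jets.

(** * Growth of the derivatives along escaping orbits *)

Section jet_estimates.
Context {R : realType}.
Local Notation C := (Cplx R).
Variables (A : R) (q : nat -> {poly C}) (b : nat -> C) (e : nat -> nat).
Hypothesis T : tame A q b e.
Local Notation orb := (orb q b).
Local Notation jet1 := (jet1 q b).
Local Notation jet2 := (jet2 q b).
Local Notation log_jet1 := (log_jet1 q b).
Local Notation log_jet2 := (log_jet2 q b).

Let Q : R := 4 * A ^+ 4.

Let A1 : 1 <= A := tame_ge1 T.

Let A0 : 0 < A. Proof. exact: lt_le_trans ltr01 A1. Qed.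

Let A4 : [/\ A <= A ^+ 4, A ^+ 2 <= A ^+ 4 & A ^+ 3 <= A ^+ 4].
Proof. by rewrite -{1}(expr1 A) !ler_weXn2l. Qed.

Let Q4 : 4 <= Q.
Proof. by rewrite /Q ler_pMr // exprn_ege1. Qed.

(** The coefficients of the recursions for the jets, in units of the points y and y' of
two consecutive times. The bounds on r1, r2 and s make them O(1 / |y|). *)
Record step_ratio (d : nat) (y y' b q1 q2 r1 r2 s tau : C) : Prop := StepRatio {
  ratio_deriv : y * q1 = (d%:R + r1) * y' ;
  ratio_deriv2 : y ^+ 2 * q2 = ((d * d.-1)%:R + r2) * y' ;
  ratio_coef : b * y = s * y' ;
  ratio_prev : y = tau * y' ;
  ratio_deriv_le : cmod r1 * cmod y <= Q ;
  ratio_deriv2_le : cmod r2 * cmod y <= Q ;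
  ratio_coef_le : cmod s * cmod y <= Q ;
  ratio_prev_le : cmod tau <= 1 }.

Lemma step_ratio_exists k z : escaped (escape_radius A) z ->
  exists r1 r2 s tau, step_ratio (e k).+2 z.2 (step (q k) (b k) z).2 (b k)
    (q k)^`().[z.2] (q k)^`()^`().[z.2] r1 r2 s tau.
Proof.
move=> ez; have [xy ry] := ez.
have low := step_lower T k ez.
have [_ grow] := step_escaped T k (lexx _) ez.
move: low grow => /=; set y := z.2 in xy ry *; set x := z.1 in xy *.
set y' := (q k).[y] - b k * x => low grow.
have N4 : 4 <= cmod y by exact: le_trans (escape_radius_ge4 T) ry.
have N1 : 1 <= cmod y by lra.
have N0 : 0 < cmod y by lra.
have M0 : 0 < cmod y' by lra.
have y'0 : y' != 0 by rewrite -cmod_gt0.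
set P := cmod y ^+ (e k).+1.
have PN : cmod y <= P by rewrite ler_eXnr.
have low' : P * cmod y <= 2 * A * cmod y' by rewrite -exprSr.
have bx : cmod (b k * x) <= A * P.
  rewrite cmodM; apply: ler_pM; rewrite ?cmod_ge0 // ?(tame_coef T) //.
  exact: le_trans PN.
have [AA2 AA3 AA4] := A4.
have dA := tame_deg T k.
have ratio (num : C) (c : R) : 0 <= c -> cmod num <= c * P ->
    cmod (num / y') * cmod y <= c * (2 * A).
  move=> c0 h; rewrite cmodM cmodV mulrAC ler_pdivrMr //.
  apply: (@le_trans _ _ (c * P * cmod y)); first by rewrite ler_wpM2r // ltW.
  by rewrite -!mulrA ler_wpM2l // mulrA.
pose d : C := (e k).+2%:R; pose dd : C := ((e k).+2 * (e k).+1)%:R.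
have dm : cmod d <= A by rewrite /d cmod_nat.
have ddm : cmod dd <= A ^+ 2.
  rewrite /dd cmod_nat natrM expr2; apply: ler_pM => //.
  by apply: le_trans dA; rewrite ler_nat.
pose n1 := y * (q k)^`().[y] - d * y'.
pose n2 := y ^+ 2 * (q k)^`()^`().[y] - dd * y'.
have n1m : cmod n1 <= (2 * A ^+ 2) * P.
  have -> : n1 = (y * (q k)^`().[y] - d * (q k).[y]) + d * (b k * x).
    by rewrite /n1 /y'; ring.
  apply: (le_trans (cmodD _ _)); rewrite cmodM.
  have h1 : cmod (y * (q k)^`().[y] - d * (q k).[y]) <= A * P.
    exact: (tame_euler T k N1 (lexx _)).
  have h2 : cmod d * cmod (b k * x) <= A * (A * P).
    by apply: ler_pM; rewrite ?cmod_ge0.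
  have h3 : A * P <= A ^+ 2 * P.
    by rewrite ler_wpM2r ?exprn_ge0 ?cmod_ge0 // expr2 ler_peMr // ltW.
  by move: h2; rewrite mulrA -expr2; lra.
have n2m : cmod n2 <= (2 * A ^+ 3) * P.
  have -> : n2 = (y ^+ 2 * (q k)^`()^`().[y] - dd * (q k).[y]) + dd * (b k * x).
    by rewrite /n2 /y'; ring.
  apply: (le_trans (cmodD _ _)); rewrite cmodM.
  have h1 : cmod (y ^+ 2 * (q k)^`()^`().[y] - dd * (q k).[y]) <= A * P.
    exact: (tame_euler2 T k N1 (lexx _)).
  have h2 : cmod dd * cmod (b k * x) <= A ^+ 2 * (A * P).
    by apply: ler_pM; rewrite ?cmod_ge0.
  have h3 : A * P <= A ^+ 3 * P.
    by rewrite ler_wpM2r ?exprn_ge0 ?cmod_ge0 // ler_eXnr.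
  by move: h2; rewrite mulrA -exprSr; lra.
exists (n1 / y'), (n2 / y'), (b k * y / y'), (y / y'); split.
- by rewrite mulrDl divfK // /n1 addrC subrK.
- by rewrite mulrDl divfK // /n2 addrC subrK.
- by rewrite divfK.
- by rewrite divfK.
- apply: (le_trans (ratio _ _ _ n1m)); first by rewrite mulr_ge0 // exprn_ge0 // ltW.
  have -> : 2 * A ^+ 2 * (2 * A) = 4 * A ^+ 3 by ring.
  by rewrite /Q ler_pM2l.
- apply: (le_trans (ratio _ _ _ n2m)); first by rewrite mulr_ge0 // exprn_ge0 // ltW.
  by rewrite /Q le_eqVlt; apply/orP; left; apply/eqP; ring.
- have bym : cmod (b k * y) <= A * P.
    by rewrite cmodM; apply: ler_pM; rewrite ?cmod_ge0 // (tame_coef T).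
  apply: (le_trans (ratio _ _ (ltW A0) bym)).
  have -> : A * (2 * A) = 2 * A ^+ 2 by ring.
  by rewrite /Q; have := A1; lra.
- by rewrite cmodM cmodV ler_pdivrMr // mul1r; lra.
Qed.

(** Jets in units of the current point. *)
Definition rel1 k v z : C2 R := ((jet1 k v z).1 / (orb k z).2, (jet1 k v z).2 / (orb k z).2).
Definition rel2 k v w z : C2 R :=
  ((jet2 k v w z).1 / (orb k z).2, (jet2 k v w z).2 / (orb k z).2).

(** In relative terms the recursions have coefficients close to d and d (d - 1), where d
is the degree. *)
Lemma rel_step k v w z : escaped (escape_radius A) (orb k z) ->
  exists r1 r2 s tau : C,
  [/\ [/\ cmod r1 * cmod (orb k z).2 <= Q, cmod r2 * cmod (orb k z).2 <= Q,
         cmod s * cmod (orb k z).2 <= Q & cmod tau <= 1],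
     forall u, rel1 k.+1 u z =
       (tau * (rel1 k u z).2, ((e k).+2%:R + r1) * (rel1 k u z).2 - s * (rel1 k u z).1) &
     rel2 k.+1 v w z =
       (tau * (rel2 k v w z).2,
        (((e k).+2 * (e k).+1)%:R + r2) * ((rel1 k v z).2 * (rel1 k w z).2) +
        ((e k).+2%:R + r1) * (rel2 k v w z).2 - s * (rel2 k v w z).1)].
Proof.
move=> ez; have [r1 [r2 [s [tau S]]]] := step_ratio_exists k ez.
exists r1, r2, s, tau; case: S => E1 E2 E3 E4 b1 b2 b3 b4.
have y0 : (orb k z).2 != 0.
  by rewrite -cmod_gt0; have := le_trans (escape_radius_ge4 T) ez.2; lra.
have y'0 : (step (q k) (b k) (orb k z)).2 != 0.
  rewrite -cmod_gt0; have [_] := step_escaped T k (lexx _) ez.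
  by have := le_trans (escape_radius_ge4 T) ez.2; lra.
set y := (orb k z).2 in y0 b1 b2 b3 E1 E2 E3 E4 *.
set y' := (step _ _ _).2 in y'0 E1 E2 E3 E4 *.
have D1 : (e k).+2%:R + r1 = y * (q k)^`().[y] / y' by rewrite E1 mulfK.
have D2 : ((e k).+2 * (e k).+2.-1)%:R + r2 = y ^+ 2 * (q k)^`()^`().[y] / y'.
  by rewrite E2 mulfK.
have D3 : s = b k * y / y' by rewrite E3 mulfK.
have D4 : tau = y / y' by rewrite {1}E4 mulfK.
split=> // [u|].
- rewrite D1 D3 D4.
  transitivity (((jet1 k u z).2 / y',
    ((q k)^`().[y] * (jet1 k u z).2 - b k * (jet1 k u z).1) / y') : C2 R) => //.
  by rewrite /rel1 -/y; congr pair => /=; field; rewrite ?y0 ?y'0.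
- rewrite D1 D2 D3 D4.
  transitivity (((jet2 k v w z).2 / y',
    ((q k)^`()^`().[y] * ((jet1 k v z).2 * (jet1 k w z).2)
     + (q k)^`().[y] * (jet2 k v w z).2 - b k * (jet2 k v w z).1) / y') : C2 R) => //.
  by rewrite /rel1 /rel2 -/y; congr pair => /=; field; rewrite ?y0 ?y'0.
Qed.

Lemma rel_log1 k v z : log_jet1 k v z = (rel1 k v z).2.
Proof. by []. Qed.

Lemma rel_log2 k v w z : log_jet2 k v w z =
  (rel2 k v w z).2 - (rel1 k v z).2 * (rel1 k w z).2.
Proof.
rewrite /log_jet2 /rel1 /rel2 /= expr2 invfM; congr (_ - _); ring.
Qed.

(** A bound for the growth per step of the relative first derivatives. *)
Definition growth1 : R := 4 * Q.
(** A bound for the growth per step of the relative second derivatives, whose recursion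
contains products of two first derivatives. *)
Definition growth2 : R := 4 * growth1 ^+ 2.
(** From this radius on |y| grows per step by twice the factor [growth2] allowed for the
jets, so that O(1 / |y|) errors are summable after multiplication by the jets. *)
Definition far_radius : R := escape_radius A + 2 * A * (2 * growth2).

Lemma far_radius_ge : escape_radius A <= far_radius.
Proof.
rewrite /far_radius lerDl mulr_ge0 //; first by have := A0; lra.
by rewrite mulr_ge0 // /growth2 mulr_ge0 // sqr_ge0.
Qed.

Lemma growth1_ge : 16 <= growth1.
Proof. by rewrite /growth1; have := Q4; lra. Qed.

Lemma growth12 : growth1 <= growth2 /\ 1 <= growth2.
Proof. by have := growth1_ge; rewrite /growth2; split; nra. Qed.

Lemma growth_pow j : growth1 ^+ j <= growth2 ^+ j.
Proof.
have [g12 g2] := growth12; have g1 := growth1_ge.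
by rewrite lerXn2r // nnegrE; lra.
Qed.

Lemma growth_sqr (E : R) j :
  (growth1 ^+ j * E) * (growth1 ^+ j * E) <= growth2 ^+ j * E ^+ 2.
Proof.
have -> : (growth1 ^+ j * E) * (growth1 ^+ j * E) = (growth1 ^+ 2) ^+ j * E ^+ 2.
  by rewrite -exprM mulnC exprM; ring.
rewrite ler_wpM2r ?sqr_ge0 // lerXn2r ?nnegrE ?sqr_ge0 //.
  by rewrite /growth2 mulr_ge0 ?sqr_ge0.
by rewrite /growth2 ler_peMl ?sqr_ge0 // ler1n.
Qed.

Lemma ratio_crude k z (r1 r2 s : C) : escaped (escape_radius A) (orb k z) ->
  cmod r1 * cmod (orb k z).2 <= Q -> cmod r2 * cmod (orb k z).2 <= Q ->
  cmod s * cmod (orb k z).2 <= Q ->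
  [/\ cmod r1 <= Q, cmod r2 <= Q, cmod s <= Q &
    cmod ((e k).+2%:R : C) <= Q /\ cmod (((e k).+2 * (e k).+1)%:R : C) <= Q].
Proof.
move=> ez b1 b2 b3.
have N1 : 1 <= cmod (orb k z).2.
  by have := le_trans (escape_radius_ge4 T) ez.2; lra.
have crude (r : C) : cmod r * cmod (orb k z).2 <= Q -> cmod r <= Q.
  by apply: le_trans; rewrite ler_peMr ?cmod_ge0.
have [AA2 AA3 AA4] := A4; have dA := tame_deg T k; have a1 := A1.
split; [exact: crude|exact: crude|exact: crude|split].
  by rewrite cmod_nat /Q; lra.
rewrite cmod_nat natrM; apply: (@le_trans _ _ (A ^+ 2)); last by rewrite /Q; lra.
by rewrite expr2; apply: ler_pM => //; apply: le_trans dA; rewrite ler_nat.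
Qed.

Section far_orbit.
Variables (n : nat) (z : C2 R).
Hypothesis far : escaped far_radius (orb n z).

Lemma far_escaped j : escaped (escape_radius A) (orb (n + j) z).
Proof.
apply: (@escaped_orb _ _ _ _ _ T _ _ n) => //; last exact: leq_addr.
by case: far => h1 h2; split=> //; exact: le_trans far_radius_ge _.
Qed.

Lemma far_growth j : (2 * growth2) ^+ j <= cmod (orb (n + j) z).2.
Proof.
have [g12 g2] := growth12.
have H i : escaped far_radius (orb (n + i) z).
  exact: (escaped_orb T far_radius_ge far (leq_addr _ _)).
elim: j => [|j IH].
  rewrite addn0 expr0; apply: le_trans far.2; apply: le_trans far_radius_ge.
  by have := escape_radius_ge4 T; lra.
rewrite addnS exprS.
apply: (le_trans _ (step_grow T (n + j) (K := 2 * growth2) (far_escaped j) _)).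
  by rewrite ler_wpM2l //; lra.
apply: le_trans (H j).2; rewrite /far_radius lerDr.
by have := escape_radius_ge4 T; lra.
Qed.

Variable E : R.
Hypothesis E1 : 1 <= E.

Lemma rel1_bound v : cmod (rel1 n v z).1 <= E -> cmod (rel1 n v z).2 <= E ->
  forall j, cmod (rel1 (n + j) v z).1 <= growth1 ^+ j * E /\
            cmod (rel1 (n + j) v z).2 <= growth1 ^+ j * E.
Proof.
move=> h1 h2; elim=> [|j [IH1 IH2]]; first by rewrite addn0 expr0 mul1r.
have [r1 [r2 [s [tau [[b1 b2 b3 b4] step1 _]]]]] := rel_step v v (far_escaped j).
rewrite addnS step1 /= exprS -mulrA.
have [c1 c2 c3 c4] := ratio_crude (far_escaped j) b1 b2 b3.
move: IH1 IH2; set G := growth1 ^+ j * E; set a := (rel1 _ v z).2; set a' := (rel1 _ v z).1.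
move=> IH1 IH2; have G0 : 0 <= G := le_trans (cmod_ge0 _) IH1.
have Q0 : 0 <= Q by have := Q4; lra.
have QG : 0 <= Q * G by rewrite mulr_ge0.
split.
  rewrite cmodM; apply: (@le_trans _ _ (1 * G)); first by apply: ler_pM; rewrite ?cmod_ge0.
  by rewrite ler_wpM2r //; have := growth1_ge; lra.
apply: (le_trans (cmodB _ _)); rewrite (cmodM _ a) (cmodM s).
have h3 : cmod ((e (n + j)).+2%:R + r1) * cmod a <= (2 * Q) * G.
  by apply: ler_pM; rewrite ?cmod_ge0 //; apply: (le_trans (cmodD _ _)); lra.
have h4 : cmod s * cmod a' <= Q * G by apply: ler_pM; rewrite ?cmod_ge0.
by rewrite /growth1; lra.
Qed.

Lemma rel2_bound v w :
  cmod (rel1 n v z).1 <= E -> cmod (rel1 n v z).2 <= E ->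
  cmod (rel1 n w z).1 <= E -> cmod (rel1 n w z).2 <= E ->
  cmod (rel2 n v w z).1 <= E -> cmod (rel2 n v w z).2 <= E ->
  forall j, cmod (rel2 (n + j) v w z).1 <= growth2 ^+ j * E ^+ 2 /\
            cmod (rel2 (n + j) v w z).2 <= growth2 ^+ j * E ^+ 2.
Proof.
move=> v1 v2 w1 w2 h1 h2; have EE : E <= E ^+ 2 by rewrite ler_eXnr.
elim=> [|j [IH1 IH2]].
  by rewrite addn0 expr0 mul1r; split; [exact: le_trans h1 EE|exact: le_trans h2 EE].
have [r1 [r2 [s [tau [[b1 b2 b3 b4] _ step2]]]]] := rel_step v w (far_escaped j).
have [_ bv] := rel1_bound v1 v2 j; have [_ bw] := rel1_bound w1 w2 j.
rewrite addnS step2 /= exprS -mulrA.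
have [c1 c2 c3 [c4 c5]] := ratio_crude (far_escaped j) b1 b2 b3.
have GG := growth_sqr E j.
move: IH1 IH2; set G := growth2 ^+ j * E ^+ 2.
set g := (rel2 _ v w z).2; set g' := (rel2 _ v w z).1.
move=> IH1 IH2; have G0 : 0 <= G := le_trans (cmod_ge0 _) IH1.
have Q0 : 0 <= Q by have := Q4; lra.
have QG : 0 <= Q * G by rewrite mulr_ge0.
have g1 := growth1_ge; have gQ : 4 * Q = growth1 by [].
have g21 : 4 * Q * 4 <= growth2 by rewrite /growth2 gQ; nra.
have g21G : 4 * Q * 4 * G <= growth2 * G by rewrite ler_wpM2r.
split.
  rewrite cmodM; apply: (@le_trans _ _ (1 * G)); first by apply: ler_pM; rewrite ?cmod_ge0.
  by rewrite ler_wpM2r //; have := growth12; lra.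
have vw : cmod ((rel1 (n + j) v z).2 * (rel1 (n + j) w z).2) <= G.
  rewrite cmodM; apply: (@le_trans _ _ ((growth1 ^+ j * E) * (growth1 ^+ j * E))).
    by apply: ler_pM; rewrite ?cmod_ge0.
  exact: growth_sqr.
set vw' := _ * (rel1 _ w z).2 in vw *.
apply: (le_trans (cmodB _ _)).
apply: (@le_trans _ _ (2 * Q * G + 2 * Q * G + Q * G)); last first.
  by move: g21G; lra.
apply: lerD; last by rewrite cmodM; apply: ler_pM; rewrite ?cmod_ge0.
apply: (le_trans (cmodD _ _)); apply: lerD; rewrite cmodM; apply: ler_pM; rewrite ?cmod_ge0 //.
  by apply: (le_trans (cmodD _ _)); lra.
by apply: (le_trans (cmodD _ _)); lra.
Qed.

(** As |y| grows by 2 [growth2] per step, the error is at most c / 2^j. *)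
Lemma rescaled_step (l l' : C) (c : R) j : 0 <= c ->
  cmod (l' - (e (n + j)).+2%:R * l) * cmod (orb (n + j) z).2 <= c * growth2 ^+ j ->
  `|complex.Re l' / total_deg e (n + j.+1) - complex.Re l / total_deg e (n + j)| <=
    2 * c / 2 ^+ j.+1.
Proof.
move=> c0 h; rewrite addnS total_degS.
have D0 : 0 < total_deg e (n + j) :> R := total_deg_gt0 _ _.
set d : R := (e (n + j)).+2%:R; have d0 : 0 < d by rewrite ltr0n.
have [_ g2] := growth12.
have K0 : 0 < (2 * growth2) ^+ j by rewrite exprn_gt0 //; lra.
have -> : complex.Re l' / (total_deg e (n + j) * d) - complex.Re l / total_deg e (n + j) =
   complex.Re (l' - (e (n + j)).+2%:R * l) / (total_deg e (n + j) * d).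
  have -> : complex.Re (l' - (e (n + j)).+2%:R * l) = complex.Re l' - d * complex.Re l.
    rewrite -(rmorph_nat (real_complex R)) -/d.
    by case: l l' {h} => x y [x' y'] /=; rewrite mul0r subr0.
  by field; rewrite !gt_eqF.
have Dd : 1 <= total_deg e (n + j) * d.
  by rewrite -total_degS; apply: le_trans (total_deg_ge _ _); rewrite exprn_ege1 // ler1n.
rewrite normrM [`|_^-1|]gtr0_norm ?invr_gt0; last by lra.
rewrite ler_pdivrMr; last by lra.
have h2 : cmod (l' - (e (n + j)).+2%:R * l) <= c / 2 ^+ j.
  rewrite ler_pdivlMr ?exprn_gt0 // -(ler_pM2r (_ : 0 < growth2 ^+ j)); last first.
    by rewrite exprn_gt0 //; lra.
  rewrite -mulrA -exprMn; apply: le_trans h.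
  by rewrite ler_wpM2l ?cmod_ge0 // far_growth.
apply: (le_trans (Re_cmod _)); apply: (le_trans h2).
have -> : 2 * c / 2 ^+ j.+1 = c / 2 ^+ j.
  by rewrite exprS; field; rewrite expf_neq0.
by rewrite ler_peMr // divr_ge0 // exprn_ge0.
Qed.

Lemma log_jet1_step v : cmod (rel1 n v z).1 <= E -> cmod (rel1 n v z).2 <= E ->
  forall j, `|complex.Re (log_jet1 (n + j.+1) v z) / total_deg e (n + j.+1) -
     complex.Re (log_jet1 (n + j) v z) / total_deg e (n + j)| <= 2 * (2 * Q * E) / 2 ^+ j.+1.
Proof.
move=> h1 h2 j; have Q0 : 0 <= Q by have := Q4; lra.
apply: rescaled_step; first by apply: mulr_ge0; [apply: mulr_ge0|have := E1; lra].
have [r1 [r2 [s [tau [[b1 b2 b3 b4] step1 _]]]]] := rel_step v v (far_escaped j).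
have [bv' bv] := rel1_bound h1 h2 j.
rewrite !rel_log1 addnS step1 /=.
move: bv' bv b1 b3; set a := (rel1 _ v z).2; set a' := (rel1 _ v z).1 => bv' bv b1 b3.
have -> : ((e (n + j)).+2%:R + r1) * a - s * a' - (e (n + j)).+2%:R * a =
    r1 * a - s * a' by ring.
have gE : growth1 ^+ j * E <= growth2 ^+ j * E.
  by apply: ler_wpM2r; [have := E1; lra|exact: growth_pow].
apply: (@le_trans _ _ (Q * (growth1 ^+ j * E) + Q * (growth1 ^+ j * E))).
  set N := cmod (orb (n + j) z).2 in b1 b3 *.
  have N0 : 0 <= N := cmod_ge0 _.
  apply: (@le_trans _ _ (cmod r1 * N * cmod a + cmod s * N * cmod a')).
    rewrite [cmod r1 * N * _]mulrAC [cmod s * N * _]mulrAC -mulrDl ler_wpM2r //.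
    by rewrite -!cmodM cmodB.
  by apply: lerD; apply: ler_pM; rewrite ?mulr_ge0 ?cmod_ge0.
have : Q * (growth1 ^+ j * E) <= Q * (growth2 ^+ j * E) by rewrite ler_wpM2l.
lra.
Qed.

(** Inserting the recursions of [rel_step], the main terms of t' - d t cancel because
d (d - 1) - d^2 + d = 0; every remaining term contains r1, r2 or s. *)
Lemma log_jet2_step v w :
  cmod (rel1 n v z).1 <= E -> cmod (rel1 n v z).2 <= E ->
  cmod (rel1 n w z).1 <= E -> cmod (rel1 n w z).2 <= E ->
  cmod (rel2 n v w z).1 <= E -> cmod (rel2 n v w z).2 <= E ->
  forall j, `|complex.Re (log_jet2 (n + j.+1) v w z) / total_deg e (n + j.+1) -
     complex.Re (log_jet2 (n + j) v w z) / total_deg e (n + j)| <=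
    2 * (9 * Q ^+ 2 * E ^+ 2) / 2 ^+ j.+1.
Proof.
move=> v1 v2 w1 w2 h1 h2 j; have Q0 : 0 <= Q by have := Q4; lra.
apply: rescaled_step; first by rewrite mulr_ge0 ?sqr_ge0 // mulr_ge0 ?sqr_ge0.
have [r1 [r2 [s [tau [[b1 b2 b3 b4] step1 step2]]]]] := rel_step v w (far_escaped j).
have [c1 c2 c3 [c4 c5]] := ratio_crude (far_escaped j) b1 b2 b3.
have [bv' bv] := rel1_bound v1 v2 j; have [bw' bw] := rel1_bound w1 w2 j.
have [bg' bg] := rel2_bound v1 v2 w1 w2 h1 h2 j.
have GG := growth_sqr E j.
rewrite !rel_log2 addnS !step1 step2 /=.
move: bv' bv bw' bw bg' bg b1 b2 b3.
set al := (rel1 _ v z).2; set al' := (rel1 _ v z).1.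
set be := (rel1 _ w z).2; set be' := (rel1 _ w z).1.
set ga := (rel2 _ v w z).2; set ga' := (rel2 _ v w z).1.
set N := cmod (orb (n + j) z).2.
set H := growth1 ^+ j * E in GG *; set G := growth2 ^+ j * E ^+ 2 in GG *.
move=> bv' bv bw' bw bg' bg b1 b2 b3.
set d : C := (e (n + j)).+2%:R in c4 *.
have ddE : ((e (n + j)).+2 * (e (n + j)).+1)%:R = d ^+ 2 - d :> C.
  by rewrite natrM expr2 -[X in _ = _ - X]mulr1 -mulrBr /d -(natr1 (e (n + j)).+1) addrK.
rewrite ddE.
have -> : (d ^+ 2 - d + r2) * (al * be) + (d + r1) * ga - s * ga' -
    ((d + r1) * al - s * al') * ((d + r1) * be - s * be') - d * (ga - al * be) =
    r1 * ga - s * ga' + r2 * (al * be) - r1 * ((2 * d + r1) * (al * be))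
    + s * ((d + r1) * (al * be' + al' * be)) - s * (s * (al' * be')) by ring.
have N0 : 0 <= N := cmod_ge0 _.
have G0 : 0 <= G := le_trans (cmod_ge0 _) bg.
have prod (x y : C) : cmod x <= H -> cmod y <= H -> cmod (x * y) <= G.
  move=> hx hy; rewrite cmodM; apply: le_trans GG.
  by apply: ler_pM; rewrite ?cmod_ge0.
have small (r x : C) (m : R) : cmod r * N <= Q -> cmod x <= m * G ->
    cmod (r * x) * N <= Q * m * G.
  move=> hr hx; rewrite cmodM mulrAC -[leRHS]mulrA.
  by apply: ler_pM; rewrite ?mulr_ge0 ?cmod_ge0.
have t1 : cmod (r1 * ga) * N <= Q * 1 * G by apply: small; rewrite ?mul1r.
have t2 : cmod (s * ga') * N <= Q * 1 * G by apply: small; rewrite ?mul1r.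
have t3 : cmod (r2 * (al * be)) * N <= Q * 1 * G.
  by apply: small => //; rewrite mul1r prod.
have t4 : cmod (r1 * ((2 * d + r1) * (al * be))) * N <= Q * (3 * Q) * G.
  apply: small => //; rewrite cmodM; apply: ler_pM; rewrite ?cmod_ge0 ?prod //.
  by apply: (le_trans (cmodD _ _)); rewrite cmodM cmod_nat; lra.
have t5 : cmod (s * ((d + r1) * (al * be' + al' * be))) * N <= Q * (4 * Q) * G.
  apply: small => //; rewrite cmodM.
  have -> : 4 * Q * G = (2 * Q) * (2 * G) by ring.
  apply: ler_pM; rewrite ?cmod_ge0 //.
    by apply: (le_trans (cmodD _ _)); lra.
  apply: (le_trans (cmodD _ _)).
  by have := prod _ _ bv bw'; have := prod _ _ bv' bw; lra.
have t6 : cmod (s * (s * (al' * be'))) * N <= Q * Q * G.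
  by apply: small => //; rewrite cmodM; apply: ler_pM; rewrite ?cmod_ge0 ?prod.
apply: (@le_trans _ _ (Q * 1 * G + Q * 1 * G + Q * 1 * G +
    Q * (3 * Q) * G + Q * (4 * Q) * G + Q * Q * G)).
  have tri (x1 x2 x3 x4 x5 x6 : C) : cmod (x1 - x2 + x3 - x4 + x5 - x6) * N <=
     cmod x1 * N + cmod x2 * N + cmod x3 * N + cmod x4 * N + cmod x5 * N + cmod x6 * N.
    rewrite -!mulrDl ler_wpM2r //.
    have := cmodB (x1 - x2 + x3 - x4 + x5) x6.
    have := cmodD (x1 - x2 + x3 - x4) x5.
    have := cmodB (x1 - x2 + x3) x4.
    have := cmodD (x1 - x2) x3.
    have := cmodB x1 x2.
    lra.
  apply: (le_trans (tri _ _ _ _ _ _)); lra.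
have -> : 9 * Q ^+ 2 * E ^+ 2 * growth2 ^+ j = 9 * Q * Q * G by rewrite /G; ring.
have : 3 * Q * G <= Q * Q * G.
  by rewrite ler_wpM2r // ler_wpM2r //; have := Q4; lra.
lra.
Qed.

End far_orbit.

End jet_estimates.

(** * Pluriharmonicity on the escaping set *)

Section local_limits.
Context {R : realType}.

Lemma cvg_shift (u : nat -> R) (l : R) n :
  (u (n + j)%N @[j --> \oo] --> l) <-> (u j @[j --> \oo] --> l).
Proof.
have -> : (fun j => u (n + j)%N) = [sequence u (j + n)%N]_j.
  by apply/funext => j /=; rewrite addnC.
by rewrite cvg_shiftn.
Qed.

Lemma dyadic_limit_continuous (V : topologicalType) (f : nat -> V -> R) (g : V -> R)
    (z0 : V) (c : R) :
  (forall j, {for z0, continuous (f j)}) ->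
  (\forall z \near z0, forall j, `|f j z - g z| <= c / 2 ^+ j) ->
  {for z0, continuous g}.
Proof.
move=> fc H; have H0 := nbhs_singleton H.
apply/cvgrPdist_lt => eps e0; have e3 : 0 < eps / 3 by lra.
have /cvgr0Pnorm_lt /(_ _ e3) [k _ /(_ k (leqnn k))] := half_pow_cvg0 c.
move=> /= hk; have {}hk := le_lt_trans (ler_norm _) hk.
have /cvgrPdist_lt /(_ _ e3) fk := fc k.
apply: filterS2 H fk => z Hz fz.
have h0 := H0 k; have h1 := Hz k.
have -> : g z0 - g z = (f k z0 - f k z) - (f k z0 - g z0) + (f k z - g z) by ring.
apply: (le_lt_trans (ler_normD _ _)).
have := ler_normB (f k z0 - f k z) (f k z0 - g z0); lra.
Qed.

End local_limits.

Section pluriharmonicity.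
Context {R : realType}.
Local Notation C := (Cplx R).
Variables (A : R) (q : nat -> {poly C}) (b : nat -> C) (e : nat -> nat).
Hypothesis T : tame A q b e.
Local Notation orb := (orb q b).
Local Notation green := (green q b e).
Local Notation log_jet1 := (log_jet1 q b).
Local Notation log_jet2 := (log_jet2 q b).

Definition escaping : set (C2 R) := [set z | exists k, escaped (escape_radius A) (orb k z)].

Lemma escaped_near (r : R) n z0 : cmod (orb n z0).1 < cmod (orb n z0).2 ->
  r < cmod (orb n z0).2 -> \forall z \near z0, escaped r (orb n z).
Proof.
move=> xy ry; have [xc yc] := orb_continuous q b n.
have mc := @cmod_continuous R.
have X : cmod (orb n z).1 @[z --> z0] --> cmod (orb n z0).1.
  exact: cvg_comp (xc z0) (mc _).
have Y : cmod (orb n z).2 @[z --> z0] --> cmod (orb n z0).2.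
  exact: cvg_comp (yc z0) (mc _).
have D : cmod (orb n z).2 - cmod (orb n z).1 @[z --> z0] -->
   cmod (orb n z0).2 - cmod (orb n z0).1 by exact: cvgB.
have Y' : \forall z \near z0, r < cmod (orb n z).2 by exact: (cvgr_gt _ Y).
have xy0 : 0 < cmod (orb n z0).2 - cmod (orb n z0).1 by rewrite subr_gt0.
have D' : \forall z \near z0, 0 < cmod (orb n z).2 - cmod (orb n z).1.
  exact: (cvgr_gt _ D).
by apply: filterS2 Y' D' => z h1 h2; split; lra.
Qed.

(** Escaping is an open condition, at any prescribed distance: one more step makes the
inequality |x| <= |y| strict. *)
Lemma escaping_far (r : R) z0 : escaping z0 ->
  exists n, \forall z \near z0, escaped r (orb n z).
Proof.
move=> [k ek].
have grow j : 2 ^+ j <= cmod (orb (k + j) z0).2 /\ escaped (escape_radius A) (orb (k + j) z0).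
  elim: j => [|j [IH1 IH2]].
    by rewrite addn0 expr0; split=> //; have := le_trans (escape_radius_ge4 T) ek.2; lra.
  have [h1 h2] := step_escaped T (k + j) (lexx _) IH2.
  by rewrite addnS exprS; split=> //; apply: le_trans h2; rewrite ler_pM2l.
pose j := (Num.bound (Num.max r 0)).+1.
have rj : r < 2 ^+ j.
  have m0 : 0 <= Num.max r 0 by rewrite le_max lexx orbT.
  apply: (@le_lt_trans _ _ (Num.max r 0)); first by rewrite le_max lexx.
  apply: (lt_le_trans (archi_boundP m0)).
  apply: (@le_trans _ _ (2 ^+ Num.bound (Num.max r 0))).
    by rewrite -natrX ler_nat ltnW // ltn_expl.
  by rewrite ler_weXn2l // ler1n.
have [g1 g2] := grow j; have [h1 h2] := step_escaped T (k + j) (lexx _) g2.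
have y4 := le_trans (escape_radius_ge4 T) g2.2.
exists (k + j).+1; apply: escaped_near; rewrite /=; move: h2 => /=; lra.
Qed.

Lemma escaping_open : open escaping.
Proof.
rewrite openE => z /(@escaping_far (escape_radius A))[n H].
by apply: filterS H => w; exists n.
Qed.

Lemma near_cmod_le (f : C2 R -> C) z0 : {for z0, continuous f} ->
  \forall z \near z0, cmod (f z) <= cmod (f z0) + 1.
Proof.
move=> fc.
have X : cmod (f z) @[z --> z0] --> cmod (f z0).
  exact: cvg_comp fc (@cmod_continuous R _).
have lt1 : cmod (f z0) < cmod (f z0) + 1 by rewrite ltrDl.
have H : \forall z \near z0, cmod (f z) < cmod (f z0) + 1 by exact: (cvgr_lt _ X).
by apply: filterS H => z; exact: ltW.
Qed.

Lemma near_rel_le (X : C2 R -> C) n z0 : (orb n z0).2 != 0 -> continuous X ->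
  \forall z \near z0, cmod (X z / (orb n z).2) <= cmod (X z0 / (orb n z0).2) + 1.
Proof.
move=> y0 Xc; apply: (@near_cmod_le (fun z => X z / (orb n z).2)).
apply: cvg_cplxM; first exact: Xc.
by apply: cvg_cplxV => //; exact: (orb_continuous q b n).2.
Qed.

Definition dgreen_approx v k z : R := complex.Re (log_jet1 k v z) / total_deg e k.
Definition d2green_approx v w k z : R := complex.Re (log_jet2 k v w z) / total_deg e k.

(** The jets at time n are bounded near z0 by continuity; from then on the estimates are
uniform. *)
Lemma local_jet_cvg z0 v w : escaping z0 -> exists n c, \forall z \near z0,
  [/\ escaped (far_radius A) (orb n z),
      forall j, `|dgreen_approx v (n + j.+1) z - dgreen_approx v (n + j) z|
        <= c / 2 ^+ j.+1 &
      forall j, `|d2green_approx v w (n + j.+1) z - d2green_approx v w (n + j) z|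
        <= c / 2 ^+ j.+1].
Proof.
move=> /(@escaping_far (far_radius A))[n H].
have H0 := nbhs_singleton H.
have y0 : (orb n z0).2 != 0.
  rewrite -cmod_gt0; have := H0.2; have := far_radius_ge T; have := escape_radius_ge4 T; lra.
pose m (X : C2 R) : R := cmod (X.1 / (orb n z0).2) + 1 + (cmod (X.2 / (orb n z0).2) + 1).
have m0 X : 0 <= m X.
  rewrite /m; have := cmod_ge0 (X.1 / (orb n z0).2).
  have := cmod_ge0 (X.2 / (orb n z0).2); lra.
have mB (J : C2 R -> C2 R) :
    continuous (fun z => (J z).1 : C) -> continuous (fun z => (J z).2 : C) ->
    \forall z \near z0, cmod ((J z).1 / (orb n z).2) <= m (J z0) /\
       cmod ((J z).2 / (orb n z).2) <= m (J z0).
  move=> c1 c2; apply: filterS2 (near_rel_le y0 c1) (near_rel_le y0 c2) => z h1 h2.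
  rewrite /m; have := cmod_ge0 ((J z0).1 / (orb n z0).2).
  by have := cmod_ge0 ((J z0).2 / (orb n z0).2); split; lra.
(* A common bound for the relative jets at time n, valid near z0. *)
pose E := 1 + m (jet1 q b n v z0) + m (jet1 q b n w z0) + m (jet2 q b n v w z0).
have [Em Em' Em''] : [/\ m (jet1 q b n v z0) <= E, m (jet1 q b n w z0) <= E &
    m (jet2 q b n v w z0) <= E].
  by rewrite /E; have := m0 (jet1 q b n v z0); have := m0 (jet1 q b n w z0);
     have := m0 (jet2 q b n v w z0); split; lra.
have E1 : 1 <= E.
  by rewrite /E; have := m0 (jet1 q b n v z0); have := m0 (jet1 q b n w z0);
     have := m0 (jet2 q b n v w z0); lra.
pose Q : R := 4 * A ^+ 4.
exists n, (Num.max (2 * (2 * Q * E)) (2 * (9 * Q ^+ 2 * E ^+ 2))).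
have Hv := mB _ (jet1_continuous q b n v).1 (jet1_continuous q b n v).2.
have Hw := mB _ (jet1_continuous q b n w).1 (jet1_continuous q b n w).2.
have Hvw := mB _ (jet2_continuous q b n v w).1 (jet2_continuous q b n v w).2.
near=> z.
have far : escaped (far_radius A) (orb n z) by near: z.
have [v1 v2] : cmod (rel1 q b n v z).1 <= m (jet1 q b n v z0) /\
    cmod (rel1 q b n v z).2 <= m (jet1 q b n v z0) by near: z; exact: Hv.
have [w1 w2] : cmod (rel1 q b n w z).1 <= m (jet1 q b n w z0) /\
    cmod (rel1 q b n w z).2 <= m (jet1 q b n w z0) by near: z; exact: Hw.
have [z1 z2] : cmod (rel2 q b n v w z).1 <= m (jet2 q b n v w z0) /\
    cmod (rel2 q b n v w z).2 <= m (jet2 q b n v w z0) by near: z; exact: Hvw.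
split=> // j.
  apply: (le_trans (log_jet1_step T far E1 (le_trans v1 Em) (le_trans v2 Em) j)).
  by rewrite ler_wpM2r ?invr_ge0 ?exprn_ge0 // le_max lexx.
apply: (le_trans (log_jet2_step T far E1 (le_trans v1 Em) (le_trans v2 Em)
   (le_trans w1 Em') (le_trans w2 Em') (le_trans z1 Em'') (le_trans z2 Em'') j)).
by rewrite ler_wpM2r ?invr_ge0 ?exprn_ge0 // le_max lexx orbT.
Unshelve. all: by end_near. Qed.

Definition dgreen v z : R := limn (fun k => dgreen_approx v k z).
Definition d2green v w z : R := limn (fun k => d2green_approx v w k z).

Lemma shifted_limit (u : nat -> R) n c :
  (forall j, `|u (n + j.+1)%N - u (n + j)%N| <= c / 2 ^+ j.+1) ->
  cvgn u /\ forall j, `|u (n + j)%N - limn u| <= c / 2 ^+ j.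
Proof.
move=> H; have [h1 h2] := @geometric_cvg _ (fun j => u (n + j)%N) c H.
have h3 := (cvg_shift u _ n).1 h1.
have E : limn u = limn (fun j => u (n + j)%N) by exact/cvg_lim.
by split; [apply/cvg_ex; eexists; exact: h3|move=> j; rewrite E].
Qed.

Lemma local_limits z0 v w : escaping z0 -> exists n c, \forall z \near z0,
  [/\ forall j, escaped (escape_radius A) (orb (n + j) z),
      forall j, `|dgreen_approx v (n + j) z - dgreen v z| <= c / 2 ^+ j,
      forall j, `|d2green_approx v w (n + j) z - d2green v w z| <= c / 2 ^+ j &
      dgreen_approx v k z @[k --> \oo] --> dgreen v z /\
      d2green_approx v w k z @[k --> \oo] --> d2green v w z].
Proof.
move=> /(local_jet_cvg v w)[n [c H]]; exists n, c; apply: filterS H => z [far h1 h2].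
have [c1 g1] := @shifted_limit (fun k => dgreen_approx v k z) _ _ h1.
have [c2 g2] := @shifted_limit (fun k => d2green_approx v w k z) _ _ h2.
by split=> // j; exact: (far_escaped T far).
Qed.

Lemma escaped_neq0 k z : escaped (escape_radius A) (orb k z) -> (orb k z).2 != 0.
Proof. by move=> ez; rewrite -cmod_gt0; have := le_trans (escape_radius_ge4 T) ez.2; lra. Qed.

Lemma green_is_derive z0 v : escaping z0 ->
  is_derive (0 : R) (1 : R) (line green v z0) (dgreen v z0).
Proof.
move=> /(local_limits v v)[n [c H]].
have [d d0 Hd] := near_line v H.
rewrite -[in dgreen v z0](addr0 z0) -(scale0r v).
apply: (@is_derive_limit _
  (fun j => line (fun z => (total_deg e (n + j))^-1 * ln (cmod (orb (n + j) z).2)) v z0)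
  (fun j t => dgreen_approx v (n + j) (z0 + (t%:C%C : C) *: v))
  (line green v z0) (fun t => dgreen v (z0 + (t%:C%C : C) *: v)) d c d0).
- move=> j t td; have [he _ _ _] := Hd t td.
  apply: is_derive_line_shift.
  have y0 := escaped_neq0 (he j).
  have h := @is_derive_ln_cmod _ _ (fun z => (orb (n + j) z).2) v _ _ y0
    (orb_is_derive q b (n + j) _ v).2.
  have := is_deriveM (is_derive_cst (total_deg e (n + j))^-1 (0 : R) (1 : R)) h.
  by move/is_derive_eq; apply; rewrite scaler0 addr0 /dgreen_approx [RHS]mulrC.
- by move=> j t td; have [_ hj _ _] := Hd t td; exact: hj.
- move=> t td; have [he _ _ _] := Hd t td.
  set z := z0 + _ in he *.
  have := (cvg_shift _ _ n).2 (@potential_cvg _ _ _ _ _ T z).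
  apply: cvg_trans; apply: near_eq_cvg; apply: nearW => j.
  by rewrite /line -/z /potential (escaped_height T (lexx _) (he j)) mulrC.
Qed.

Lemma dgreen_is_derive z0 v w : escaping z0 ->
  is_derive (0 : R) (1 : R) (line (dgreen v) w z0) (d2green v w z0).
Proof.
move=> /(local_limits v w)[n [c H]].
have [d d0 Hd] := near_line w H.
rewrite -[in d2green v w z0](addr0 z0) -(scale0r w).
apply: (@is_derive_limit _
  (fun j => line (fun z => (total_deg e (n + j))^-1 * complex.Re (log_jet1 (n + j) v z)) w z0)
  (fun j t => d2green_approx v w (n + j) (z0 + (t%:C%C : C) *: w))
  (line (dgreen v) w z0) (fun t => d2green v w (z0 + (t%:C%C : C) *: w)) d c d0).
- move=> j t td; have [he _ _ _] := Hd t td.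
  apply: is_derive_line_shift.
  have y0 := escaped_neq0 (he j).
  have h := @is_derive_Re _ _ (log_jet1 (n + j) v) w _ _ (log_jet1_is_derive v w y0).
  have := is_deriveM (is_derive_cst (total_deg e (n + j))^-1 (0 : R) (1 : R)) h.
  by move/is_derive_eq; apply; rewrite scaler0 addr0 /d2green_approx [RHS]mulrC.
- by move=> j t td; have [_ _ hj _] := Hd t td; exact: hj.
- move=> t td; have [_ _ _ [cv _]] := Hd t td.
  have := (cvg_shift _ _ n).2 cv.
  apply: cvg_trans; apply: near_eq_cvg; apply: nearW => j.
  by rewrite /line /dgreen_approx mulrC.
Qed.

Lemma rderive_green z v : escaping z -> rderive v green z = dgreen v z.
Proof.
by move=> ez; have H := green_is_derive v ez; rewrite /rderive derive1E derive_val.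
Qed.

Lemma near_rderive_green z v : escaping z ->
  \forall w \near z, rderive v green w = dgreen v w.
Proof.
move=> ez; have : \forall w \near z, escaping w by exact: escaping_open.
by apply: filterS => w; exact: rderive_green.
Qed.

Lemma rderive_green_is_derive z v w : escaping z ->
  is_derive (0 : R) (1 : R) (line (rderive v green) w z) (d2green v w z).
Proof.
move=> ez; apply: near_eq_is_derive (dgreen_is_derive v w ez).
have [d d0 Hd] := near_line w (near_rderive_green v ez).
apply/nbhs_ballP; exists d => // t; rewrite /ball /= sub0r normrN => td.
by rewrite /line Hd.
Qed.

Lemma rderive2_green z v w : escaping z ->
  rderive w (rderive v green) z = d2green v w z.
Proof.
move=> ez; have H := rderive_green_is_derive v w ez.
by rewrite /rderive derive1E derive_val.
Qed.

Lemma dgreen_continuous z v : escaping z -> {for z, continuous (dgreen v)}.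
Proof.
move=> /(local_limits v v)[n [c H]].
apply: (@dyadic_limit_continuous _ _ (fun j => dgreen_approx v (n + j)) _ _ c).
  move=> j; have [he _ _ _] := nbhs_singleton H.
  have lc := @log_jet1_continuous _ q b (n + j) v z (escaped_neq0 (he j)).
  have rc : complex.Re (log_jet1 (n + j) v x) @[x --> z] --> complex.Re (log_jet1 (n + j) v z).
    exact: cvg_comp lc (@Re_continuous R _).
  by apply: cvgM; [exact: rc|exact: cvg_cst].
by apply: filterS H => w [].
Qed.

Lemma d2green_continuous z v w : escaping z -> {for z, continuous (d2green v w)}.
Proof.
move=> /(local_limits v w)[n [c H]].
apply: (@dyadic_limit_continuous _ _ (fun j => d2green_approx v w (n + j)) _ _ c).
  move=> j; have [he _ _ _] := nbhs_singleton H.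
  have lc := @log_jet2_continuous _ q b (n + j) v w z (escaped_neq0 (he j)).
  have rc : complex.Re (log_jet2 (n + j) v w x) @[x --> z] -->
      complex.Re (log_jet2 (n + j) v w z).
    exact: cvg_comp lc (@Re_continuous R _).
  by apply: cvgM; [exact: rc|exact: cvg_cst].
by apply: filterS H => x [].
Qed.

Lemma continuous_near_eq (V : topologicalType) (f g : V -> R) (z : V) :
  (\forall w \near z, f w = g w) -> {for z, continuous f} -> {for z, continuous g}.
Proof.
move=> fg fc; rewrite /prop_for /continuous_at -(nbhs_singleton fg).
by apply: cvg_trans fc; apply: near_eq_cvg; apply: filterS fg => w ->.
Qed.

Lemma green_C2_on : continuous (green : C2 R -> R) -> C2_on escaping green.
Proof.
move=> gc; split=> [z _|v z ez|v w z ez]; first exact: gc.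
- split; first by have H := green_is_derive v ez; exact: ex_derive.
  apply: (@continuous_near_eq _ (dgreen v) (rderive v green) z _ (@dgreen_continuous z v ez)).
  by apply: filterS (near_rderive_green v ez) => w ->.
- split; first by have H := rderive_green_is_derive v w ez; exact: ex_derive.
  apply: (@continuous_near_eq _ (d2green v w) (rderive w (rderive v green)) z _
    (@d2green_continuous z v w ez)).
  have : \forall x \near z, escaping x by exact: escaping_open.
  by apply: filterS => x ex; rewrite rderive2_green.
Qed.

Lemma log_jet2_i k v z :
  log_jet2 k (('i%C : C) *: v) (('i%C : C) *: v) z = - log_jet2 k v v z.
Proof.
rewrite /log_jet2 jet2Z !jet1Z.
have ii : 'i%C * 'i%C = -1 :> C by rewrite -expr2 sqr_i.
set X := jet1 _ _ _ _ _; set Z := jet2 _ _ _ _ _ _; set y := (orb k z).2.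
change (('i%C * 'i%C) * Z.2 / y - ('i%C * X.2) * ('i%C * X.2) / y ^+ 2 =
  - (Z.2 / y - X.2 * X.2 / y ^+ 2) :> C).
by rewrite mulrACA ii; ring.
Qed.

(** The second jet is complex bilinear in its directions, and i^2 = -1. *)
Lemma d2green_i z v : escaping z ->
  d2green (('i%C : C) *: v) (('i%C : C) *: v) z = - d2green v v z.
Proof.
move=> ez; have [n [c H]] := local_limits v v ez.
have [_ _ _ [_ cv]] := nbhs_singleton H.
rewrite {1}/d2green; apply: cvg_lim => //.
have -> : (fun k => d2green_approx (('i%C : C) *: v) (('i%C : C) *: v) k z) =
    (fun k => - d2green_approx v v k z).
  apply/funext => k; rewrite /d2green_approx log_jet2_i -mulNr; congr (_ / _).
  by case: (log_jet2 _ _ _ _).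
exact: cvgN cv.
Qed.

End pluriharmonicity.

Section slices.
Context {R : realType}.
Local Notation C := (Cplx R).
Implicit Types (u : C2 R -> R) (Omega : set (C2 R)) (a b : C2 R).

Lemma line_slice u a b (v zeta : C) :
  line (fun zeta : C => u (a + zeta *: b)) v zeta = line u (v *: b) (a + zeta *: b).
Proof.
apply/funext => t; rewrite /line; congr u.
by rewrite scalerDl addrA scalerA.
Qed.

Lemma rderive_slice u a b (v : C) :
  rderive v (fun zeta : C => u (a + zeta *: b)) =
  fun zeta : C => rderive (v *: b) u (a + zeta *: b).
Proof. by apply/funext => zeta; rewrite /rderive line_slice. Qed.

Lemma slice_continuous u a b (zeta : C) :
  {for a + zeta *: b, continuous u} ->
  {for zeta, continuous (fun zeta : C => u (a + zeta *: b))}.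
Proof.
move=> uc; apply: (@cvg_comp _ _ _ (fun zeta : C => a + zeta *: b) u _ _ _ _ uc).
exact: line_continuous.
Qed.

Lemma C2_on_slice Omega u a b : C2_on Omega u ->
  C2_on [set zeta : C | Omega (a + zeta *: b)] (fun zeta : C => u (a + zeta *: b)).
Proof.
move=> [u0 u1 u2]; split=> [z Oz|v z Oz|v w z Oz].
- exact/slice_continuous/u0.
- rewrite /rderivable line_slice rderive_slice; have [h1 h2] := u1 (v *: b) _ Oz.
  by split; [exact: h1|exact: (slice_continuous h2)].
- rewrite /rderivable !rderive_slice line_slice; have [h1 h2] := u2 (v *: b) (w *: b) _ Oz.
  by split; [exact: h1|exact: (slice_continuous h2)].
Qed.

(** The Laplacian of a slice in the direction b is the sum of the second derivatives
along b and i b. *)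
Lemma pluriharmonic_of_C2 Omega u : open Omega -> C2_on Omega u ->
  (forall z b, Omega z -> rderive b (rderive b u) z +
     rderive (('i%C : C) *: b) (rderive (('i%C : C) *: b) u) z = 0) ->
  pluriharmonic_on Omega u.
Proof.
move=> Oo uC2 lap; split=> // a b; split.
- by apply: open_comp => // z _; exact: line_continuous.
- exact: C2_on_slice.
- move=> zeta Oz; rewrite /laplacian !rderive_slice scale1r.
  exact: lap.
Qed.

End slices.

Lemma green_pluriharmonic {R : realType} (A : R) (q : nat -> {poly Cplx R})
    (b : nat -> Cplx R) (e : nat -> nat) : tame A q b e ->
  continuous (green q b e : C2 R -> R) ->
  pluriharmonic_on (escaping A q b) (green q b e).
Proof.
move=> T gc; apply: pluriharmonic_of_C2.
- exact: escaping_open T.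
- exact: green_C2_on.
- by move=> z v ez; rewrite !(rderive2_green T) // (d2green_i T) // subrr.
Qed.

(** * Bounds on coefficients *)

Section tame_from_coefficients.
Context {R : realType}.
Local Notation C := (Cplx R).
Implicit Types (p : {poly C}) (y : C) (N B : R).

Lemma horner_bound p n B N y : (size p <= n.+1)%N -> (forall i, cmod p`_i <= B) ->
  1 <= N -> cmod y <= N -> cmod p.[y] <= n.+1%:R * B * N ^+ n.
Proof.
move=> sp pB N1 yN; rewrite (horner_coef_wide _ sp).
apply: (le_trans (cmod_sum _ _ _)).
apply: (@le_trans _ _ (\sum_(i < n.+1) B * N ^+ n)); last first.
  by rewrite sumr_const card_ord -mulrA (mulr_natl _ n.+1).
apply: ler_sum => i _; rewrite cmodM cmodX; apply: ler_pM; rewrite ?exprn_ge0 ?cmod_ge0 //.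
apply: (@le_trans _ _ (N ^+ i)).
  by rewrite lerXn2r // ?nnegrE ?cmod_ge0 //; lra.
by rewrite ler_weXn2l // -ltnS ltn_ord.
Qed.

Lemma pow_lip n N y y' : 1 <= N -> cmod y <= N -> cmod y' <= N ->
  cmod (y ^+ n.+1 - y' ^+ n.+1) <= n.+1%:R * N ^+ n * cmod (y - y').
Proof.
move=> N1 yN y'N; rewrite subrXX cmodM mulrC ler_wpM2r ?cmod_ge0 //.
apply: (le_trans (cmod_sum _ _ _)).
apply: (@le_trans _ _ (\sum_(i < n.+1) N ^+ n)); last first.
  by rewrite sumr_const card_ord (mulr_natl _ n.+1).
apply: ler_sum => i _; rewrite cmodM !cmodX.
have iN : (i <= n)%N by rewrite -ltnS ltn_ord.
rewrite -[in leRHS](subnK iN) exprD /=.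
by apply: ler_pM; rewrite ?exprn_ge0 ?cmod_ge0 // lerXn2r // nnegrE ?cmod_ge0 //; lra.
Qed.

Lemma horner_lip p n B N y y' : (size p <= n.+2)%N -> (forall i, cmod p`_i <= B) ->
  1 <= N -> cmod y <= N -> cmod y' <= N ->
  cmod (p.[y] - p.[y']) <= n.+2%:R * (B * n.+1%:R) * N ^+ n * cmod (y - y').
Proof.
move=> sp pB N1 yN y'N; rewrite !(horner_coef_wide _ sp) -sumrB.
have B0 : 0 <= B by exact: le_trans (cmod_ge0 _) (pB 0%N).
apply: (le_trans (cmod_sum _ _ _)).
apply: (@le_trans _ _ (\sum_(i < n.+2) (B * n.+1%:R) * N ^+ n * cmod (y - y'))); last first.
  by rewrite sumr_const card_ord -!mulrA (mulr_natl _ n.+2).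
apply: ler_sum => -[[|i] ilt] _ /=.
  rewrite !expr0 subrr cmod0 !mulr_ge0 ?cmod_ge0 // exprn_ge0 //; lra.
rewrite -mulrBr cmodM -!mulrA; apply: ler_pM; rewrite ?cmod_ge0 //.
apply: (le_trans (pow_lip i N1 yN y'N)); rewrite mulrA.
apply: ler_wpM2r; first exact: cmod_ge0.
apply: ler_pM => //; first by rewrite exprn_ge0 //; lra.
  by rewrite ler_nat -ltnS.
by rewrite ler_weXn2l // -ltnS.
Qed.

(** One factor A0 pays for dividing by the leading coefficient; the cube comes from the
number of coefficients and from differentiating twice. *)
Lemma tame_of_bounds (A0 : R) (D : nat) (q : nat -> {poly C}) (b : nat -> C)
    (e : nat -> nat) : 1 <= A0 -> (forall k, ((e k).+2 <= D)%N) ->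
  (forall k, cmod (b k) <= A0) -> (forall k, size (q k) = (e k).+3) ->
  (forall k i, cmod (q k)`_i <= A0) ->
  (forall k, 1 <= A0 * cmod (lead_coef (q k))) ->
  tame (A0 ^+ 2 * D.+1%:R ^+ 3) q b e.
Proof.
move=> A1 eD bA sq qA lA; set A := _ * _.
have D1 : 1 <= D.+1%:R :> R by rewrite ler1n.
set d1 : R := D.+1%:R in A D1 *.
have AA : A0 <= A0 ^+ 2 by rewrite ler_eXnr.
have d1d2 : d1 <= d1 ^+ 2 by rewrite ler_eXnr.
have d1d3 : d1 <= d1 ^+ 3 by rewrite ler_eXnr.
have d2d3 : d1 ^+ 2 <= d1 ^+ 3 by rewrite ler_weXn2l.
have A0' : 0 <= A0 ^+ 2 by rewrite sqr_ge0.
have bnd (x c : R) : 0 <= x -> 0 <= c -> x <= A0 ^+ 2 -> c <= d1 ^+ 3 -> x * c <= A.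
  by move=> *; apply: ler_pM.
have d10 : 0 <= d1 by lra.
have nD n : (n <= D.+1)%N -> n%:R <= d1 by rewrite ler_nat.
have eD1 k : ((e k).+2 <= D.+1)%N by apply: leq_trans (eD k) _.
have eD2 k : ((e k).+3 <= D.+1)%N by rewrite ltnS.
have eD3 k : ((e k).+1 <= D.+1)%N by apply: leq_trans (eD1 k).
have A00 : 0 <= A0 by lra.
have lead k : lead_coef (q k) = (q k)`_(e k).+2 by rewrite lead_coefE sq.
have big k i : ((e k).+2 < i)%N -> (q k)`_i = 0.
  by move=> h; apply: nth_default; rewrite sq.
(* The shape of the bounds below: at most D + 1 summands, coefficients at most
   A0 (D + 1)^2. *)
have use n (B : R) (X : R) : (n <= D.+1)%N -> 0 <= B -> B <= A0 * d1 ^+ 2 -> 0 <= X ->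
    n%:R * B * X <= A * X.
  move=> nDn B0 BB X0; apply: ler_wpM2r => //.
  apply: (@le_trans _ _ (d1 * (A0 * d1 ^+ 2))).
    by apply: ler_pM => //; exact: nD.
  have -> : d1 * (A0 * d1 ^+ 2) = A0 * d1 ^+ 3 by ring.
  by rewrite ler_wpM2r // exprn_ge0.
have pow0 (N : R) n : 1 <= N -> 0 <= N ^+ n by move=> *; rewrite exprn_ge0 //; lra.
have A0d : A0 <= A0 * d1 ^+ 2 by rewrite ler_peMr // exprn_ege1.
have A0d' : A0 * d1 <= A0 * d1 ^+ 2 by rewrite ler_wpM2l.
split.
- by rewrite mulr_ege1 // exprn_ege1.
- move=> k; apply: (le_trans (nD _ (eD1 k))).
  by rewrite -[d1]mul1r; apply: ler_pM => //; rewrite exprn_ege1.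
- move=> k; apply: (le_trans (bA k)).
  by rewrite -[A0]mulr1; apply: bnd; rewrite ?mulr1 // exprn_ege1.
- move=> k N y N1 yN.
  apply: (le_trans (horner_bound (n := (e k).+2) (B := A0) _ (qA k) N1 yN)).
    by rewrite sq.
  by apply: use => //; exact: pow0.
- move=> k y y1; set t := cmod y in y1 *.
  pose p := q k - lead_coef (q k) *: 'X^((e k).+2).
  have ps : (size p <= (e k).+2)%N.
    apply/leq_sizeP => i; rewrite leq_eqVlt => /orP[/eqP <-|h].
      by rewrite coefB coefZ coefXn eqxx mulr1 lead subrr.
    by rewrite coefB coefZ coefXn gtn_eqF // mulr0 subr0 big.
  have pA i : cmod p`_i <= A0.
    rewrite coefB coefZ coefXn; case: eqVneq => [->|_]; last by rewrite mulr0 subr0.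
    by rewrite mulr1 lead subrr cmod0.
  have hp := horner_bound ps pA y1 (lexx t).
  have qE : lead_coef (q k) * y ^+ (e k).+2 = (q k).[y] - p.[y].
    by rewrite /p hornerD hornerN hornerZ hornerXn opprB addrCA subrr addr0.
  have h1 : cmod (lead_coef (q k)) * t ^+ (e k).+2 <= cmod (q k).[y] + cmod p.[y].
    by rewrite /t -cmodX -cmodM qE cmodB.
  have X0 := pow0 t (e k).+2 y1; have X1 := pow0 t (e k).+1 y1.
  have h2 : t ^+ (e k).+2 <= A0 * (cmod (q k).[y] + cmod p.[y]).
    apply: le_trans (ler_wpM2l A00 h1); rewrite mulrA ler_peMl //.
  apply: (le_trans h2).
  have h3 : (e k).+2%:R * A0 * t ^+ (e k).+1 <= (A0 * d1 ^+ 3) * t ^+ (e k).+1.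
    apply: ler_wpM2r => //; rewrite mulrC; apply: ler_wpM2l => //.
    exact: le_trans (nD _ (eD1 k)) _.
  have h4 : A0 * cmod (q k).[y] <= A * cmod (q k).[y].
    apply: ler_wpM2r; first exact: cmod_ge0.
    by rewrite -[A0]mulr1; apply: bnd; rewrite ?mulr1 // exprn_ege1.
  have h5 : A0 * cmod p.[y] <= A * t ^+ (e k).+1.
    have -> : A * t ^+ (e k).+1 = A0 * ((A0 * d1 ^+ 3) * t ^+ (e k).+1) by rewrite /A; ring.
    by apply: ler_wpM2l => //; exact: le_trans hp h3.
  by rewrite !mulrDr; exact: lerD.
- move=> k N y y' N1 yN y'N.
  apply: (le_trans (horner_lip (n := (e k).+1) (B := A0) _ (qA k) N1 yN y'N)).
    by rewrite sq.
  apply: ler_wpM2r; first exact: cmod_ge0.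
  apply: use; rewrite ?mulr_ge0 //; last exact: pow0.
  by apply: le_trans A0d'; rewrite ler_wpM2l // nD.
- move=> k N y N1 yN.
  pose p := 'X * (q k)^`() - (e k).+2%:R *: q k.
  have pE i : p`_i = (q k)`_i * i%:R - (e k).+2%:R * (q k)`_i.
    rewrite coefB coefXM coefZ; congr (_ - _); case: i => [|i] /=; first by rewrite mulr0.
    by rewrite coef_deriv [RHS]mulr_natr.
  have -> : y * (q k)^`().[y] - (e k).+2%:R * (q k).[y] = p.[y].
    by rewrite /p hornerD hornerN hornerZ hornerM hornerX.
  apply: (le_trans (horner_bound (n := (e k).+1) (B := A0 * d1) _ _ N1 yN)).
  + apply/leq_sizeP => i; rewrite pE leq_eqVlt => /orP[/eqP <-|h].
      by rewrite mulrC subrr.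
    by rewrite big // mul0r mulr0 subrr.
  + move=> i; rewrite pE.
    case: (leqP i (e k).+2) => h; last by rewrite big // mul0r mulr0 subrr cmod0 mulr_ge0.
    rewrite mulrC -mulrBl cmodM mulrC; apply: ler_pM; rewrite ?cmod_ge0 //.
    rewrite cmodC -natrB // cmod_nat; apply: nD.
    by apply: leq_trans (eD1 k); exact: leq_subr.
  + by apply: use; rewrite ?mulr_ge0 //; exact: pow0.
- move=> k N y N1 yN.
  pose c : nat := ((e k).+2 * (e k).+1)%N.
  pose p := 'X^2 * (q k)^`()^`() - c%:R *: q k.
  have pE i : p`_i = (q k)`_i * (i * i.-1)%:R - c%:R * (q k)`_i.
    rewrite coefB coefXnM coefZ; congr (_ - _); case: i => [|[|i]] /=; rewrite ?mulr0 //.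
    by rewrite !coef_deriv subn2 /= natrM -(mulr_natr _ i.+2) -(mulr_natr _ i.+1); ring.
  have -> : y ^+ 2 * (q k)^`()^`().[y] - c%:R * (q k).[y] = p.[y].
    by rewrite /p hornerD hornerN hornerZ hornerM hornerXn.
  apply: (le_trans (horner_bound (n := (e k).+1) (B := A0 * d1 ^+ 2) _ _ N1 yN)).
  + apply/leq_sizeP => i; rewrite pE leq_eqVlt => /orP[/eqP <-|h].
      by rewrite mulrC subrr.
    by rewrite big // mul0r mulr0 subrr.
  + move=> i; rewrite pE.
    case: (leqP i (e k).+2) => h; last first.
      by rewrite big // mul0r mulr0 subrr cmod0 mulr_ge0 ?exprn_ge0.
    rewrite mulrC -mulrBl cmodM mulrC; apply: ler_pM; rewrite ?cmod_ge0 //.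
    have ic : (i * i.-1 <= c)%N by rewrite /c leq_mul // -ltnS; case: i h.
    rewrite cmodC -natrB // cmod_nat; apply: (@le_trans _ _ c%:R).
      by rewrite ler_nat leq_subr.
    by rewrite /c natrM expr2; apply: ler_pM => //; exact: nD.
  + by apply: use => //; [rewrite mulr_ge0 ?exprn_ge0|exact: pow0].
Qed.

End tame_from_coefficients.

(** * Continuity, exchange of coordinates, norms *)

Section topology.
Context {R : realType}.
Local Notation C := (Cplx R).

Lemma compact_upper_bound (T : topologicalType) (f : T -> R) (K : set T) :
  continuous f -> compact K -> exists2 B : R, 0 <= B & forall x, K x -> f x <= B.
Proof.
move=> fc Kc.
have fK : compact (f @` K) by apply: continuous_compact Kc; exact: continuous_subspaceT.
have [B [_ HB]] := compact_bounded fK.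
exists (Num.max 0 (B + 1)); first by rewrite le_max lexx.
move=> x Kx; apply: (le_trans (ler_norm _)).
rewrite le_max; apply/orP; right; apply: HB; first by rewrite ltrDl.
by exists x.
Qed.

Lemma cvg_height {X : Type} (F : set_system X) {FF : Filter F} (f g : X -> C) (l m : C) :
  f x @[x --> F] --> l -> g x @[x --> F] --> m ->
  height ((f x, g x) : C2 R) @[x --> F] --> height ((l, m) : C2 R).
Proof.
move=> /cvg_cmodP fl /cvg_cmodP gm; apply/cvgrPdist_lt => eps e0.
apply: filterS2 (fl _ e0) (gm _ e0) => x h1 h2.
by apply: (le_lt_trans (height_dist _ _)); rewrite gt_max h1 h2.
Qed.

Lemma cvg_horner_coef {X : Type} (F : set_system X) {FF : Filter F} N
    (p : X -> {poly C}) (p0 : {poly C}) (f : X -> C) (l : C) :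
  (forall x, (size (p x) <= N)%N) -> (size p0 <= N)%N ->
  (forall i, (p x)`_i @[x --> F] --> p0`_i) -> f x @[x --> F] --> l ->
  (p x).[f x] @[x --> F] --> p0.[l].
Proof.
move=> ps p0s pc fl; rewrite (horner_coef_wide _ p0s).
have -> : (fun x => (p x).[f x]) = (fun x => \sum_(i < N) (p x)`_i * f x ^+ i).
  by apply/funext => x; rewrite (horner_coef_wide _ (ps x)).
apply: (@cvg_sum C C) => i; apply: cvg_cplxM; first exact: pc.
elim: (nat_of_ord i) => [|n IH]; first exact: cvg_cst.
rewrite exprS; under eq_fun do rewrite exprS.
exact: cvg_cplxM.
Qed.

End topology.

Section sign_orientation.
Context {R : realType}.
Local Notation C := (Cplx R).

(** For the lower sign, the exchange of coordinates that makes the inverse of a factor an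
elementary map. *)
Definition orient (s : sign) (z : C2 R) : C2 R := if s is Plus then z else (z.2, z.1).

Lemma orientK s : involutive (orient s).
Proof. by case: s => [] [x y]. Qed.

Lemma height_orient s z : height (orient s z) = height z.
Proof. by case: s; rewrite // /height /= [Num.max (cmod z.2) _]maxC. Qed.

Lemma norm2_orient s z : norm2 (orient s z) = norm2 z.
Proof. by case: s; rewrite // /norm2 /= addrC. Qed.

Lemma orient_line s (a b : C2 R) (c : C) :
  orient s (a + c *: b) = orient s a + c *: orient s b.
Proof. by case: s; case: a b => [a1 a2] [b1 b2]. Qed.

Lemma cvg_pairC {X : Type} (F : set_system X) {FF : Filter F} (f g : X -> C) (z : C2 R) :
  f x @[x --> F] --> z.1 -> g x @[x --> F] --> z.2 ->
  ((f x, g x) : C2 R) @[x --> F] --> z.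
Proof.
case: z => a b fl gm.
exact: (@cvg_pair _ C C F (nbhs (a : C)) (nbhs (b : C)) FF
  (nbhs_filter _) (nbhs_filter _) f g fl gm).
Qed.

Lemma orient_continuous s : continuous (orient s : C2 R -> C2 R).
Proof.
case: s => z; first exact: cvg_id.
by apply: cvg_pairC; [exact: cvg_snd|exact: cvg_fst].
Qed.

Lemma plurisubharmonic_orient s (u : C2 R -> \bar R) :
  plurisubharmonic u -> plurisubharmonic (u \o orient s).
Proof.
move=> [u1 u2 u3]; split=> [z||a b]; first exact: u1.
- move=> x a /= ax; have [V Vx HV] := u2 (orient s x) a ax.
  exists (orient s @^-1` V); first exact: orient_continuous.
  by move=> y; exact: HV.
- have -> : (fun zeta : C => (u \o orient s) (a + zeta *: b)) =
      (fun zeta : C => u (orient s a + zeta *: orient s b)).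
    by apply/funext => zeta /=; rewrite orient_line.
  exact: u3.
Qed.

Lemma line_orient s (u : C2 R -> R) (v z : C2 R) :
  line (u \o orient s) v z = line u (orient s v) (orient s z).
Proof. by apply/funext => t; rewrite /line /= orient_line. Qed.

Lemma rderive_orient s (u : C2 R -> R) (v : C2 R) :
  rderive v (u \o orient s) = rderive (orient s v) u \o orient s.
Proof. by apply/funext => z; rewrite /rderive line_orient. Qed.

Lemma comp_orient_continuous s (u : C2 R -> R) z :
  {for orient s z, continuous u} -> {for z, continuous (u \o orient s)}.
Proof.
by move=> uc; apply: (@continuous_comp _ _ _ (orient s) u); [exact: orient_continuous|].
Qed.

Lemma C2_on_orient s (Omega : set (C2 R)) (u : C2 R -> R) :
  C2_on Omega u -> C2_on (orient s @^-1` Omega) (u \o orient s).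
Proof.
move=> [u0 u1 u2]; split=> [z Oz|v z Oz|v w z Oz].
- exact/comp_orient_continuous/u0.
- rewrite /rderivable line_orient rderive_orient; have [h1 h2] := u1 (orient s v) _ Oz.
  by split; [exact: h1|exact: comp_orient_continuous h2].
- rewrite /rderivable !rderive_orient line_orient.
  have [h1 h2] := u2 (orient s v) (orient s w) _ Oz.
  by split; [exact: h1|exact: comp_orient_continuous h2].
Qed.

Lemma pluriharmonic_orient s (Omega : set (C2 R)) (u : C2 R -> R) :
  pluriharmonic_on Omega u -> pluriharmonic_on (orient s @^-1` Omega) (u \o orient s).
Proof.
move=> [Oo uC2 uh]; split.
- by apply: open_comp => // z _; exact: orient_continuous.
- exact: C2_on_orient.
- move=> a b; have := uh (orient s a) (orient s b).
  have -> : (fun zeta : C => (u \o orient s) (a + zeta *: b)) =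
      (fun zeta : C => u (orient s a + zeta *: orient s b)).
    by apply/funext => zeta /=; rewrite orient_line.
  rewrite (_ : [set zeta : C | Omega (orient s a + zeta *: orient s b)] =
     [set zeta : C | (orient s @^-1` Omega) (a + zeta *: b)]) //.
  by apply/seteqP; split=> zeta /=; rewrite orient_line.
Qed.

Lemma norm2_ge (z : C2 R) : Num.max (cmod z.1) (cmod z.2) <= norm2 z.
Proof. by have := dist2_le_norm2 z 0; rewrite /dist2 !subr0. Qed.

Lemma norm2_le (z : C2 R) : norm2 z <= cmod z.1 + cmod z.2.
Proof.
have [x0 y0] := conj (cmod_ge0 z.1) (cmod_ge0 z.2).
rewrite -(ler_pXn2r (n := 2)) ?nnegrE ?addr_ge0 ?sqrtr_ge0 //.
rewrite /norm2 -!/(cmod _) sqr_sqrtr ?addr_ge0 ?sqr_ge0 // sqrrD.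
by rewrite lerD2r lerDl mulrn_wge0 // mulr_ge0.
Qed.

Lemma norm2_ge0 (z : C2 R) : 0 <= norm2 z.
Proof. exact: sqrtr_ge0. Qed.

(** The Euclidean norm lies between the maximum norm and twice the maximum norm. *)
Lemma log_plus_height (z : C2 R) :
  ln (height z) <= log_plus (norm2 z) <= ln (height z) + ln 2.
Proof.
have n0 := norm2_ge0 z; have h1 := norm2_ge z; have h2 := norm2_le z.
have m1 := height_ge_fst z; have m2 := height_ge_snd z.
have g1 := height_ge1 z; have g0 := height_gt0 z.
have l2 : 0 <= ln 2 :> R by rewrite ln_ge0 // ler1n.
rewrite /log_plus; apply/andP; split.
  rewrite /height; case: (lerP (Num.max (cmod z.1) (cmod z.2)) 1) => h.
    by rewrite ln1 le_max lexx orbT.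
  by rewrite le_max ler_ln ?posrE ?h1 //; lra.
rewrite ge_max; apply/andP; split; last first.
  by rewrite addr_ge0 // ln_ge0.
rewrite -lnM ?posrE //; have [n1|n1] := lerP (norm2 z) 0.
  by rewrite ln0 // ln_ge0 //; lra.
by rewrite ler_ln ?posrE ?mulr_gt0 //; lra.
Qed.

End sign_orientation.

(** * Henon families as sequences of elementary maps *)

Section family.
Context {R : realType} {M : topologicalType} (F : henonFamily R M).
Variable sigma : M -> M.
Local Notation C := (Cplx R).
Local Notation m := (hlen F).
Implicit Types (s : sign) (lam : M) (z : C2 R).

(** The inverse applies the factors backwards. *)
Definition factor_order s : seq 'I_m := if s is Plus then enum 'I_m else rev (enum 'I_m).

Definition factor_poly s lam (j : 'I_m) : {poly C} :=
  if s is Plus then hpoly j lam else (hcoef j lam)^-1 *: hpoly j lam.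

Definition factor_coef s lam (j : 'I_m) : C :=
  if s is Plus then hcoef j lam else (hcoef j lam)^-1.

Definition factor_step s lam z j := step (factor_poly s lam j) (factor_coef s lam j) z.

Lemma size_factor_order s : size (factor_order s) = m.
Proof. by case: s; rewrite /= ?size_rev size_enum_ord. Qed.

Lemma orient_henon_pm s lam z :
  orient s (henon_pm F s lam z) =
  foldl (factor_step s lam) (orient s z) (factor_order s).
Proof.
case: s => //=; rewrite /henon_inv foldl_rev.
elim: (enum _) => //= j r <-.
rewrite /factor_step /factor_inv /step /=; congr pair => /=.
by rewrite hornerZ -mulrBr mulrC.
Qed.

Definition factor_index s k : 'I_m :=
  nth (Ordinal (hlen_gt0 F)) (factor_order s) (k %% m).

(** The k-th elementary map belongs to the block of number k %/ m, over the
corresponding iterate of sigma. *)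
Definition fiber lam k : M := iter (k %/ m) sigma lam.

Definition sys_poly s lam k := factor_poly s (fiber lam k) (factor_index s k).
Definition sys_coef s lam k := factor_coef s (fiber lam k) (factor_index s k).
(** Two less than the degree, as in [tame]. *)
Definition sys_deg s k := (hdeg (factor_index s k)).-2.

Local Notation orbit s lam := (orb (sys_poly s lam) (sys_coef s lam)).

Lemma sys_degE s k : (sys_deg s k).+2 = hdeg (factor_index s k).
Proof. by rewrite /sys_deg; case: (hdeg _) (hdeg_ge2 (factor_index s k)) => [|[|d]]. Qed.

Lemma block_index n i : (i < m)%N -> ((n * m + i) %/ m = n)%N /\ ((n * m + i) %% m = i)%N.
Proof.
move=> im; have m0 := hlen_gt0 F.
by rewrite divnMDl // divn_small // addn0 modnMDl modn_small.
Qed.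

Lemma orb_block s lam z n i : (i <= m)%N ->
  orbit s lam (n * m + i) z =
  foldl (factor_step s (iter n sigma lam)) (orbit s lam (n * m) z)
    (take i (factor_order s)).
Proof.
elim: i => [|i IH] im; first by rewrite addn0 take0.
have [h1 h2] := block_index n im.
rewrite addnS (take_nth (Ordinal (hlen_gt0 F))) ?size_factor_order // foldl_rcons.
rewrite -IH; last exact: ltnW.
by rewrite /= /sys_poly /sys_coef /fiber /factor_index h1 h2.
Qed.

Lemma orb_henon_iter s lam z n :
  orbit s lam (n * m) (orient s z) = orient s (henon_iter F sigma s n lam z).
Proof.
elim: n => [|n IH] //=; rewrite orient_henon_pm -IH mulSn addnC orb_block //.
by rewrite take_oversize // size_factor_order.
Qed.

Lemma total_deg_block s n i : (i <= m)%N ->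
  total_deg (sys_deg s) (n * m + i) =
  total_deg (sys_deg s) (n * m) * \prod_(j <- take i (factor_order s)) (hdeg j)%:R :> R.
Proof.
elim: i => [|i IH] im; first by rewrite addn0 take0 big_nil mulr1.
have [_ h2] := block_index n im.
rewrite addnS total_degS (take_nth (Ordinal (hlen_gt0 F))) ?size_factor_order //.
rewrite -cats1 big_cat big_seq1 mulrA -IH; last exact: ltnW.
by rewrite sys_degE /factor_index h2.
Qed.

Lemma total_deg_henon s n : total_deg (sys_deg s) (n * m) = (degree F)%:R ^+ n :> R.
Proof.
elim: n => [|n IH]; first by rewrite /total_deg big_ord0.
rewrite mulSn addnC total_deg_block // take_oversize ?size_factor_order // IH exprSr.
congr (_ * _); rewrite /degree natr_prod.
have P (t : sign) : perm_eq (factor_order t) (enum 'I_m).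
  by case: t; rewrite //= perm_rev.
by rewrite (perm_big _ (P s)) /= big_enum.
Qed.

Lemma degree_ge2 : 2 <= (degree F)%:R :> R.
Proof.
have := total_deg_henon Plus 1; rewrite mul1n expr1 => <-.
apply: le_trans (total_deg_ge _ _); rewrite -[leLHS]expr1 ler_weXn2l ?ler1n //.
exact: hlen_gt0.
Qed.

Lemma henon_iterSr s n lam z :
  henon_iter F sigma s n.+1 lam z =
  henon_iter F sigma s n (sigma lam) (henon_pm F s lam z).
Proof. by elim: n => //= n ->; rewrite -iterSr. Qed.

Lemma coef_bound (f : M -> C) : compact [set: M] -> continuous f ->
  exists2 B : R, 0 <= B & forall lam, cmod (f lam) <= B.
Proof.
move=> Mc fc.
have gc : continuous (cmod \o f).
  by move=> x; apply: continuous_comp; [exact: fc|exact: cmod_continuous].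
by have [B B0 HB] := compact_upper_bound gc Mc; exists B => // lam; exact: HB.
Qed.

Lemma finite_bound (I : finType) (g : I -> M -> R) :
  (forall i, exists2 B : R, 0 <= B & forall lam, g i lam <= B) ->
  exists2 B : R, 0 <= B & forall i lam, g i lam <= B.
Proof.
move=> H; have [Bf B0 HB] := fin_all_exists2 H.
exists (\sum_i Bf i); first by apply: sumr_ge0.
move=> i lam; apply: (le_trans (HB i lam)).
by rewrite (bigD1 i) //= lerDl sumr_ge0.
Qed.

Hypothesis M_compact : compact [set: M].

Lemma data_bound : exists2 B : R, 1 <= B & forall j lam,
  [/\ cmod (hcoef (h:=F) j lam) <= B, (cmod (hcoef (h:=F) j lam))^-1 <= B &
      forall i, cmod (hpoly (h:=F) j lam)`_i <= B].
Proof.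
pose D := \max_(j < m) hdeg j.
have [B1 B10 H1] := @finite_bound 'I_m (fun j lam => cmod (hcoef j lam))
  (fun j => coef_bound M_compact (hcoef_cont (h:=F) (j:=j))).
have ic j : continuous (fun lam => (hcoef (h:=F) j lam)^-1).
  by move=> lam; apply: cvg_cplxV; [exact: hcoef_neq0|exact: hcoef_cont].
have [B2 B20 H2] := @finite_bound 'I_m (fun j lam => cmod (hcoef j lam)^-1)
  (fun j => coef_bound M_compact (ic j)).
have [B3 B30 H3] := @finite_bound ('I_m * 'I_D.+1)%type
  (fun ji lam => cmod (hpoly ji.1 lam)`_(ji.2))
  (fun ji => coef_bound M_compact (hpoly_cont (h:=F) (j:=ji.1) (k:=ji.2))).
exists (1 + B1 + B2 + B3) => [|j lam]; first lra.
split.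
- by have := H1 j lam; lra.
- by have := H2 j lam; rewrite cmodV; lra.
- move=> i; case: (ltnP i D.+1) => iD.
    by have := H3 (j, Ordinal iD) lam => /=; lra.
  rewrite nth_default ?cmod0; first lra.
  rewrite hpoly_size; apply: leq_trans iD; rewrite ltnS.
  exact: (leq_bigmax j).
Qed.

Lemma system_tame : exists A : R, forall s lam,
  tame A (sys_poly s lam) (sys_coef s lam) (sys_deg s).
Proof.
have [B B1 HB] := data_bound; pose D := \max_(j < m) hdeg j.
have BB : B <= B ^+ 2 by rewrite ler_eXnr.
have B2 : 1 <= B ^+ 2 by lra.
exists ((B ^+ 2) ^+ 2 * D.+1%:R ^+ 3) => s lam; apply: tame_of_bounds => //.
- by move=> k; rewrite sys_degE; exact: (leq_bigmax (factor_index s k)).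
- move=> k; rewrite /sys_coef; have [h1 h2 _] := HB (factor_index s k) (fiber lam k).
  by rewrite /factor_coef; case: (s) h1 h2 => h1 h2; rewrite ?cmodV; lra.
- move=> k; rewrite sys_degE /sys_poly /factor_poly; case: (s); first exact: hpoly_size.
  by rewrite size_scale ?invr_eq0 ?hcoef_neq0 // hpoly_size.
- move=> k i; rewrite /sys_poly /factor_poly.
  have [h1 h2 h3] := HB (factor_index s k) (fiber lam k).
  case: (s) h1 h2 h3 => h1 h2 h3; first by have := h3 i; lra.
  rewrite coefZ cmodM cmodV expr2; apply: ler_pM; rewrite ?cmod_ge0 ?invr_ge0 ?cmod_ge0 //.
- move=> k; rewrite /sys_poly /factor_poly.
  have [h1 h2 h3] := HB (factor_index s k) (fiber lam k).
  have a0 : 0 < cmod (hcoef (factor_index s k) (fiber lam k)).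
    by rewrite cmod_gt0 hcoef_neq0.
  case: (s) h1 h2 h3 a0 => h1 h2 h3 a0.
    by rewrite (monicP (hpoly_monic _ _)) cmod1 mulr1.
  rewrite lead_coefZ (monicP (hpoly_monic _ _)) mulr1 cmodV.
  by rewrite ler_pdivlMr // mul1r; lra.
Qed.

Hypothesis sigma_cont : continuous sigma.

Lemma fiber_continuous k : continuous (fiber ^~ k).
Proof.
rewrite /fiber; elim: (k %/ m)%N => [|n IH] lam /=; first exact: cvg_id.
by apply: (@continuous_comp _ _ _ (iter n sigma) sigma); [exact: IH|exact: sigma_cont].
Qed.

Lemma sys_coef_continuous s k : continuous (fun lam => sys_coef s lam k : C).
Proof.
move=> lam; rewrite /sys_coef /factor_coef; have fc := @fiber_continuous k.
case: s.
  apply: (@continuous_comp _ _ _ (fiber ^~ k) (hcoef (factor_index Plus k))); first exact: fc.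
  exact: hcoef_cont.
apply: cvg_cplxV; first exact: hcoef_neq0.
apply: (@continuous_comp _ _ _ (fiber ^~ k) (hcoef (factor_index Minus k))); first exact: fc.
exact: hcoef_cont.
Qed.

Lemma sys_poly_continuous s k i : continuous (fun lam => (sys_poly s lam k)`_i : C).
Proof.
move=> lam; rewrite /sys_poly /factor_poly; have fc := @fiber_continuous k.
have pc j : {for lam, continuous (fun lam => (hpoly (h:=F) j (fiber lam k))`_i : C)}.
  apply: (@continuous_comp _ _ _ (fiber ^~ k) (fun lam => (hpoly j lam)`_i)); first exact: fc.
  exact: hpoly_cont.
case: s; first exact: pc.
have ac := @sys_coef_continuous Minus k lam; rewrite /sys_coef /factor_coef in ac.
have -> : (fun lam => ((hcoef (factor_index Minus k) (fiber lam k))^-1 *: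
     hpoly (factor_index Minus k) (fiber lam k))`_i) =
   (fun lam => (hcoef (factor_index Minus k) (fiber lam k))^-1 *
     (hpoly (factor_index Minus k) (fiber lam k))`_i).
  by apply/funext => l; rewrite coefZ.
rewrite /continuous_at; exact: cvg_cplxM ac (pc _).
Qed.

Lemma size_sys_poly s lam k : size (sys_poly s lam k) = (sys_deg s k).+3.
Proof.
rewrite sys_degE /sys_poly /factor_poly; case: s; first exact: hpoly_size.
by rewrite size_scale ?invr_eq0 ?hcoef_neq0 // hpoly_size.
Qed.

Lemma orbit_joint_continuous s k :
  continuous (fun p : M * C2 R => (orbit s p.1 k (orient s p.2)).1 : C) /\
  continuous (fun p : M * C2 R => (orbit s p.1 k (orient s p.2)).2 : C).
Proof.
have oc : continuous (fun p : M * C2 R => orient s p.2).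
  move=> p; apply: (@continuous_comp _ _ _ snd (orient s)); first exact: cvg_snd.
  exact: orient_continuous.
elim: k => [|k [IH1 IH2]] /=.
  split=> p.
    apply: (@continuous_comp _ _ _ (fun p : M * C2 R => orient s p.2) fst); first exact: oc.
    exact: cvg_fst.
  apply: (@continuous_comp _ _ _ (fun p : M * C2 R => orient s p.2) snd); first exact: oc.
  exact: cvg_snd.
suff H (p : (M * C2 R)%type) :
    (sys_poly s x.1 k).[(orbit s x.1 k (orient s x.2)).2]
      - sys_coef s x.1 k * (orbit s x.1 k (orient s x.2)).1 @[x --> p] -->
    (sys_poly s p.1 k).[(orbit s p.1 k (orient s p.2)).2]
      - sys_coef s p.1 k * (orbit s p.1 k (orient s p.2)).1.
  by split; [exact: IH2|exact: H].
apply: cvg_cplxB.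
  have pc i : (sys_poly s x.1 k)`_i @[x --> p] --> (sys_poly s p.1 k)`_i.
    exact: (@cvg_comp _ _ _ (fst : M * C2 R -> M) (fun lam => (sys_poly s lam k)`_i : C)
      _ _ _ cvg_fst (@sys_poly_continuous s k i p.1)).
  apply: (@cvg_horner_coef R _ (nbhs p) _ (sys_deg s k).+3 (fun x => sys_poly s x.1 k)
    (sys_poly s p.1 k) (fun x => (orbit s x.1 k (orient s x.2)).2) _ _ _ pc (IH2 p)).
    by move=> x; rewrite size_sys_poly.
  by rewrite size_sys_poly.
have bc : sys_coef s x.1 k @[x --> p] --> sys_coef s p.1 k.
  exact: (@cvg_comp _ _ _ (fst : M * C2 R -> M) (fun lam => sys_coef s lam k : C)
    _ _ _ cvg_fst (@sys_coef_continuous s k p.1)).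
exact: cvg_cplxM bc (IH1 p).
Qed.

Lemma height_continuous : continuous (height : C2 R -> R).
Proof.
move=> z.
have -> : height = fun w : C2 R => height ((w.1, w.2) : C2 R).
  by apply/funext => -[].
exact: (@cvg_height _ _ (nbhs z) _ fst snd z.1 z.2 cvg_fst cvg_snd).
Qed.

End family.

(** * The Green functions of a Henon family *)

Section family_green.
Context {R : realType} {M : topologicalType} (F : henonFamily R M).
Variable sigma : M -> M.
Hypothesis sigma_cont : continuous sigma.
Local Notation C := (Cplx R).
Local Notation m := (hlen F).
Variable A : R.
Hypothesis T : forall s lam,
  tame A (sys_poly F sigma s lam) (sys_coef F sigma s lam) (sys_deg F s).
Implicit Types (s : sign) (lam : M) (z : C2 R).

Local Notation orbit s lam := (orb (sys_poly F sigma s lam) (sys_coef F sigma s lam)).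
Local Notation pot s lam :=
  (potential (sys_poly F sigma s lam) (sys_coef F sigma s lam) (sys_deg F s)).
Local Notation sgreen s lam :=
  (green (sys_poly F sigma s lam) (sys_coef F sigma s lam) (sys_deg F s)).

Definition family_green s lam z : R := sgreen s lam (orient s z).

Lemma Gn_potential s n lam z :
  `|Gn F sigma s n lam z - pot s lam (n * m) (orient s z)| <= ln 2 / 2 ^+ n.
Proof.
rewrite /Gn /potential total_deg_henon orb_henon_iter height_orient.
set w := henon_iter _ _ _ _ _ _.
have /andP[h1 h2] := log_plus_height w.
have d2 := degree_ge2 F; set d : R := (degree F)%:R in d2 *.
have dn : 2 ^+ n <= d ^+ n by rewrite lerXn2r // nnegrE; lra.
have t0 : 0 < 2 ^+ n :> R by rewrite exprn_gt0.
have dn0 : 0 < d ^+ n by exact: lt_le_trans dn.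
have -> : (d ^+ n)^-1 * log_plus (norm2 w) - ln (height w) / d ^+ n =
    (log_plus (norm2 w) - ln (height w)) / d ^+ n by ring.
rewrite normrM [`|_^-1|]gtr0_norm ?invr_gt0 // ger0_norm; last by lra.
apply: ler_pM; rewrite ?invr_ge0; [lra|exact: ltW|lra|].
by rewrite lef_pV2 ?posrE.
Qed.

Lemma Gn_green B s n lam z : escape_radius A <= B -> height z <= B ->
  `|Gn F sigma s n lam z - family_green s lam z| <= (ln 2 + ln (cmp_const A B)) / 2 ^+ n.
Proof.
move=> rB zB; have h1 := Gn_potential s n lam z.
have zB' : height (orient s z) <= B by rewrite height_orient.
have h2 := potential_green (T s lam) (n * m) rB zB'.
have B1 : 1 <= B by have := escape_radius_ge4 (T s lam); lra.
have c0 := ln_cmp_ge0 (T s lam) B1.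
have h3 : ln (cmp_const A B) / 2 ^+ (n * m) <= ln (cmp_const A B) / 2 ^+ n.
  rewrite ler_wpM2l // lef_pV2 ?posrE ?exprn_gt0 // ler_weXn2l ?ler1n //.
  by rewrite leq_pmulr // hlen_gt0.
rewrite /family_green mulrDl -[X in `|X|](subrKA (pot s lam (n * m) (orient s z))).
by apply: (le_trans (ler_normD _ _)); lra.
Qed.

Lemma Gn_cvg s lam z : Gn F sigma s n lam z @[n --> \oo] --> family_green s lam z.
Proof.
pose B := Num.max (escape_radius A) (height z).
have rB : escape_radius A <= B by rewrite le_max lexx.
have zB : height z <= B by rewrite le_max lexx orbT.
apply/cvgrPdist_lt => eps e0.
have /cvgr0Pnorm_lt /(_ _ e0) := half_pow_cvg0 (ln 2 + ln (cmp_const A B)).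
apply: filterS => n hn; rewrite distrC; apply: (le_lt_trans (Gn_green s n lam rB zB)).
exact: le_lt_trans (ler_norm _) hn.
Qed.

(** Both sides are the limit of d * Gn at the order n + 1. *)
Lemma family_green_functional s lam z :
  (degree F)%:R * family_green s lam z =
  family_green s (sigma lam) (henon_pm F s lam z).
Proof.
have d2 := degree_ge2 F; have d0 : (degree F)%:R != 0 :> R by rewrite gt_eqF //; lra.
have h1 : (degree F)%:R * Gn F sigma s (1 + n)%N lam z @[n --> \oo] -->
    (degree F)%:R * family_green s lam z.
  apply: cvgM; first exact: cvg_cst.
  by apply/(cvg_shift (fun n => Gn F sigma s n lam z)); exact: Gn_cvg.
have h2 := @Gn_cvg s (sigma lam) (henon_pm F s lam z).
have h3 : (degree F)%:R * Gn F sigma s (1 + n)%N lam z @[n --> \oo] -->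
    family_green s (sigma lam) (henon_pm F s lam z).
  apply: cvg_trans h2; apply: near_eq_cvg; apply: nearW => n.
  rewrite /Gn add1n henon_iterSr mulrA; congr (_ * _).
  by rewrite exprS invfM mulrA divff // mul1r.
by rewrite -(cvg_lim (@Rhausdorff R) h1) (cvg_lim (@Rhausdorff R) h3).
Qed.

Lemma potential_joint_continuous s k :
  continuous (fun p : M * C2 R => pot s p.1 k (orient s p.2)).
Proof.
have H (p : (M * C2 R)%type) : pot s x.1 k (orient s x.2) @[x --> p] -->
    pot s p.1 k (orient s p.2).
  have [c1 c2] := orbit_joint_continuous F sigma_cont s k.
  have hc : height (orbit s x.1 k (orient s x.2)) @[x --> p] -->
      height (orbit s p.1 k (orient s p.2)).
    have E x : height (orbit s x.1 k (orient s x.2)) =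
      height (((orbit s x.1 k (orient s x.2)).1, (orbit s x.1 k (orient s x.2)).2) : C2 R).
      by case: (orbit _ _ _ _).
    by rewrite E; under eq_fun do rewrite E; exact: cvg_height (c1 p) (c2 p).
  apply: cvgM; last exact: cvg_cst.
  exact: cvg_comp hc (continuous_ln (height_gt0 _)).
exact: H.
Qed.

(** The potentials are jointly continuous and converge uniformly near each point. *)
Lemma family_green_continuous s : continuous (fun p : M * C2 R => family_green s p.1 p.2).
Proof.
have H (p : (M * C2 R)%type) : {for p, continuous (fun p : M * C2 R => family_green s p.1 p.2)}.
  pose B := Num.max (escape_radius A) (height p.2 + 1).
  have rB : escape_radius A <= B by rewrite le_max lexx.
  apply: (@dyadic_limit_continuous _ _
    (fun j (p : M * C2 R) => pot s p.1 j (orient s p.2)) _ p (ln (cmp_const A B))).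
    by move=> j; exact: potential_joint_continuous.
  have hc : height x.2 @[x --> p] --> height p.2.
    exact: (@cvg_comp _ _ _ (snd : M * C2 R -> C2 R) _ _ _ _ cvg_snd (@height_continuous R p.2)).
  have lt1 : height p.2 < height p.2 + 1 by rewrite ltrDl.
  have near1 : \forall x \near p, height x.2 < height p.2 + 1 by exact: (cvgr_lt _ hc).
  apply: filterS near1 => x hx j; apply: (potential_green (T s x.1)) => //.
  by rewrite height_orient le_max (ltW hx) orbT.
exact: H.
Qed.

Lemma sgreen_continuous s lam : continuous (sgreen s lam : C2 R -> R).
Proof.
move=> z.
have E : sgreen s lam = fun z : C2 R => family_green s lam (orient s z).
  by apply/funext => w; rewrite /family_green orientK.
rewrite E; apply: (@continuous_comp _ _ _ (orient s) (family_green s lam)).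
  exact: orient_continuous.
apply: (@continuous_comp _ _ _ (fun w : C2 R => (lam, w)) (fun p => family_green s p.1 p.2)).
  exact: (@cvg_pair _ M (C2 R) (nbhs (orient s z)) (nbhs lam) (nbhs (orient s z))
    (nbhs_filter _) (nbhs_filter _) (nbhs_filter _) (fun=> lam) id (cvg_cst _) cvg_id).
exact: family_green_continuous.
Qed.

(** Along a bounded orbit the numerators are bounded. *)
Lemma filledK_green s lam z : filledK F sigma s lam z -> family_green s lam z = 0.
Proof.
move=> [B HB]; apply/eqP; rewrite eq_le (green_ge0 (T s lam)) andbT.
have lim : (ln (Num.max 1 B)) / 2 ^+ n @[n --> \oo] --> (0 : R) := half_pow_cvg0 _.
have cv := @Gn_cvg s lam z.
apply: (ler_cvg_to cv lim); apply: nearW => n; rewrite /Gn mulrC.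
have d2 := degree_ge2 F.
have t0 : 0 < 2 ^+ n :> R by rewrite exprn_gt0.
have dn : 2 ^+ n <= (degree F)%:R ^+ n :> R by rewrite lerXn2r // nnegrE; lra.
have dn0 : 0 < (degree F)%:R ^+ n :> R by exact: lt_le_trans dn.
apply: ler_pM; rewrite ?invr_ge0 ?(ltW dn0) //; last by rewrite lef_pV2 ?posrE.
  by rewrite /log_plus le_max lexx orbT.
rewrite /log_plus ge_max; apply/andP; split; last by rewrite ln_ge0 // le_max lexx.
have [n0|n0] := lerP (norm2 (henon_iter F sigma s n lam z)) 0.
  by rewrite ln0 // ln_ge0 // le_max lexx.
by rewrite ler_ln ?posrE // ?lt_max ?ltr01 // le_max HB orbT.
Qed.

(** An orbit that never escapes stays in a ball; an escaping one has a positive Green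
function, which a bounded orbit cannot have. *)
Lemma not_filledK s lam :
  ~` filledK F sigma s lam =
  orient s @^-1` escaping A (sys_poly F sigma s lam) (sys_coef F sigma s lam).
Proof.
apply/seteqP; split=> z /=.
  move=> nK; apply: contrapT => nE; apply: nK.
  pose B := Num.max (escape_radius A) (height (orient s z)).
  have rB : escape_radius A <= B by rewrite le_max lexx.
  have zB : height (orient s z) <= B by rewrite le_max lexx orbT.
  exists (B + B) => n; rewrite -(norm2_orient s) -orb_henon_iter.
  apply: (le_trans (norm2_le _)).
  have [hB|[h1 h2]] := escape_alternative (T s lam) rB zB (n * m).
    by apply: lerD; apply: le_trans hB; [exact: height_ge_fst|exact: height_ge_snd].
  by exfalso; apply: nE; exists (n * m)%N; split=> //; exact: le_trans h2.
move=> [k ek] /filledK_green h0.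
by have := green_gt0 (T s lam) ek; rewrite -/(family_green s lam z) h0 ltxx.
Qed.

Lemma family_green_gt0 s lam z : ~ filledK F sigma s lam z -> 0 < family_green s lam z.
Proof.
move=> nK; have : (~` filledK F sigma s lam) z by [].
by rewrite not_filledK => -[k ek]; exact: (green_gt0 (T s lam) ek).
Qed.

Lemma family_green_eq0 s lam z : family_green s lam z = 0 <-> filledK F sigma s lam z.
Proof.
split; last exact: filledK_green.
by move=> g0; apply: contrapT => /family_green_gt0; rewrite g0 ltxx.
Qed.

Lemma family_green_pluriharmonic s lam :
  pluriharmonic_on (~` filledK F sigma s lam) (family_green s lam).
Proof.
rewrite not_filledK; apply: (@pluriharmonic_orient _ s _ (sgreen s lam)).
by apply: green_pluriharmonic; [exact: T|exact: sgreen_continuous].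
Qed.

Lemma family_green_plurisubharmonic s lam :
  plurisubharmonic (EFin \o family_green s lam).
Proof.
apply: (@plurisubharmonic_orient _ s (EFin \o sgreen s lam)).
by apply: green_plurisubharmonic; [exact: T|exact: sgreen_continuous].
Qed.

Lemma compact_height_bound (S : set (C2 R)) : compact S ->
  exists B, escape_radius A <= B /\ forall z, S z -> height z <= B.
Proof.
move=> Sc; have [B _ HB] := compact_upper_bound (@height_continuous R) Sc.
exists (Num.max (escape_radius A) B); split; first by rewrite le_max lexx.
by move=> z Sz; rewrite le_max HB ?orbT.
Qed.

Lemma Gn_cvg_compact s :
  {family compact, (fun n (p : M * C2 R) => Gn F sigma s n p.1 p.2) @ \oo
     --> (fun p : M * C2 R => family_green s p.1 p.2)}.
Proof.
apply/fam_cvgP => K Kc P /uniform_nbhs[E [+ HP]]; rewrite -entourage_from_ballE => -[eps /= e0 HE].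
have Sc : compact (snd @` K).
  apply: continuous_compact Kc; apply: continuous_subspaceT.
  by move=> p; exact: cvg_snd.
have [B [rB HB]] := compact_height_bound Sc.
have /cvgr0Pnorm_lt /(_ _ e0) := half_pow_cvg0 (ln 2 + ln (cmp_const A B)).
apply: filterS => n hn; apply: HP => p Kp; apply: HE => /=.
rewrite /ball /= distrC; apply: le_lt_trans (le_lt_trans (ler_norm _) hn).
by apply: Gn_green => //; apply: HB; exists p.
Qed.

(** Joint continuity curries to continuity for the compact-open topology, which is the
topology of uniform convergence on compact sets. *)
Lemma family_green_continuous_compact s :
  continuous (family_green s : M -> {family compact, C2 R -> R}).
Proof.
have [c1 c2] := continuous_curry (@family_green_continuous s).
move=> lam; have /compact_open_fam_compactP := c1 lam.
by apply; exact: c2.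
Qed.

End family_green.

Theorem proposition1p1 (R : realType) (M : metricType R) (sigma : M -> M)
    (F : henonFamily R M) (M_compact : compact [set: M])
    (sigma_cont : continuous sigma) :
  exists G : sign -> M -> C2 R -> R,
    (forall s : sign,
      [/\ {family compact, (fun n (p : M * C2 R) => Gn F sigma s n p.1 p.2) @ \oo
             --> (fun p : M * C2 R => G s p.1 p.2)},
          continuous (fun p : M * C2 R => G s p.1 p.2),
          (forall (lam : M) (z : C2 R),
             (degree F)%:R * G s lam z = G s (sigma lam) (henon_pm F s lam z)),
          (forall lam : M,
             [/\ forall z, (~` filledK F sigma s lam) z -> 0 < G s lam z,
                 pluriharmonic_on (~` filledK F sigma s lam) (G s lam),
                 plurisubharmonic (EFin \o G s lam) &
                 forall z, G s lam z = 0 <-> filledK F sigma s lam z]) &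
          continuous (G s : M -> {family compact, C2 R -> R})]) /\
    (set_surj [set: M] [set: M] sigma ->
      forall S : set (C2 R), compact S ->
        exists tau C : R,
          [/\ 0 < tau, 0 < C &
              forall (lam : M) (z z' : C2 R), S z -> S z' ->
                `|G Plus lam z - G Plus lam z'| <= C * norm2 (z - z') `^ tau]).
Proof.
have [A T] := system_tame F sigma M_compact.
exists (family_green F sigma); split.
  move=> s; split.
  - exact: (Gn_cvg_compact T).
  - exact: (family_green_continuous sigma_cont T).
  - by move=> lam z; exact: (family_green_functional T).
  - move=> lam; split.
    + by move=> z; exact: (family_green_gt0 T).
    + exact: (family_green_pluriharmonic sigma_cont T).
    + exact: (family_green_plurisubharmonic sigma_cont T).
    + by move=> z; exact: (family_green_eq0 T).
  - exact: (family_green_continuous_compact sigma_cont T).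
move=> _ S Sc.
have [B [rB HB]] := compact_height_bound A Sc.
(* Over an empty base no fiber provides the inequality 1 <= A. *)
have [lam0|noM] := pselect (exists lam : M, True); last first.
  by exists 1, 1; split=> // lam; exfalso; apply: noM; exists lam.
have A1 : 1 <= A by case: lam0 => lam _; exact: tame_ge1 (T Plus lam).
have [tau [C0 [tau0 C00 H]]] := green_holder A1 rB.
exists tau, C0; split=> // lam z z' Sz Sz'.
by apply: (H _ _ _ (T Plus lam)); exact: HB.
Qed.
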